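(* Let $K\subset S^3$ be the figure-eight knot with knot group $\pi_K$. Then for all integers $n\geq 1$ the character variety $X(\pi_K,\mathrm{SL}(10n,\mathbb{C}))$ has an irreducible component $C$ of dimension at least $4n^2-1$. Moreover, $C$ contains characters of irreducible representations.
   Context: For a knot $K\subset S^3$, let $\pi_K=\pi_1(S^3\setminus\nu K)$, where $\nu K$ is an open tubular neighbourhood of $K$. For a finitely generated group $G=\langle g_1,\dots,g_r\rangle$, the representation variety $R(G,\mathrm{SL}(n,\mathbb{C}))=\mathrm{Hom}(G,\mathrm{SL}(n,\mathbb{C}))\subset \mathrm{SL}(n,\mathbb{C})^r$ is an affine algebraic set (via $\rho\mapsto(\rho(g_1),\dots,\rho(g_r))$) on which $\mathrm{SL}(n,\mathbb{C})$ acts by conjugation. The character variety $X(G,\mathrm{SL}(n,\mathbb{C}))$ is the algebraic (GIT) quotient $R(G,\mathrm{SL}(n,\mathbb{C}))/\!/\mathrm{SL}(n,\mathbb{C})$, an affine algebraic set, not necessarily irreducible. The character of $\rho$ is $\chi_\rho:G\to\mathbb{C}$, $\chi_\rho(\gamma)=\mathrm{tr}(\rho(\gamma))$; the image of $\rho$ in $X(G,\mathrm{SL}(n,\mathbb{C}))$ is identified with $\chi_\rho$. A representation $\rho:G\to\mathrm{GL}(n,\mathbb{C})$ is irreducible if no subspace $V$ with $0\ne V\ne\mathbb{C}^n$ is $\rho(G)$-stable. *)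

(* Defs.v *)
From HB Require Import structures.
From mathcomp Require Import all_boot all_order all_algebra generic_quotient.
From mathcomp Require Import all_classical all_reals ereal topology normedtype.
From mathcomp Require Import complex lra.

Set Implicit Arguments.
Unset Strict Implicit.
Unset Printing Implicit Defensive.

Import Order.TTheory GRing.Theory Num.Theory.
Import numFieldNormedType.Exports.

Local Open Scope classical_set_scope.
Local Open Scope ring_scope.
Local Open Scope quotient_scope.

(** Loops and homotopies are total functions on [R] and [R * R]; only their
    values on the unit interval and on the unit square matter. *)
Record loop (R : realType) (X : topologicalType) (x : X) := Loop {
  loop_fun :> R -> X;
  loop_continuous : {within `[0, 1], continuous loop_fun};
  loop0 : loop_fun 0 = x;
  loop1 : loop_fun 1 = x }.

HB.instance Definition _ R X x := gen_eqMixin (@loop R X x).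
HB.instance Definition _ R X x := gen_choiceMixin (@loop R X x).

Definition loop_homotopic (R : realType) (X : topologicalType) (x : X)
    (a b : loop R x) : Prop :=
  exists H : R * R -> X,
    [/\ {within `[0, 1]%classic `*` `[0, 1]%classic, continuous H},
        forall t, 0 <= t <= 1 -> H (0, t) = a t /\ H (1, t) = b t &
        forall s, 0 <= s <= 1 -> H (s, 0) = x /\ H (s, 1) = x].

Lemma continuous_pair (T U V : topologicalType) (f : T -> U) (g : T -> V) :
  continuous f -> continuous g -> continuous (fun x => (f x, g x)).
Proof. by move=> cf cg x; apply: cvg_pair; [exact: cf | exact: cg]. Qed.

Section clamp.
Context {R : realType}.

Definition clamp (t : R) : R := Num.max 0 (Num.min t 1).

Lemma clamp_in t : 0 <= clamp t <= 1.
Proof.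
by rewrite /clamp le_max lexx /= ge_max ler01 ge_min lexx orbT.
Qed.

Lemma clamp_id t : 0 <= t <= 1 -> clamp t = t.
Proof.
by case/andP=> t0 t1; rewrite /clamp (min_idPl t1) (max_idPr t0).
Qed.

Lemma clamp_continuous : continuous clamp.
Proof.
move=> t; apply: (@continuous_max R R (cst 0) (id \min cst 1)).
  exact: cst_continuous.
by apply: continuous_min; [exact: cvg_id | exact: cst_continuous].
Qed.

Definition clamp2 (p : R * R) : R * R := (clamp p.1, clamp p.2).

Lemma clamp2_continuous : continuous clamp2.
Proof.
apply: continuous_pair => p; apply: continuous_comp.
- exact: cvg_fst.
- exact: clamp_continuous.
- exact: cvg_snd.
- exact: clamp_continuous.
Qed.

End clamp.

Lemma within_retract (T U : topologicalType) (A : set T) (c : T -> T)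
    (f : T -> U) :
  continuous c -> (forall x, A (c x)) -> (forall x, A x -> c x = x) ->
  {within A, continuous f} <-> continuous (f \o c).
Proof.
move=> cc cA cid; split=> [/subspace_continuousP cf x|cf].
- move=> W /(cf _ (cA x)); rewrite /within /= => nW.
  have : nbhs x (c @^-1` [set y | A y -> W (f y)]) by apply: cc; exact: nW.
  by apply: filterS => y /=; apply; exact: cA.
- apply/subspace_continuousP => x Ax W.
  move=> Wfx; have : nbhs x ((f \o c) @^-1` W) by apply: cf; rewrite /= cid.
  by apply: filterS => y /= + Ay; rewrite cid.
Qed.

Section clamp_within.
Context {R : realType} {X : topologicalType}.

Lemma within_clamp (f : R -> X) :
  {within `[0, 1]%classic, continuous f} <-> continuous (f \o clamp).
Proof.
apply: within_retract; first exact: clamp_continuous.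
- by move=> t; rewrite /= in_itv /=; exact: clamp_in.
- by move=> t; rewrite /= in_itv /=; exact: clamp_id.
Qed.

Lemma within_clamp2 (f : R * R -> X) :
  {within `[0, 1]%classic `*` `[0, 1]%classic, continuous f} <->
  continuous (f \o clamp2).
Proof.
apply: within_retract; first exact: clamp2_continuous.
- by move=> t; split; rewrite /= in_itv /=; exact: clamp_in.
- by move=> [s t] [/=]; rewrite !in_itv /= => hs ht; rewrite /clamp2 /= !clamp_id.
Qed.

Lemma glue_continuous (T : topologicalType) (h : T -> R) (a : R)
    (f g : T -> X) :
  continuous h -> continuous f -> continuous g ->
  (forall x, h x = a -> f x = g x) ->
  continuous (fun x => if h x <= a then f x else g x).
Proof.
move=> ch cf cg fg x W.
have [hxa|hax|hxa] := ltgtP (h x) a => Wx.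
- have h1 : \forall y \near x, h y < a := ch x _ (lt_nbhsl hxa).
  have h2 : \forall y \near x, W (f y) := cf x W Wx.
  by apply: filterS2 h1 h2 => y hy; rewrite /= (ltW hy).
- have h1 : \forall y \near x, a < h y := ch x _ (lt_nbhsr hax).
  have h2 : \forall y \near x, W (g y) := cg x W Wx.
  by apply: filterS2 h1 h2 => y hy; rewrite /= leNgt hy.
- have h1 : \forall y \near x, W (f y) := cf x W Wx.
  have h2 : \forall y \near x, W (g y).
    by apply: cg; rewrite -fg.
  by apply: filterS2 h1 h2 => y ? ? /=; case: ifP.
Qed.

End clamp_within.

Section loops.
Context {R : realType} {X : topologicalType} {x : X}.
Implicit Types a b c : loop R x.
Local Notation homotopic := (@loop_homotopic R X x).

Lemma loop_clamp_continuous a : continuous (a \o clamp).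
Proof. exact/within_clamp/loop_continuous. Qed.

Lemma within_eq_continuous (f g : R -> X) :
  (forall t, 0 <= t <= 1 -> f t = g t) -> continuous f ->
  {within `[0, 1]%classic, continuous g}.
Proof.
move=> fg cf; apply: (@subspace_eq_continuous _ _ _ f).
  by move=> t; rewrite inE /= in_itv /=; exact: fg.
exact: continuous_subspaceT.
Qed.

Let half_eq (t : R) : t = 2^-1 -> 2 * t = 1.
Proof. by move=> ->; lra. Qed.

Let affine_continuous (u v : R) : continuous (fun t : R => u * t + v).
Proof.
move=> t; apply: continuousD; last exact: cst_continuous.
by apply: continuousM; [exact: cst_continuous | exact: cvg_id].
Qed.

Let loop_affine_continuous a (u v : R) :
  continuous (fun t : R => (a \o clamp) (u * t + v)).
Proof.
move=> t; apply: (@continuous_comp _ _ _ (fun t : R => u * t + v)).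
  exact: affine_continuous.
exact: loop_clamp_continuous.
Qed.

Let affine1_continuous (K : R * R -> X) (u v : R) :
  continuous K -> continuous (fun p : R * R => K (u * p.1 + v, p.2)).
Proof.
move=> cK p.
apply: (@continuous_comp _ _ _ (fun p : R * R => (u * p.1 + v, p.2))) (cK _).
apply: continuous_pair p => p; last exact: cvg_snd.
apply: (@continuous_comp _ _ _ fst (fun t : R => u * t + v)).
  exact: cvg_fst.
exact: affine_continuous.
Qed.

Let affine2_continuous (K : R * R -> X) (u v : R) :
  continuous K -> continuous (fun p : R * R => K (p.1, u * p.2 + v)).
Proof.
move=> cK p.
apply: (@continuous_comp _ _ _ (fun p : R * R => (p.1, u * p.2 + v))) (cK _).
apply: continuous_pair p => p; first exact: cvg_fst.
apply: (@continuous_comp _ _ _ snd (fun t : R => u * t + v)).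
  exact: cvg_snd.
exact: affine_continuous.
Qed.

Definition concat_fun a b (t : R) : X :=
  if t <= 2^-1 then a (2 * t) else b (2 * t - 1).

Lemma concat_continuous a b :
  {within `[0, 1]%classic, continuous (concat_fun a b)}.
Proof.
apply: (@within_eq_continuous (fun t => if t <= 2^-1
    then (a \o clamp) (2 * t + 0) else (b \o clamp) (2 * t + (-1)))).
  move=> t t01; rewrite /concat_fun /=; case: ifPn => ht.
    by rewrite addr0 clamp_id //; lra.
  by rewrite clamp_id //; lra.
apply: (@glue_continuous R X R id).
- by move=> t; exact: cvg_id.
- exact: loop_affine_continuous.
- exact: loop_affine_continuous.
- move=> t /half_eq /= ->; rewrite addr0 subrr !clamp_id; [|lra|lra].
  by rewrite loop0 loop1.
Qed.

Lemma concat0 a b : concat_fun a b 0 = x.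
Proof. by rewrite /concat_fun ifT ?mulr0 ?loop0 // invr_ge0; lra. Qed.

Lemma concat1 a b : concat_fun a b 1 = x.
Proof.
rewrite /concat_fun ifF; last by apply/negbTE; lra.
by rewrite (_ : 2 * 1 - 1 = 1) ?loop1 //; lra.
Qed.

Definition loop_concat a b : loop R x :=
  Loop (@concat_continuous a b) (concat0 a b) (concat1 a b).

Definition loop_cst : loop R x :=
  @Loop R X x (cst x) (continuous_subspaceT (@cst_continuous _ _ x))
    erefl erefl.

Definition reverse_fun a (t : R) : X := a (1 - t).

Lemma reverse_continuous a :
  {within `[0, 1]%classic, continuous (reverse_fun a)}.
Proof.
apply: (@within_eq_continuous (fun t => (a \o clamp) ((-1) * t + 1))).
  by move=> t t01; rewrite /reverse_fun /= clamp_id; [congr (a _)|]; lra.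
exact: loop_affine_continuous.
Qed.

Lemma reverse0 a : reverse_fun a 0 = x.
Proof. by rewrite /reverse_fun subr0 loop1. Qed.

Lemma reverse1 a : reverse_fun a 1 = x.
Proof. by rewrite /reverse_fun subrr loop0. Qed.

Definition loop_reverse a : loop R x :=
  Loop (@reverse_continuous a) (reverse0 a) (reverse1 a).

Lemma loop_homotopicI (K : R * R -> X) a b :
  continuous K ->
  (forall t, 0 <= t <= 1 -> K (0, t) = a t /\ K (1, t) = b t) ->
  (forall s, 0 <= s <= 1 -> K (s, 0) = x /\ K (s, 1) = x) ->
  homotopic a b.
Proof. by move=> cK K01 Kx; exists K; split => //; exact: continuous_subspaceT. Qed.

Lemma loop_homotopicE a b : homotopic a b ->
  exists K : R * R -> X,
  [/\ continuous K,
     (forall t, K (0, t) = a (clamp t) /\ K (1, t) = b (clamp t)) &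
     (forall s, K (s, 0) = x /\ K (s, 1) = x)].
Proof.
case=> H [/within_clamp2 cH H01 Hx]; exists (H \o clamp2); split => //.
- move=> t; rewrite /= /clamp2 /= (@clamp_id R 0) ?(@clamp_id R 1); [|lra|lra].
  exact/H01/clamp_in.
- move=> s; rewrite /= /clamp2 /= (@clamp_id R 0) ?(@clamp_id R 1); [|lra|lra].
  exact/Hx/clamp_in.
Qed.

Lemma loop_reparam (f g : R -> R) a b c :
  continuous f -> continuous g -> f 0 = g 0 -> f 1 = g 1 ->
  (forall t, 0 <= t <= 1 -> b t = a (clamp (f t))) ->
  (forall t, 0 <= t <= 1 -> c t = a (clamp (g t))) ->
  homotopic b c.
Proof.
move=> cf cg fg0 fg1 bE cE.
pose h (p : R * R) := f p.2 + p.1 * (g p.2 - f p.2).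
have comp2 (k : R -> R) : continuous k -> continuous (k \o snd : R * R -> R).
  by move=> ck p; apply: continuous_comp; [exact: cvg_snd | exact: ck].
have ch : continuous h.
  move=> p; apply: (@continuousD _ _ _ (f \o snd)); first exact: comp2.
  apply: (@continuousM _ _ fst); first exact: cvg_fst.
  by apply: (@continuousB _ _ _ (g \o snd)); exact: comp2.
apply: (@loop_homotopicI ((a \o clamp) \o h)).
- move=> p; apply: continuous_comp; first exact: ch.
  exact: loop_clamp_continuous.
- move=> t t01; rewrite /h /= mul0r addr0 mul1r addrC subrK.
  by rewrite bE // cE.
- move=> s s01; rewrite /h /= fg0 fg1 !subrr !mulr0 !addr0 -!cE ?loop0 ?loop1 //;
  lra.
Qed.

Lemma loop_homotopic_refl a : homotopic a a.
Proof.
apply: (@loop_reparam id id a) => //; try by move=> t; exact: cvg_id.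
- by move=> t t01; rewrite clamp_id.
- by move=> t t01; rewrite clamp_id.
Qed.

Lemma loop_homotopic_sym a b : homotopic a b -> homotopic b a.
Proof.
move=> /loop_homotopicE[K [cK K01 Kx]].
apply: (@loop_homotopicI (fun p => K ((-1) * p.1 + 1, p.2))).
- exact: affine1_continuous.
- move=> t t01 /=; rewrite mulr0 add0r mulr1 addNr.
  by have [-> ->] := K01 t; rewrite clamp_id.
- by move=> s s01 /=; exact: Kx.
Qed.

Lemma loop_homotopic_trans a b c :
  homotopic a b -> homotopic b c -> homotopic a c.
Proof.
move=> /loop_homotopicE[K [cK K01 Kx]] /loop_homotopicE[L [cL L01 Lx]].
apply: (@loop_homotopicI (fun p => if p.1 <= 2^-1
  then K (2 * p.1 + 0, p.2) else L (2 * p.1 + (-1), p.2))).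
- apply: (@glue_continuous R X _ fst).
  + by move=> p; exact: cvg_fst.
  + exact: affine1_continuous.
  + exact: affine1_continuous.
  + move=> [s t] /= /half_eq ->; rewrite addr0 subrr.
    by rewrite (K01 t).2 (L01 t).1.
- move=> t t01 /=; rewrite ifT; last by rewrite invr_ge0; lra.
  rewrite ifF; last by apply/negbTE; lra.
  rewrite mulr0 addr0 (K01 t).1 clamp_id //; split => //.
  by rewrite (_ : 2 * 1 + -1 = 1) ?(L01 t).2 ?clamp_id //; lra.
- move=> s s01 /=; case: ifP => _; first exact: Kx.
  exact: Lx.
Qed.

Lemma loop_concat_homotopic a a' b b' :
  homotopic a a' -> homotopic b b' ->
  homotopic (loop_concat a b) (loop_concat a' b').
Proof.
move=> /loop_homotopicE[K [cK K01 Kx]] /loop_homotopicE[L [cL L01 Lx]].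
apply: (@loop_homotopicI (fun p => if p.2 <= 2^-1
  then K (p.1, 2 * p.2 + 0) else L (p.1, 2 * p.2 + (-1)))).
- apply: (@glue_continuous R X _ snd).
  + by move=> p; exact: cvg_snd.
  + exact: affine2_continuous.
  + exact: affine2_continuous.
  + move=> [s t] /= /half_eq ->; rewrite addr0 subrr.
    by rewrite (Kx s).2 (Lx s).1.
- move=> t t01 /=; rewrite /concat_fun; case: ifPn => ht.
    by rewrite addr0 (K01 _).1 (K01 _).2 clamp_id //; lra.
  by rewrite (L01 _).1 (L01 _).2 clamp_id //; lra.
- move=> s s01 /=; rewrite ifT; last by rewrite invr_ge0; lra.
  rewrite ifF; last by apply/negbTE; lra.
  by rewrite mulr0 addr0 (Kx s).1 (_ : 2 * 1 + -1 = 1) ?(Lx s).2 //; lra.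
Qed.

Lemma loop_reverse_homotopic a b :
  homotopic a b -> homotopic (loop_reverse a) (loop_reverse b).
Proof.
move=> /loop_homotopicE[K [cK K01 Kx]].
apply: (@loop_homotopicI (fun p => K (p.1, (-1) * p.2 + 1))).
- exact: affine2_continuous.
- move=> t t01 /=; rewrite /reverse_fun (K01 _).1 (K01 _).2.
  by rewrite (_ : -1 * t + 1 = 1 - t) ?clamp_id //; lra.
- move=> s s01 /=; rewrite mulr0 add0r mulr1 addNr.
  by rewrite (Kx s).1 (Kx s).2.
Qed.

Let min_cts (f g : R -> R) :
  continuous f -> continuous g -> continuous (fun t => Num.min (f t) (g t)).
Proof. by move=> cf cg t; apply: (@continuous_min R R f g); [exact: cf|exact: cg]. Qed.

Let max_cts (f g : R -> R) :
  continuous f -> continuous g -> continuous (fun t => Num.max (f t) (g t)).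
Proof. by move=> cf cg t; apply: (@continuous_max R R f g); [exact: cf|exact: cg]. Qed.

Let id_cts : continuous (id : R -> R).
Proof. by move=> t; exact: cvg_id. Qed.

Let clamp_idE (t : R) : 0 <= t <= 1 -> t = clamp t.
Proof. by move=> /clamp_id. Qed.

Lemma loop_concatA a b c :
  homotopic (loop_concat a (loop_concat b c)) (loop_concat (loop_concat a b) c).
Proof.
apply: loop_homotopic_sym.
pose f (t : R) :=
  Num.min (2 * t + 0) (Num.min (1 * t + 4^-1) (2^-1 * t + 2^-1)).
apply: (@loop_reparam f id (loop_concat a (loop_concat b c))) => //.
- by do 2?[apply: min_cts]; exact: affine_continuous.
- by rewrite /f; case: (leP (1 * _ + _) _) => ?; case: (leP (2 * _ + _) _) => ?; lra.
- by rewrite /f; case: (leP (1 * _ + _) _) => ?; case: (leP (2 * _ + _) _) => ?; lra.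
- move=> t t01; rewrite clamp_id; last first.
    by rewrite /f; case: (leP (1 * _ + _) _) => ?; case: (leP (2 * _ + _) _) => ?; lra.
  have [t4|t4] := leP t 4^-1.
    have -> : f t = 2 * t.
      by rewrite /f; case: (leP (1 * _ + _) _) => ?; case: (leP (2 * _ + _) _) => ?; lra.
    by rewrite /= /concat_fun /= /concat_fun !ifT //; lra.
  have [t2|t2] := leP t 2^-1.
    have -> : f t = t + 4^-1.
      by rewrite /f; case: (leP (1 * _ + _) _) => ?; case: (leP (2 * _ + _) _) => ?; lra.
    rewrite /= /concat_fun /= /concat_fun ifT // ifF; last by apply/negbTE; lra.
    rewrite ifF; last by apply/negbTE; lra.
    by rewrite ifT; [congr (b _)|]; lra.
  have -> : f t = 2^-1 * t + 2^-1.
    by rewrite /f; case: (leP (1 * _ + _) _) => ?; case: (leP (2 * _ + _) _) => ?; lra.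
  rewrite /= /concat_fun /= /concat_fun ifF; last by apply/negbTE; lra.
  rewrite ifF; last by apply/negbTE; lra.
  rewrite ifF; last by apply/negbTE; lra.
  by congr (c _); lra.
- by move=> t t01; rewrite clamp_id.
Qed.

Lemma loop_concat1l a : homotopic (loop_concat loop_cst a) a.
Proof.
pose f (t : R) := Num.max 0 (2 * t + (-1)).
apply: (@loop_reparam f id a) => //.
- apply: (@max_cts (cst 0)); [exact: cst_continuous|exact: affine_continuous].
- by rewrite /f; case: (leP _ (2 * _ + _)) => ?; lra.
- by rewrite /f; case: (leP _ (2 * _ + _)) => ?; lra.
- move=> t t01; rewrite /= /concat_fun; case: ifPn => ht.
    rewrite (_ : f t = 0) ?clamp_id ?loop0 //; first lra.
    by rewrite /f; case: (leP _ (2 * _ + _)) => ?; lra.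
  rewrite (_ : f t = 2 * t - 1) ?clamp_id //; first lra.
  by rewrite /f; case: (leP _ (2 * _ + _)) => ?; lra.
- by move=> t t01; rewrite clamp_id.
Qed.

Lemma loop_concat1r a : homotopic (loop_concat a loop_cst) a.
Proof.
pose f (t : R) := Num.min 1 (2 * t + 0).
apply: (@loop_reparam f id a) => //.
- apply: (@min_cts (cst 1)); [exact: cst_continuous|exact: affine_continuous].
- by rewrite /f; case: (leP _ (2 * _ + _)) => ?; lra.
- by rewrite /f; case: (leP _ (2 * _ + _)) => ?; lra.
- move=> t t01; rewrite /= /concat_fun; case: ifPn => ht.
    rewrite (_ : f t = 2 * t) ?clamp_id //; first lra.
    by rewrite /f; case: (leP _ (2 * _ + _)) => ?; lra.
  rewrite (_ : f t = 1) ?clamp_id ?loop1 //; first lra.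
  by rewrite /f; case: (leP _ (2 * _ + _)) => ?; lra.
- by move=> t t01; rewrite clamp_id.
Qed.

Lemma loop_concatVl a : homotopic (loop_concat (loop_reverse a) a) loop_cst.
Proof.
pose f (t : R) := Num.max ((-2) * t + 1) (2 * t + (-1)).
apply: (@loop_reparam f (cst 1) a) => //.
- by apply: max_cts; exact: affine_continuous.
- exact: cst_continuous.
- by rewrite /f /cst; case: (leP (_ * _ + _) (_ * _ + _)) => ?; lra.
- by rewrite /f /cst; case: (leP (_ * _ + _) (_ * _ + _)) => ?; lra.
- move=> t t01; rewrite /= /concat_fun; case: ifPn => ht.
    rewrite (_ : f t = 1 - 2 * t) ?clamp_id //; first lra.
    by rewrite /f; case: (leP (_ * _ + _) (_ * _ + _)) => ?; lra.
  rewrite (_ : f t = 2 * t - 1) ?clamp_id //; first lra.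
  by rewrite /f; case: (leP (_ * _ + _) (_ * _ + _)) => ?; lra.
- by move=> t t01; rewrite /= /cst clamp_id ?loop1 //; lra.
Qed.

Lemma loop_concatVr a : homotopic (loop_concat a (loop_reverse a)) loop_cst.
Proof.
pose f (t : R) := Num.min (2 * t + 0) ((-2) * t + 2).
apply: (@loop_reparam f (cst 0) a) => //.
- by apply: min_cts; exact: affine_continuous.
- exact: cst_continuous.
- by rewrite /f /cst; case: (leP (_ * _ + _) (_ * _ + _)) => ?; lra.
- by rewrite /f /cst; case: (leP (_ * _ + _) (_ * _ + _)) => ?; lra.
- move=> t t01; rewrite /= /concat_fun; case: ifPn => ht.
    rewrite (_ : f t = 2 * t) ?clamp_id //; first lra.
    by rewrite /f; case: (leP (_ * _ + _) (_ * _ + _)) => ?; lra.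
  rewrite (_ : f t = 1 - (2 * t - 1)) ?clamp_id //; first lra.
  by rewrite /f; case: (leP (_ * _ + _) (_ * _ + _)) => ?; lra.
- by move=> t t01; rewrite /= /cst clamp_id ?loop0 //; lra.
Qed.

Definition homotopicb a b : bool := `[< homotopic a b >].

Lemma homotopicb_equiv : equiv_class_of homotopicb.
Proof.
apply: EquivClass.
- by move=> a; apply/asboolP; exact: loop_homotopic_refl.
- by move=> a b; apply/asboolP/asboolP; exact: loop_homotopic_sym.
- move=> b a c /asboolP ab /asboolP bc; apply/asboolP.
  exact: loop_homotopic_trans bc.
Qed.

Canonical homotopicb_equiv_rel := EquivRelPack homotopicb_equiv.

End loops.

Definition pi1 (R : realType) (X : topologicalType) (x : X) :=
  {eq_quot @homotopicb R X x}.

HB.instance Definition _ R X x := Choice.on (@pi1 R X x).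
HB.instance Definition _ R X x := EqQuotient.on (@pi1 R X x).

Section pi1_group.
Context {R : realType} {X : topologicalType} {x : X}.
Local Notation G := (@pi1 R X x).
Implicit Types u v w : G.

Definition pi1_one : G := \pi_G loop_cst.
Definition pi1_inv u : G := \pi_G (loop_reverse (repr u)).
Definition pi1_mul u v : G := \pi_G (loop_concat (repr u) (repr v)).

Lemma pi1_eqP (a b : loop R x) :
  \pi_G a = \pi_G b <-> loop_homotopic a b.
Proof. by split=> [/eqquotP/asboolP|ab] //; apply/eqquotP/asboolP. Qed.

Lemma pi1_repr (a : loop R x) : loop_homotopic (repr (\pi_G a)) a.
Proof. by apply/pi1_eqP; rewrite reprK. Qed.

Lemma pi1_mulE (a b : loop R x) :
  pi1_mul (\pi_G a) (\pi_G b) = \pi_G (loop_concat a b).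
Proof. by apply/pi1_eqP/loop_concat_homotopic; exact: pi1_repr. Qed.

Lemma pi1_invE (a : loop R x) : pi1_inv (\pi_G a) = \pi_G (loop_reverse a).
Proof. by apply/pi1_eqP/loop_reverse_homotopic; exact: pi1_repr. Qed.

Lemma pi1_mulA : associative pi1_mul.
Proof.
move=> u v w.
rewrite -[u]reprK -[v]reprK -[w]reprK.
move: (repr u) (repr v) (repr w) => a b c.
rewrite (pi1_mulE b c) (pi1_mulE a b) (pi1_mulE a (loop_concat b c)).
rewrite (pi1_mulE (loop_concat a b) c).
apply/pi1_eqP; exact: loop_concatA.
Qed.

Lemma pi1_mul1g : left_id pi1_one pi1_mul.
Proof. by move=> u; rewrite -[u]reprK; move: (repr u) => a; rewrite ?pi1_mulE; apply/pi1_eqP; exact: loop_concat1l. Qed.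

Lemma pi1_mulg1 : right_id pi1_one pi1_mul.
Proof. by move=> u; rewrite -[u]reprK; move: (repr u) => a; rewrite ?pi1_mulE; apply/pi1_eqP; exact: loop_concat1r. Qed.

Lemma pi1_mulVg : left_inverse pi1_one pi1_inv pi1_mul.
Proof.
move=> u; rewrite -[u]reprK; move: (repr u) => a; rewrite ?pi1_invE pi1_mulE; apply/pi1_eqP; exact: loop_concatVl.
Qed.

Lemma pi1_mulgV : right_inverse pi1_one pi1_inv pi1_mul.
Proof.
move=> u; rewrite -[u]reprK; move: (repr u) => a; rewrite ?pi1_invE pi1_mulE; apply/pi1_eqP; exact: loop_concatVr.
Qed.

HB.instance Definition _ :=
  isGroup.Build G pi1_mulA pi1_mul1g pi1_mulg1 pi1_mulVg pi1_mulgV.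

End pi1_group.

Section figure_eight.
Context (R : realType).
Local Notation R3 := 'rV[R]_3.

Definition lattice_point (p : nat * nat * nat) : R3 :=
  \row_(i < 3) [:: p.1.1%:R; p.1.2%:R; p.2%:R]`_i.

Definition segment (a b : R3) : set R3 :=
  [set (1 - t) *: a + t *: b | t in `[0, 1]%classic].

(** The closed polygon through the points of [vs], in this cyclic order. *)
Definition closed_polygon (vs : seq R3) : set R3 :=
  \bigcup_(e in [set` zip vs (rot 1 vs)]) segment e.1 e.2.

(** A lattice polygon built from a 6 x 6 grid diagram: the edges parallel to
    the second axis lie at height 1, those parallel to the first axis at height
    0, and unit vertical edges join them at the corners.  Viewed from above it
    has four crossings, at (2,5), (4,4), (3,3) and (5,2); following the list
    they are met in the order
      (2,5) under, (4,4) over, (3,3) under, (2,5) over,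
      (5,2) under, (3,3) over, (4,4) under, (5,2) over,
    that is, the alternating four-crossing diagram of the figure-eight knot
    with Gauss code 1 2 3 1 4 3 2 4. *)
Definition figure_eight_vertices : seq (nat * nat * nat) :=
  [:: (1, 1, 1); (1, 5, 1); (1, 5, 0); (4, 5, 0);
      (4, 5, 1); (4, 3, 1); (4, 3, 0); (2, 3, 0);
      (2, 3, 1); (2, 6, 1); (2, 6, 0); (6, 6, 0);
      (6, 6, 1); (6, 2, 1); (6, 2, 0); (3, 2, 0);
      (3, 2, 1); (3, 4, 1); (3, 4, 0); (5, 4, 0);
      (5, 4, 1); (5, 1, 1); (5, 1, 0); (1, 1, 0)]%N.

Definition figure_eight : set R3 :=
  closed_polygon (map lattice_point figure_eight_vertices).

Definition S3 := one_point_compactification R3.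

HB.instance Definition _ := Topological.on S3.

(** Distances are measured in the maximum norm of [R3].  Two disjoint edges of
    the polygon are at distance at least 1, so the points at distance less than
    1/4 from it form an open tubular neighbourhood (an open solid torus, made
    of one box around each edge, whose core is the knot). *)
Definition figure_eight_nbhd : set S3 :=
  Some @` [set x : R3 | exists2 y, figure_eight y & `|x - y| < 4^-1].

Definition figure_eight_exterior : topologicalType :=
  set_type (~` figure_eight_nbhd).

Lemma coord_le_norm (x : R3) (i : 'I_3) : `|x 0 i| <= `|x|.
Proof.
rewrite /Num.norm /= mx_normrE.
by rewrite (le_bigmax _ (fun ij : 'I_1 * 'I_3 => `|x ij.1 ij.2|) (0, i)).
Qed.

Lemma figure_eight_height (y : R3) : figure_eight y -> y 0 ord_max <= 1.
Proof.
case=> -[a b] /= abP.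
set vs := map lattice_point figure_eight_vertices in abP.
have : a \in vs.
  rewrite -(@unzip1_zip _ _ vs (rot 1 vs)) ?size_rot //.
  exact: (map_f fst abP).
have : b \in vs.
  rewrite -(mem_rot 1) -(@unzip2_zip _ _ vs (rot 1 vs)) ?size_rot //.
  exact: (map_f snd abP).
move=> /mapP[q qP ->] /mapP[p pP ->] [t /=].
rewrite in_itv /= => /andP[t0 t1] <-.
have height (r : nat * nat * nat) :
    r \in figure_eight_vertices -> (r.2%:R : R) <= 1.
  move=> rP; have /allP /(_ r rP) : all (fun r => r.2 <= 1)%N
    figure_eight_vertices by [].
  by rewrite -(ler_nat R).
have := height p pP; have := height q qP; rewrite !mxE /= => hq hp.
by nra.
Qed.

Definition viewpoint : R3 := lattice_point (0, 0, 2)%N.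

Lemma viewpoint_exterior :
  (Some viewpoint : S3) \in ~` figure_eight_nbhd.
Proof.
rewrite inE => -[v [y /figure_eight_height hy vy] [vE]]; move: vy; rewrite vE.
apply/negP; rewrite -leNgt; apply: le_trans (coord_le_norm _ ord_max).
rewrite !mxE /=; rewrite ger0_norm; lra.
Qed.

Definition figure_eight_base : figure_eight_exterior :=
  exist _ (Some viewpoint : S3) viewpoint_exterior.

Definition figure_eight_group : groupType := @pi1 R _ figure_eight_base.

End figure_eight.

Section representations.
Context (F : fieldType) (G : groupType) (N : nat).

Record SLrep := MkSLrep {
  rep_mx :> G -> 'M[F]_N;
  rep_det : forall g, \det (rep_mx g) = 1;
  repM : forall g h, rep_mx (g * h)%g = rep_mx g *m rep_mx h }.

HB.instance Definition _ := gen_eqMixin SLrep.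
HB.instance Definition _ := gen_choiceMixin SLrep.

Definition irreducible_rep (rho : SLrep) : Prop :=
  forall V : {vspace 'cV[F]_N},
    (forall g v, v \in V -> rho g *m v \in V) -> V = 0%VS \/ V = fullv.

(** The coordinate ring of [Hom(G, SL(N, F))], as a ring of functions: it is
    generated by the matrix entries of all the [rho g].  When [g_1, ..., g_r]
    generate [G], the entries of the [rho g_i] already generate it (the
    determinants being 1, inverses are polynomial in the entries), so these are
    the polynomial functions for the embedding
    [rho |-> (rho g_1, ..., rho g_r)]; no choice of generators is needed. *)
Inductive regular_fun : (SLrep -> F) -> Prop :=
| regular_const c : regular_fun (fun=> c)
| regular_entry g i j : regular_fun (fun rho => rho g i j)
| regular_add f1 f2 : regular_fun f1 -> regular_fun f2 ->
    regular_fun (fun rho => f1 rho + f2 rho)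
| regular_mul f1 f2 : regular_fun f1 -> regular_fun f2 ->
    regular_fun (fun rho => f1 rho * f2 rho).

Definition SL_conjugate (rho rho' : SLrep) : Prop :=
  exists2 P : 'M[F]_N, \det P = 1 &
    forall g, rho' g = P *m rho g *m invmx P.

Definition SL_invariant (f : SLrep -> F) : Prop :=
  forall rho rho', SL_conjugate rho rho' -> f rho' = f rho.

(** The points of the quotient [Hom(G, SL(N, F)) // SL(N, F)] are the classes
    of representations that invariant regular functions do not separate. *)
Definition git_equivb (rho rho' : SLrep) : bool :=
  `[< forall f, regular_fun f -> SL_invariant f -> f rho = f rho' >].

Lemma git_equivb_equiv : equiv_class_of git_equivb.
Proof.
apply: EquivClass.
- by move=> rho; apply/asboolP.
- by move=> rho rho'; apply/asboolP/asboolP => h f rf sf; rewrite h.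
- move=> rho' rho rho'' /asboolP h1 /asboolP h2.
  by apply/asboolP => f rf sf; rewrite h1 // h2.
Qed.

Canonical git_equivb_equiv_rel := EquivRelPack git_equivb_equiv.

Definition char_variety := {eq_quot git_equivb}.

HB.instance Definition _ := Choice.on char_variety.
HB.instance Definition _ := EqQuotient.on char_variety.

(** The image of [rho] in the quotient, i.e. its character. *)
Definition character (rho : SLrep) : char_variety := \pi_char_variety rho.

(** The coordinate ring of the quotient: pulling back along [character]
    identifies it with the ring of invariant regular functions. *)
Definition char_regular (f : char_variety -> F) : Prop :=
  regular_fun (f \o character).

Definition zariski_closed (Z : set char_variety) : Prop :=
  exists2 S : set (char_variety -> F), S `<=` char_regular &
    Z = [set x | forall f, S f -> f x = 0].

Definition irreducible_closed (Z : set char_variety) : Prop :=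
  [/\ zariski_closed Z, Z !=set0 &
      forall Z1 Z2, zariski_closed Z1 -> zariski_closed Z2 ->
        Z `<=` Z1 `|` Z2 -> Z `<=` Z1 \/ Z `<=` Z2].

Definition irreducible_component (C : set char_variety) : Prop :=
  irreducible_closed C /\
  forall Z, irreducible_closed Z -> C `<=` Z -> Z = C.

(** The Krull dimension of [C]: the supremum of the lengths [k] of the chains
    [Z_0 < Z_1 < ... < Z_k] of irreducible closed subsets of [C]. *)
Definition krull_dim (R : realType) (C : set char_variety) : \bar R :=
  ereal_sup [set k%:R%:E | k in [set k : nat |
    exists Z : nat -> set char_variety,
      (forall i, (i <= k)%N -> irreducible_closed (Z i) /\ Z i `<=` C) /\
      (forall i, (i < k)%N -> Z i `<` Z i.+1)]].

End representations.

(* Main.v *)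
(** Put [m = 2n].  The fundamental group of the irregular dihedral 5-fold covering
    of the figure-eight exterior becomes free of rank 2 when the meridian around
    the unbranched lift of the knot is killed.  Inducing a representation of this
    free group, given by two matrices [A] and [B] of [GL_m], produces a
    representation of the knot group by 5 x 5 block monomial matrices, of
    determinant 1 as soon as [det A * det B = 1].

    The square of a meridian acts as the identity on one block.  A product of
    four such squares minus 1 therefore lives in a single block, where it takes
    values [(A-1) u (A-1) v (B-1) w (B-1)].  For a fixed diagonal [A] the traces of
    these elements of the group ring give back all entries of [B], normalised so
    that its first row is [(x, 1, .., 1)]; after that the eigenvalues of [A] are
    detected by characteristic polynomials.  Freeing one parameter after the
    other yields a chain of [m^2 = 4n^2] strict inclusions between irreducible
    closed sets (closures of images of rational families), all containing the
    character of one irreducible representation; a maximal irreducible closed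
    set above them is the required component.

    Homomorphisms out of the topological fundamental group come from discrete
    Alexander-Spanier cocycles: walls hang down from the edges of the grid
    diagram at height 1 to a floor at height 0, and crossing them multiplies by
    the labels of the Neuwirth presentation of the diagram. *)

Require Import Defs.
From HB Require Import structures.
From mathcomp Require Import all_boot all_order all_algebra generic_quotient.
From mathcomp Require Import all_classical all_reals ereal topology normedtype.
From mathcomp Require Import complex mxtens zify ring lra.

Set Implicit Arguments.
Unset Strict Implicit.
Unset Printing Implicit Defensive.

Import Order.TTheory GRing.Theory Num.Theory.
Import numFieldNormedType.Exports.

Local Open Scope classical_set_scope.
Local Open Scope ring_scope.
Local Open Scope quotient_scope.

(** * Irreducible closed sets of the character variety *)

Section char_variety_geometry.
Context {F : fieldType} {G : groupType} {N : nat}.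
Local Notation X := (char_variety F G N).
Local Notation Rep := (SLrep F G N).
Implicit Types (Z A : set X) (phi : Rep -> F).

Definition zariski_closure A : set X :=
  [set x | forall f, char_regular f -> (forall a, A a -> f a = 0) -> f x = 0].

Lemma zariski_closure_closed A : zariski_closed (zariski_closure A).
Proof.
exists [set f | char_regular f /\ forall a, A a -> f a = 0] => [f []//|].
by apply/seteqP; split=> x hx f; [case=> ? ?; exact: hx | move=> rf fA; exact: hx].
Qed.

Lemma sub_zariski_closure A : A `<=` zariski_closure A.
Proof. by move=> x Ax f _; exact. Qed.

Lemma zariski_closure_min A Z :
  zariski_closed Z -> A `<=` Z -> zariski_closure A `<=` Z.
Proof.
move=> [S SR ->] AS x xA f Sf; apply: xA => [|a Aa]; first exact: SR.
exact: AS.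
Qed.

(** Stated for arbitrary sets, so that it applies to images of parameter families and to unions of
    chains. *)
Definition irreducible_set A : Prop :=
  A !=set0 /\ forall Z1 Z2, zariski_closed Z1 -> zariski_closed Z2 ->
    A `<=` Z1 `|` Z2 -> A `<=` Z1 \/ A `<=` Z2.

(** If neither closed set contains [A], each system of equations has a member that is nonzero
    somewhere on [A]; a point of [A] where both are nonzero lies in neither closed set. *)
Lemma irreducible_setP A : A !=set0 ->
  (forall f1 f2 a1 a2, char_regular f1 -> char_regular f2 -> A a1 -> A a2 ->
    f1 a1 != 0 -> f2 a2 != 0 ->
    exists a, [/\ A a, f1 a != 0 & f2 a != 0]) ->
  irreducible_set A.
Proof.
move=> A0 irr; split=> // Z1 Z2 [S1 R1 ->] [S2 R2 ->] AZ.
apply: contrapT => /not_orP[/existsNP[a1 n1] /existsNP[a2 n2]].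
move/not_implyP: n1 => -[Aa1 /existsNP[f1 /not_implyP[Sf1 /eqP f1a]]].
move/not_implyP: n2 => -[Aa2 /existsNP[f2 /not_implyP[Sf2 /eqP f2a]]].
have [a [Aa fa1 fa2]] := irr _ _ _ _ (R1 _ Sf1) (R2 _ Sf2) Aa1 Aa2 f1a f2a.
by case: (AZ _ Aa) => h; [move: fa1 | move: fa2]; rewrite h ?eqxx.
Qed.

Lemma irreducible_closure A :
  irreducible_set A -> irreducible_closed (zariski_closure A).
Proof.
move=> [[a Aa] irr]; split; first exact: zariski_closure_closed.
  by exists a; exact: sub_zariski_closure.
move=> Z1 Z2 c1 c2 h.
have [AZ|AZ] := irr _ _ c1 c2 (subset_trans (@sub_zariski_closure A) h).
- by left; exact: zariski_closure_min.
- by right; exact: zariski_closure_min.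
Qed.

(** Zorn's lemma on the irreducible sets above [Z]. The closure of a maximal one is again a
    candidate, so the maximal one is closed. *)
Lemma irreducible_component_exists Z : irreducible_closed Z ->
  exists C, irreducible_component C /\ Z `<=` C.
Proof.
move=> iZ; have [_ Z0 irrZ] := iZ.
pose P A := A = set0 \/ irreducible_set A /\ Z `<=` A.
have PZ : P Z by right; split=> //; split.
have [|A [PA Amax]] := @Zorn_bigcup _ P.
- move=> K KP Ktot.
  have [[A0 [KA0 A0n]]|K0] := pselect (exists A, K A /\ A <> set0); last first.
    left; apply/seteqP; split=> // x [A KA Ax]; apply: K0; exists A; split=> //.
    by move=> A0; rewrite A0 in Ax.
  right; have [//|[[A0ne _] ZA0]] := KP _ KA0.
  split; last by apply: subset_trans ZA0 _; exact: bigcup_sup.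
  split; first by have [a A0a] := A0ne; exists a, A0.
  move=> Z1 Z2 c1 c2 KZ.
  have dich A : K A -> A `<=` Z1 \/ A `<=` Z2.
    move=> KA; have [->|[[_ iA] _]] := KP _ KA; first by left.
    by apply: iA => //; apply: subset_trans KZ; exact: bigcup_sup.
  (* If a member [A1] is not inside [Z1], the members above it escape [Z1] too and those below it
     lie in [A1]; all therefore lie in [Z2]. *)
  have [all1|/existsNP[A1 /not_implyP[KA1 nA1]]] :=
    pselect (forall A, K A -> A `<=` Z1).
    by left; exact: bigcup_sub.
  right; apply: bigcup_sub => A KA.
  have [A1A|AA1] := Ktot _ _ KA1 KA.
    have [AZ1|//] := dich _ KA.
    by exfalso; apply: nA1; exact: subset_trans AZ1.
  by apply: subset_trans AA1 _; case: (dich _ KA1).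
have maxA B : P B -> A `<=` B -> B = A.
  move=> PB AB; apply/seteqP; split=> //; apply: contrapT => BA.
  by apply: (Amax B) PB; split.
case: PA => [A0|[iA ZA]].
  have := maxA _ PZ; rewrite A0 => /(_ (@sub0set _ _)) Z00.
  by case: Z0 => z; rewrite Z00.
have iclA := irreducible_closure iA.
have clA : zariski_closure A = A.
  apply: maxA; last exact: sub_zariski_closure.
  have [_ ? ?] := iclA; right; split=> //.
  by apply: subset_trans ZA _; exact: sub_zariski_closure.
exists A; split=> //; split=> [|B [_ B0 iB] AB]; first by rewrite -clA.
by apply: maxA => //; right; split=> //; exact: subset_trans AB.
Qed.

Lemma krull_dim_ge (R : realType) (C : set X) (d : nat) (Z : nat -> set X) :
  (forall i, (i <= d)%N -> irreducible_closed (Z i) /\ Z i `<=` C) ->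
  (forall i, (i < d)%N -> Z i `<` Z i.+1) ->
  ((d%:R : R)%:E <= krull_dim R C)%E.
Proof. by move=> Zi Zlt; apply: ereal_sup_ubound; exists d => //; exists Z. Qed.

Definition invariant_fun phi : Prop := regular_fun phi /\ SL_invariant phi.

Definition char_fun phi : X -> F := phi \o repr.

Lemma char_funE phi rho : invariant_fun phi ->
  char_fun phi (character rho) = phi rho.
Proof.
move=> [rphi iphi]; rewrite /char_fun /=.
have /eqquotP/asboolP : \pi_X (repr (character rho)) = \pi_X rho.
  by rewrite reprK.
exact.
Qed.

Lemma char_fun_regular phi : invariant_fun phi -> char_regular (char_fun phi).
Proof.
move=> iphi; rewrite /char_regular.
have -> : char_fun phi \o @character F G N = phi.
  by apply/funext => rho; exact: char_funE.
exact: iphi.1.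
Qed.

Lemma regular_sum (I : Type) (r : seq I) (P : pred I) (f : I -> Rep -> F) :
  (forall i, P i -> regular_fun (f i)) ->
  regular_fun (fun rho => \sum_(i <- r | P i) f i rho).
Proof.
move=> rf; elim: r => [|i r IH].
  rewrite (_ : (fun _ => _) = fun=> 0); first exact: regular_const.
  by apply/funext => rho; rewrite big_nil.
case Pi: (P i); last first.
  by under eq_fun do rewrite big_cons Pi.
under eq_fun do rewrite big_cons Pi.
by apply: regular_add => //; exact: rf.
Qed.

Lemma regular_prod (I : Type) (r : seq I) (f : I -> Rep -> F) :
  (forall i, regular_fun (f i)) ->
  regular_fun (fun rho => \prod_(i <- r) f i rho).
Proof.
move=> rf; elim: r => [|i r IH].
  under eq_fun do rewrite big_nil.
  exact: regular_const.
under eq_fun do rewrite big_cons.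
exact: regular_mul.
Qed.

(** An axiomatic form of the matrix-valued functions that the elements of the
    group algebra of [G] induce on the representations. *)
Definition group_alg (phi : Rep -> 'M[F]_N) : Prop :=
  [/\ forall i j, regular_fun (fun rho => phi rho i j),
      forall (rho rho' : Rep) (P : 'M[F]_N), \det P = 1 ->
        (forall g, rho' g = P *m rho g *m invmx P) ->
        phi rho' = P *m phi rho *m invmx P &
      forall (rho : Rep) (V : {vspace 'cV[F]_N}),
        (forall g v, v \in V -> rho g *m v \in V) ->
        forall v, v \in V -> phi rho *m v \in V].

Let det1_unit (P : 'M[F]_N) : \det P = 1 -> P \in unitmx.
Proof. by move=> dP; rewrite unitmxE dP unitr1. Qed.

Lemma group_alg_rep g : group_alg (fun rho => rho g).
Proof.
split=> [i j|rho rho' P _ ->//|rho V sV v]; first exact: regular_entry.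
exact: sV.
Qed.

Lemma group_alg_scalar c : group_alg (fun=> c%:M).
Proof.
split=> [i j|rho rho' P dP _|rho V _ v vV]; first exact: regular_const.
  by rewrite scalar_mxC -mulmxA mulmxV ?mulmx1 // det1_unit.
by rewrite mul_scalar_mx memvZ.
Qed.

Lemma group_alg_add (phi psi : Rep -> 'M[F]_N) : group_alg phi -> group_alg psi ->
  group_alg (fun rho => phi rho + psi rho).
Proof.
move=> [r1 e1 s1] [r2 e2 s2]; split=> [i j|rho rho' P dP h|rho V sV v vV].
- by under eq_fun do rewrite mxE; exact: regular_add.
- by rewrite (e1 _ _ _ dP h) (e2 _ _ _ dP h) mulmxDr mulmxDl.
- by rewrite mulmxDl memvD ?(s1 _ _ sV) ?(s2 _ _ sV).
Qed.

Lemma group_alg_mul (phi psi : Rep -> 'M[F]_N) : group_alg phi -> group_alg psi ->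
  group_alg (fun rho => phi rho *m psi rho).
Proof.
move=> [r1 e1 s1] [r2 e2 s2]; split=> [i j|rho rho' P dP h|rho V sV v vV].
- under eq_fun do rewrite mxE.
  by apply: regular_sum => k _; exact: regular_mul.
- by rewrite (e1 _ _ _ dP h) (e2 _ _ _ dP h) !mulmxA mulmxKV ?det1_unit.
- by rewrite -mulmxA (s1 _ _ sV) ?(s2 _ _ sV).
Qed.

Lemma group_alg_prod (I : Type) (r : seq I) (f : I -> Rep -> 'M[F]_N) :
  (forall i, group_alg (f i)) ->
  group_alg (fun rho => \big[mulmx/1%:M]_(i <- r) f i rho).
Proof.
move=> rf; elim: r => [|i r IH].
  under eq_fun do rewrite big_nil.
  exact: group_alg_scalar.
under eq_fun do rewrite big_cons.
exact: group_alg_mul.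
Qed.

Lemma group_alg_trace (phi : Rep -> 'M[F]_N) :
  group_alg phi -> invariant_fun (fun rho => \tr (phi rho)).
Proof.
move=> [r e _]; split; first exact: regular_sum.
move=> rho rho' [P dP h]; rewrite (e _ _ _ dP h) mxtrace_mulC mulmxA mulVmx.
  by rewrite mul1mx.
exact: det1_unit.
Qed.

Lemma group_alg_det (phi : Rep -> 'M[F]_N) :
  group_alg phi -> invariant_fun (fun rho => \det (phi rho)).
Proof.
move=> [r e _]; split.
  apply: regular_sum => s _; apply: regular_mul; first exact: regular_const.
  exact: regular_prod.
move=> rho rho' [P dP h]; rewrite (e _ _ _ dP h) !det_mulmx mulrAC -det_mulmx.
by rewrite mulmxV ?det1 ?mul1r // det1_unit.
Qed.

End char_variety_geometry.

(** * Rational curves of representations and irreducibility of their families *)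

Section rational_curves.
Context {F : numFieldType} {G : groupType} {N : nat}.
Implicit Types (D : {poly F}) (f g : F -> F).

(** The elements of [F[t][1/D]], as functions off the zeros of [D]; a common [D] keeps sums and
    products in the class. *)
Definition fraction_fun D f : Prop :=
  exists (P : {poly F}) (e : nat), forall t, D.[t] != 0 ->
    f t = P.[t] / D.[t] ^+ e.

Lemma fraction_poly D (P : {poly F}) : fraction_fun D (horner P).
Proof. by exists P, 0%N => t _; rewrite expr0 divr1. Qed.

Lemma fraction_ext D f g : (forall t, D.[t] != 0 -> f t = g t) ->
  fraction_fun D f -> fraction_fun D g.
Proof. by move=> fg [P [e h]]; exists P, e => t Dt; rewrite -fg ?h. Qed.

Lemma fraction_const D c : fraction_fun D (fun=> c).
Proof. by apply: fraction_ext (fraction_poly D c%:P) => t _; rewrite hornerC. Qed.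

Lemma fraction_add D f g :
  fraction_fun D f -> fraction_fun D g -> fraction_fun D (fun t => f t + g t).
Proof.
move=> [P [e hP]] [Q [k hQ]]; exists (P * D ^+ k + Q * D ^+ e), (e + k)%N => t Dt.
by rewrite hP ?hQ // !hornerE addf_div ?expf_neq0 // exprD.
Qed.

Lemma fraction_mul D f g :
  fraction_fun D f -> fraction_fun D g -> fraction_fun D (fun t => f t * g t).
Proof.
move=> [P [e hP]] [Q [k hQ]]; exists (P * Q), (e + k)%N => t Dt.
by rewrite hP ?hQ // hornerM exprD mulf_div.
Qed.

Lemma fraction_inv D : fraction_fun D (fun t => (D.[t])^-1).
Proof. by exists 1, 1%N => t _; rewrite hornerE expr1 div1r. Qed.

Lemma fraction_sum D (I : Type) (r : seq I) (P : pred I) (f : I -> F -> F) :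
  (forall i, fraction_fun D (f i)) ->
  fraction_fun D (fun t => \sum_(i <- r | P i) f i t).
Proof.
move=> ff; elim: r => [|i r IH].
  by under eq_fun do rewrite big_nil; exact: fraction_const.
under eq_fun do rewrite big_cons.
by case: (P i) => //; exact: fraction_add.
Qed.

Lemma fraction_prod D (I : Type) (r : seq I) (P : pred I) (f : I -> F -> F) :
  (forall i, fraction_fun D (f i)) ->
  fraction_fun D (fun t => \prod_(i <- r | P i) f i t).
Proof.
move=> ff; elim: r => [|i r IH].
  by under eq_fun do rewrite big_nil; exact: fraction_const.
under eq_fun do rewrite big_cons.
by case: (P i) => //; exact: fraction_mul.
Qed.

(** In characteristic zero the naturals below [size P] are distinct, and [P] has fewer roots than
    that. *)
Lemma nonroot_exists (P : {poly F}) : P != 0 -> exists t, P.[t] != 0.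
Proof.
move=> P0; pose rs : seq F := [seq i%:R | i <- iota 0 (size P)].
have urs : uniq rs.
  by rewrite map_inj_uniq ?iota_uniq // => i j /eqP; rewrite eqr_nat => /eqP.
have [/(max_poly_roots P0)/(_ urs)|/allPn[t _ /negP Pt]] := boolP (all (root P) rs).
  by rewrite size_map size_iota ltnn.
by exists t; apply/negP => h; exact: Pt.
Qed.

Lemma regular_fun_curve (rho : F -> SLrep F G N) D phi :
  (forall (x : G) i j, fraction_fun D (fun t => rho t x i j)) ->
  regular_fun phi -> fraction_fun D (fun t => phi (rho t)).
Proof.
move=> h; elim=> [c|g i j|f1 f2 _ h1 _ h2|f1 f2 _ h1 _ h2].
- exact: fraction_const.
- exact: h.
- exact: fraction_add.
- exact: fraction_mul.
Qed.

(** A rational curve joins a parameter where [f1] is nonzero to one where [f2] is nonzero. Along it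
    both are fractions with nonzero numerators, so any point off the roots of these numerators and
    of [D] serves both. *)
Lemma irreducible_rational (T : Type) (L : set T) (rho : T -> SLrep F G N) :
  L !=set0 ->
  (forall p q, L p -> L q -> exists (c : F -> T) D,
    [/\ c 0 = p, c 1 = q, D.[0] != 0 /\ D.[1] != 0,
        forall t, D.[t] != 0 -> L (c t) &
        forall (x : G) i j, fraction_fun D (fun t => rho (c t) x i j)]) ->
  irreducible_set [set character (rho t) | t in L].
Proof.
move=> [p0 Lp0] curve; apply: irreducible_setP.
  by exists (character (rho p0)), p0.
move=> f1 f2 _ _ r1 r2 [p Lp <-] [q Lq <-] f1p f2q.
have [c [D [cp cq [D0 D1] cL cr]]] := curve _ _ Lp Lq.
have [P1 [e1 h1]] := regular_fun_curve cr r1.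
have [P2 [e2 h2]] := regular_fun_curve cr r2.
have nz0 (P : {poly F}) t : P.[t] != 0 -> P != 0.
  by apply: contra_neq => ->; rewrite horner0.
have P1n : P1 != 0.
  apply: (nz0 _ 0); apply: contraNneq f1p => P0.
  by have /= := h1 0 D0; rewrite cp P0 mul0r => ->.
have P2n : P2 != 0.
  apply: (nz0 _ 1); apply: contraNneq f2q => P0.
  by have /= := h2 1 D1; rewrite cq P0 mul0r => ->.
have [t] : exists t, (P1 * P2 * D).[t] != 0.
  by apply: nonroot_exists; rewrite !mulf_neq0 // (nz0 _ _ D0).
rewrite !hornerE !mulf_eq0 !negb_or => /andP[/andP[P1t P2t] Dt].
exists (character (rho (c t))); split; first by exists (c t) => //; exact: cL.
- by have /= -> := h1 t Dt; rewrite mulf_neq0 ?invr_neq0 ?expf_neq0.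
- by have /= -> := h2 t Dt; rewrite mulf_neq0 ?invr_neq0 ?expf_neq0.
Qed.

End rational_curves.

(** * Holonomy of discrete cocycles *)

Section holonomy_of_loops.
Context {R : realType} {X : topologicalType} {I : Type} {A : pzRingType}.
Variable c : I -> X -> X -> A.

(** Discrete Alexander-Spanier cocycles: [c] need not be continuous, it only
    has to be multiplicative on a neighbourhood of each point. *)
Definition flat_on (U : set X) : Prop :=
  forall i, (forall p, U p -> c i p p = 1) /\
    forall p q r, U p -> U q -> U r -> c i p q * c i q r = c i p r.

Definition locally_flat : Prop :=
  forall x : X, exists2 U : set X, flat_on U & nbhs x U.

Fixpoint chain i (p : nat -> X) (n : nat) : A :=
  if n is n'.+1 then chain i p n' * c i (p n') (p n'.+1) else 1.

Lemma chain_cat i p m n :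
  chain i p (m + n) = chain i p m * chain i (fun k => p (m + k)%N) n.
Proof. by elim: n => [|n IH]; rewrite ?addn0 ?mulr1 // addnS /= IH mulrA addnS. Qed.

Lemma eq_chain i p q n :
  (forall k, (k <= n)%N -> p k = q k) -> chain i p n = chain i q n.
Proof.
elim: n => //= n IH pq; rewrite IH => [|k kn]; last by apply: pq; lia.
by rewrite !pq.
Qed.

Lemma chain_flat i U p n : flat_on U ->
  (forall k, (k <= n)%N -> U (p k)) -> chain i p n = c i (p 0%N) (p n).
Proof.
move=> fU; elim: n => [|n IH] Up /=; first by rewrite (fU i).1 //; exact: Up.
rewrite IH => [|k kn]; last by apply: Up; lia.
by rewrite (fU i).2 //; apply: Up; lia.
Qed.

Definition holonomy i (N : nat) (u : R -> X) : A :=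
  chain i (fun k => u (k%:R / N%:R)) N.

Definition fine (N : nat) (u : R -> X) : Prop :=
  forall k, (k < N)%N -> exists2 U : set X, flat_on U &
    forall t, k%:R / N%:R <= t <= k.+1%:R / N%:R -> U (u t).

(** On each of the [N] intervals the path stays in a flat set, where [M] successive transports
    collapse to one. *)
Lemma hol_refine i N M u : (0 < M)%N -> fine N u ->
  holonomy i (N * M) u = holonomy i N u.
Proof.
move=> M0 fN; rewrite /holonomy.
have [->|N0] := posnP N; first by [].
have MR : (0 : R) < M%:R by rewrite ltr0n.
have NR : (0 : R) < N%:R by rewrite ltr0n.
set q := fun k => u (k%:R / (N * M)%:R); set p := fun k => u (k%:R / N%:R).
suff H j : (j <= N)%N -> chain i q (j * M) = chain i p j by rewrite H.
have qM l : q (l * M)%N = p l.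
  by rewrite /q /p !natrM -mulf_div divff ?mulr1 // gt_eqF.
elim: j => [|j IH] jN; first by rewrite mul0n.
rewrite mulSnr chain_cat IH ?(ltnW jN) //=; congr (_ * _).
have [U fU Uu] := fN j jN.
rewrite (chain_flat i fU) => [|k kM].
  by rewrite addn0 -mulSnr !qM.
have frac x : x%:R / N%:R = (x * M)%:R / (N * M)%:R :> R.
  by rewrite !natrM -mulf_div divff ?mulr1 // gt_eqF.
apply: Uu; rewrite !frac !ler_pM2r ?invr_gt0 ?ltr0n ?muln_gt0 ?N0 //.
by rewrite !ler_nat; lia.
Qed.

Lemma hol_fine i N M u : fine N u -> fine M u -> (0 < N)%N -> (0 < M)%N ->
  holonomy i N u = holonomy i M u.
Proof.
move=> fN fM N0 M0.
by rewrite -(hol_refine i M0 fN) -(hol_refine i N0 fM) mulnC.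
Qed.

Hypothesis flat : locally_flat.

(** The Lebesgue number of the cover of [K] by preimages of flat sets, obtained from the
    near-covering form of compactness. *)
Lemma lebesgue_number (T : pseudoMetricType R) (K : set T) (f : T -> X) :
  compact K -> continuous f ->
  exists2 e : R, 0 < e & forall x, K x ->
    exists2 U : set X, flat_on U & forall y, ball x e y -> U (f y).
Proof.
move=> /compact_near_coveringP cK cf.
pose P (e : R) x := exists2 U : set X, flat_on U & forall y, ball x e y -> U (f y).
have := cK R (0^'+) P _; case=> [x Kx|d /= d0 h].
  have [U fU nU] := flat (f x).
  have /nbhs_ballP[e /= e0 eU] := cf x _ nU.
  exists (ball x (e / 2), `]-oo, e / 2[%classic).
    split; first by apply: nbhsx_ballx; rewrite divr_gt0.
    by apply: nbhs_right_lt; rewrite divr_gt0.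
  move=> [y d] /= [xy]; rewrite in_itv /= => de; exists U => // z yz.
  apply: eU; rewrite [e]splitr; apply: ball_triangle xy _.
  by apply: le_ball yz; exact: ltW.
exists (d / 2) => [|x Kx]; first by rewrite divr_gt0.
apply: (h (d / 2)) => //=; last by rewrite divr_gt0.
by rewrite sub0r normrN gtr0_norm ?divr_gt0 // ltr_pdivrMr // ltr_pMr // ltr1n.
Qed.

Let natr_big (e : R) : 0 < e ->
  exists2 N0 : nat, (0 < N0)%N & forall N, (N0 <= N)%N -> 1 / N%:R < e.
Proof.
move=> e0; exists (Num.truncn e^-1).+1 => // N hN.
have NR : (0 : R) < N%:R by rewrite ltr0n; apply: leq_trans hN.
rewrite ltr_pdivrMr // mulrC -ltr_pdivrMr // div1r.
by apply: lt_le_trans (truncnS_gt _) _; rewrite ler_nat.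
Qed.

Let grid_itv N k (t : R) : (k < N)%N -> k%:R / N%:R <= t <= k.+1%:R / N%:R ->
  [/\ 0 <= (k%:R : R) / N%:R <= 1, 0 <= t <= 1 & `|k%:R / N%:R - t| <= 1 / N%:R].
Proof.
move=> kN /andP[t1 t2]; have N0 : (0 : R) < N%:R by rewrite ltr0n; lia.
have k0 : (0 : R) <= k%:R / N%:R by rewrite divr_ge0.
have k1 : k.+1%:R / N%:R <= 1 :> R by rewrite ler_pdivrMr // mul1r ler_nat.
have kS : k.+1%:R / N%:R = k%:R / N%:R + 1 / N%:R :> R.
  by rewrite -natr1 mulrDl.
have N1 : 0 < 1 / N%:R :> R by rewrite divr_gt0.
by split; [lra|lra|rewrite ler_norml; lra].
Qed.

Lemma fine_eventually (u : R -> X) : continuous u ->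
  exists2 N0, (0 < N0)%N & forall N, (N0 <= N)%N -> fine N u.
Proof.
move=> cu.
have [e e0 h] := @lebesgue_number R _ u (@segment_compact _ 0 1) cu.
have [N0 N0pos small] := natr_big e0; exists N0 => // N hN k kN.
have [|U fU Uu] := h (k%:R / N%:R).
  rewrite /= in_itv /=; case: (@grid_itv N k (k%:R / N%:R) kN) => //.
  rewrite lexx /= ler_pM2r ?ler_nat //. by rewrite invr_gt0 ltr0n; lia.
exists U => // t kt; apply: Uu; rewrite /ball /=.
have [_ _ kte] := grid_itv kN kt.
exact: le_lt_trans kte (small _ hN).
Qed.

(** In a flat square the two ways around agree, so the last rung slides back to the first, square by
    square. *)
Lemma chain_ladder i p q n :
  (forall k, (k < n)%N -> exists2 U : set X, flat_on U &
     [/\ U (p k), U (p k.+1), U (q k) & U (q k.+1)]) ->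
  chain i p n * c i (p n) (q n) = c i (p 0%N) (q 0%N) * chain i q n.
Proof.
elim: n => [|n IH] h /=; first by rewrite mul1r mulr1.
have [U fU [pn pn1 qn qn1]] := h n (ltnSn n).
rewrite -mulrA (fU i).2 // -(((fU i).2 _ (q n) _)) // mulrA IH ?mulrA // => k kn.
by apply: h; lia.
Qed.

Section loops_holonomy.
Variable x : X.
Implicit Types a b : loop R x.

Let c1 i : c i x x = 1.
Proof. by have [U /(_ i)[U1 _] /nbhs_singleton] := flat x; exact: U1. Qed.

Lemma loop_fine a : {N | (0 < N)%N /\ fine N (a \o clamp)}.
Proof.
apply: cid; have [N0 N0pos h] := fine_eventually (@loop_clamp_continuous R X x a).
by exists N0; split=> //; exact: h.
Qed.

Definition loop_hol i a : A := holonomy i (sval (loop_fine a)) (a \o clamp).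

Lemma loop_holE i a N : (0 < N)%N -> fine N (a \o clamp) ->
  loop_hol i a = holonomy i N (a \o clamp).
Proof.
by move=> N0 fN; rewrite /loop_hol; case: loop_fine => M /= [M0 fM]; exact: hol_fine.
Qed.

(** The unit square is cut into [N0] by [N0] cells, each mapped into a flat set, and the ladder
    argument carries each row to the next. *)
Lemma loop_hol_homotopic i a b : loop_homotopic a b -> loop_hol i a = loop_hol i b.
Proof.
move=> /loop_homotopicE[K [cK Kab Kx]].
have cpt : compact (`[0, 1]%classic `*` `[0, 1]%classic : set (R * R)).
  by apply: compact_setX; exact: segment_compact.
have [e e0 h] := lebesgue_number cpt cK.
have [N0 N0pos small] := natr_big e0.
have N0R : (0 : R) < N0%:R by rewrite ltr0n.
have cell j k : (j < N0)%N -> (k < N0)%N -> exists2 U : set X, flat_on U &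
    forall s t, j%:R / N0%:R <= s <= j.+1%:R / N0%:R ->
      k%:R / N0%:R <= t <= k.+1%:R / N0%:R -> U (K (s, t)).
  move=> jN kN.
  have grid_ll l : (l%:R : R) / N0%:R <= (l%:R : R) / N0%:R <= l.+1%:R / N0%:R.
    by rewrite lexx /= ler_pM2r ?invr_gt0 ?ltr0n ?ler_nat ?leqnSn.
  have [j01 _ _] := grid_itv jN (grid_ll j).
  have [k01 _ _] := grid_itv kN (grid_ll k).
  have [|U fU Uu] := h (j%:R / N0%:R, k%:R / N0%:R).
    by split; rewrite /= in_itv.
  exists U => // s t js kt; apply: Uu; split; rewrite /ball /=.
    by have [_ _ ?] := grid_itv jN js; apply: le_lt_trans (small _ (leqnn _)).
  by have [_ _ ?] := grid_itv kN kt; apply: le_lt_trans (small _ (leqnn _)).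
have gl l : (l%:R : R) / N0%:R <= (l%:R : R) / N0%:R <= l.+1%:R / N0%:R.
  by rewrite lexx /= ler_pM2r ?invr_gt0 ?ltr0n ?ler_nat ?leqnSn.
have gr l : (l%:R : R) / N0%:R <= (l.+1%:R : R) / N0%:R <= l.+1%:R / N0%:R.
  by rewrite lexx /= andbT ler_pM2r ?invr_gt0 ?ltr0n ?ler_nat ?leqnSn.
have d0 : 0%:R / N0%:R = 0 :> R by rewrite mul0r.
have d1 : N0%:R / N0%:R = 1 :> R by rewrite divff // gt_eqF.
have row j : (j <= N0)%N -> holonomy i N0 (fun t => K (0, t)) =
    holonomy i N0 (fun t => K (j%:R / N0%:R, t)).
  elim: j => [|j IH] jN; first by rewrite d0.
  rewrite IH ?(ltnW jN) // /holonomy.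
  set p := fun k => K (j%:R / N0%:R, k%:R / N0%:R).
  set q := fun k => K (j.+1%:R / N0%:R, k%:R / N0%:R).
  have := @chain_ladder i p q N0; rewrite /p /q d0 d1.
  (* Both end rungs join the base point to itself and contribute 1. *)
  rewrite !(Kx _).1 !(Kx _).2 c1 mulr1 mul1r; apply=> k kN.
  by have [U fU UK] := cell j k jN kN; exists U => //; split; exact: UK.
have K0 : (fun t => K (0, t)) = a \o clamp by apply/funext => t; exact: (Kab t).1.
have K1 : (fun t => K (1, t)) = b \o clamp by apply/funext => t; exact: (Kab t).2.
rewrite (@loop_holE _ a N0) //; last first.
  move=> k kN; have [U fU UK] := cell 0%N k N0pos kN; exists U => // t kt.
  by rewrite -K0 -d0; exact: UK.
rewrite (@loop_holE _ b N0) //; last first.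
  have N1 : (N0.-1 < N0)%N by rewrite prednK.
  move=> k kN; have [U fU UK] := cell _ k N1 kN; exists U => // t kt.
  by rewrite -K1 -d1; apply: UK => //; have := gr N0.-1; rewrite prednK.
by rewrite -K0 -K1 -[in RHS]d1; exact: row.
Qed.

Lemma loop_hol_concat i a b :
  loop_hol i (loop_concat a b) = loop_hol i a * loop_hol i b.
Proof.
have [Na Na0 fa] := fine_eventually (@loop_clamp_continuous R X x a).
have [Nb Nb0 fb] := fine_eventually (@loop_clamp_continuous R X x b).
have [Nc Nc0 fc] :=
  fine_eventually (@loop_clamp_continuous R X x (loop_concat a b)).
pose N := (Na + Nb + Nc)%N.
have N0 : (0 < N)%N by rewrite /N; lia.
rewrite (@loop_holE _ a N) //; last by apply: fa; rewrite /N; lia.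
rewrite (@loop_holE _ b N) //; last by apply: fb; rewrite /N; lia.
(* With [N + N] intervals the midpoint is a node, so the chain splits into those of [a] and [b]. *)
rewrite (@loop_holE _ _ (N + N)); [|lia|by apply: fc; rewrite /N; lia].
have NR : (0 : R) < N%:R by rewrite ltr0n.
have itvN k : (k <= N)%N -> 0 <= (k%:R : R) / N%:R <= 1.
  by move=> kN; rewrite divr_ge0 //= ler_pdivrMr // mul1r ler_nat.
have half k : k%:R / (N + N)%:R = k%:R / N%:R / 2 :> R.
  by rewrite addnn -muln2 natrM invfM mulrA.
rewrite /holonomy chain_cat; congr (_ * _); apply: eq_chain => k kN /=.
  have kitv := itvN k kN; rewrite half !clamp_id //; last by lra.
  by rewrite /concat_fun ifT; [congr (a _)|]; lra.
have kitv := itvN k kN; rewrite half natrD mulrDl divff ?gt_eqF //.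
rewrite !clamp_id //; last by lra.
rewrite /concat_fun; case: ifPn => hk.
  (* This is the node at time 1/2: [concat_fun] assigns it to [a], and [a] at 1 and [b] at 0 are
     both the base point. *)
  have k0 : k%:R / N%:R = 0 :> R by lra.
  by rewrite k0 loop0 (_ : 2 * _ = 1) ?loop1 //; lra.
by congr (b _); lra.
Qed.

Definition pi1_hol i (g : @pi1 R X x) : A := loop_hol i (repr g).

Lemma pi1_holE i a : pi1_hol i (\pi_(@pi1 R X x) a) = loop_hol i a.
Proof. by apply: loop_hol_homotopic; exact: pi1_repr. Qed.

Lemma pi1_holM i g h : pi1_hol i (g * h)%g = pi1_hol i g * pi1_hol i h.
Proof.
rewrite -loop_hol_concat; apply: loop_hol_homotopic; exact: pi1_repr.
Qed.

(** The nodes do not depend on [i]: one chain of points computes the holonomy of all the cocycles at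
    once, on which [fig8_hol_ind] rests. *)
Lemma pi1_hol_chain g : exists (p : nat -> X) N,
  forall i, pi1_hol i g = chain i p N.
Proof. by eexists _, _ => i. Qed.

End loops_holonomy.

End holonomy_of_loops.

(** * A cocycle on the exterior of the figure-eight knot *)

Section figure_eight_relations.
Context {A : pzRingType}.

(** The two-meridian presentation of the figure-eight group, realised in a ring; the inverses are
    data, so that every word is a product of given elements. *)
Record fig8_gens := Fig8Gens {
  gena : A; genaV : A; genb : A; genbV : A;
  mulaV : gena * genaV = 1; mulVa : genaV * gena = 1;
  mulbV : genb * genbV = 1; mulVb : genbV * genb = 1;
  fig8_rel : gena * genb * genaV * genb * gena =
             genb * gena * genbV * gena * genb }.

Variable d : fig8_gens.
Local Notation a := (gena d).
Local Notation a' := (genaV d).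
Local Notation b := (genb d).
Local Notation b' := (genbV d).

(** The ends of the edges parallel to the second axis, by first coordinate; the
    grid diagram being symmetric, these are also the ends of the edges parallel
    to the first axis, by second coordinate. *)
Definition edge_lo (i : nat) : nat := nth 0%N [:: 0; 1; 3; 2; 3; 1; 2]%N i.
Definition edge_hi (i : nat) : nat := nth 0%N [:: 0; 5; 6; 4; 5; 4; 6]%N i.
Definition spans (i l : nat) : bool := (edge_lo i <= l < edge_hi i)%N.

(** The factor for crossing the wall under column [i] from left to right. Columns are numbered from
    1, so index 0 is padding. *)
Definition label (i : nat) : A :=
  nth 1 [:: 1; a; b; a' * b * a; b' * a' * b; a'; b'] i.
Definition labelV (i : nat) : A :=
  nth 1 [:: 1; a'; b'; a' * b' * a; b' * a * b; a; b] i.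

Definition wall (i l : nat) : A := if spans i l then label i else 1.
Definition wallV (i l : nat) : A := if spans i l then labelV i else 1.

Fixpoint color (k l : nat) : A :=
  if k is k'.+1 then color k' l * wall k'.+1 l else 1.
Fixpoint colorV (k l : nat) : A :=
  if k is k'.+1 then wallV k'.+1 l * colorV k' l else 1.

Let aK x : a * (a' * x) = x. Proof. by rewrite mulrA mulaV mul1r. Qed.
Let aKV x : a' * (a * x) = x. Proof. by rewrite mulrA mulVa mul1r. Qed.
Let bK x : b * (b' * x) = x. Proof. by rewrite mulrA mulbV mul1r. Qed.
Let bKV x : b' * (b * x) = x. Proof. by rewrite mulrA mulVb mul1r. Qed.
Let simp := (mul1r, mulr1, aK, aKV, bK, bKV, mulaV, mulVa, mulbV, mulVb).

Lemma spans_le i l : spans i l ->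
  [/\ (0 < i < 7)%N, (0 < edge_lo i)%N & (0 < edge_hi i)%N].
Proof.
rewrite /spans /edge_lo /edge_hi.
by case: i => [|[|[|[|[|[|[|i]]]]]]] //=; rewrite nth_nil; lia.
Qed.

Lemma mul_label i : label i * labelV i = 1.
Proof.
case: i => [|[|[|[|[|[|[|i]]]]]]]; rewrite /label /labelV //= -?mulrA ?simp //.
by rewrite !nth_nil mulr1.
Qed.

Lemma mul_labelV i : labelV i * label i = 1.
Proof.
case: i => [|[|[|[|[|[|[|i]]]]]]]; rewrite /label /labelV //= -?mulrA ?simp //.
by rewrite !nth_nil mulr1.
Qed.

Lemma mul_wall i l : wall i l * wallV i l = 1.
Proof. by rewrite /wall /wallV; case: ifP => _; rewrite ?mulr1 ?mul_label. Qed.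

Lemma mul_wallV i l : wallV i l * wall i l = 1.
Proof. by rewrite /wall /wallV; case: ifP => _; rewrite ?mulr1 ?mul_labelV. Qed.

Lemma mul_color k l : color k l * colorV k l = 1.
Proof.
elim: k => [|k IH] /=; first by rewrite mulr1.
by rewrite -mulrA [wall _ _ * _]mulrA mul_wall mul1r.
Qed.

Lemma mul_colorV k l : colorV k l * color k l = 1.
Proof.
elim: k => [|k IH] /=; first by rewrite mulr1.
by rewrite -mulrA [colorV _ _ * _]mulrA IH mul1r mul_wallV.
Qed.

Lemma wall_out i l : (6 < i)%N || (5 < l)%N -> wall i l = 1.
Proof.
rewrite /wall /spans /edge_lo /edge_hi => h; case: ifP => // /andP[h1 h2].
move: h h1 h2; case: i => [|[|[|[|[|[|[|i]]]]]]] /=; rewrite ?nth_nil; lia.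
Qed.

Lemma color_high k l : (5 < l)%N -> color k l = 1.
Proof.
by move=> l5; elim: k => //= k ->; rewrite wall_out ?mulr1 // l5 orbT.
Qed.

Lemma color_right k l : color (6 + k) l = color 6 l.
Proof.
elim: k => [//|k IH]; rewrite addnS.
by rewrite -[color (6 + k).+1 l]/(color (6 + k) l * wall (6 + k).+1 l) IH wall_out ?mulr1.
Qed.

(** These are the Neuwirth relations of the grid diagram: between two adjacent
    rows the color changes only across the edge that separates them. *)
Lemma color_step k l : ~~ spans l.+1 k -> color k l = color k l.+1.
Proof.
(* The defining relation is recast as three right-associated words that turn up when adjacent strips
   are compared. *)
have rel : a * (b * (a' * (b * (a * (b' * (a' * b)))))) = b * a.
  have := congr1 (fun x => x * b' * a' * b) (fig8_rel d).
  by rewrite -!mulrA !simp.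
have rel' : a' * (b * (a * (b' * (a' * (b * a'))))) = b' * (a' * b).
  have := congr1 (fun x => b' * a' * x * a') rel.
  by rewrite -!mulrA !simp.
have rel1 : a * (b * (a' * (b * (a * (b' * (a' * (b * (a' * b')))))))) = 1.
  have := congr1 (fun x => x * a' * b') rel.
  by rewrite -!mulrA !simp.
have low k' : (k' <= 6)%N -> ~~ spans l.+1 k' -> color k' l = color k' l.+1.
  case: l => [|[|[|[|[|[|l']]]]]]; last by rewrite !color_high.
  1-6: by case: k' => [|[|[|[|[|[|[|k'']]]]]]] //= _ _; rewrite /wall /label /=
    ?mulr1 ?mul1r -?mulrA ?simp ?rel ?rel' ?rel1 ?simp.
have [k6|k6] := leqP k 6; first exact: low.
rewrite -(subnKC (ltnW k6)) !color_right => _; apply: low => //.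
rewrite /spans /edge_hi /edge_lo.
by case: l => [|[|[|[|[|[|l']]]]]] //=; rewrite nth_nil.
Qed.

(** No row edge extends beyond abscissa 6, so by [color_step] all strips have the same total color,
    and strip 0 meets no wall. *)
Lemma color_end l : color 6 l = 1.
Proof.
elim: l => [|l <-]; first by rewrite /= /wall /= !mulr1.
apply/esym/color_step; rewrite /spans /edge_hi /edge_lo.
by case: l => [|[|[|[|[|[|l']]]]]] //=; rewrite nth_nil.
Qed.

End figure_eight_relations.

(** * Points outside the tubular neighbourhood, in coordinates *)

Section exterior.
Context {R : realType}.
Local Notation R3 := 'rV[R]_3.
Local Notation ext := (figure_eight_exterior R).
Implicit Types (u v w : R3) (p q : nat * nat * nat).

Definition cx v : R := v 0 (@Ordinal 3 0 isT).
Definition cy v : R := v 0 (@Ordinal 3 1 isT).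
Definition cz v : R := v 0 (@Ordinal 3 2 isT).

Lemma norm3_lt v e : 0 < e ->
  (`|v| < e) = [&& `|cx v| < e, `|cy v| < e & `|cz v| < e].
Proof.
move=> e0; apply/idP/and3P => [h|[hx hy hz]].
  by split; apply: le_lt_trans (coord_le_norm _ _) h.
rewrite /Num.norm /= mx_normrE; apply/bigmax_ltP; split=> // -[i j] _ /=.
rewrite ord1; case: j => -[|[|[|//]]] hj.
- by move: hx; congr (`|v 0 _| < _); exact: val_inj.
- by move: hy; congr (`|v 0 _| < _); exact: val_inj.
- by move: hz; congr (`|v 0 _| < _); exact: val_inj.
Qed.

Definition edge p q : bool :=
  ((p, q) \in zip figure_eight_vertices (rot 1 figure_eight_vertices)) ||
  ((q, p) \in zip figure_eight_vertices (rot 1 figure_eight_vertices)).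

Let map_zip (S T : Type) (f : S -> T) s t :
  zip (map f s) (map f t) = map (fun e => (f e.1, f e.2)) (zip s t).
Proof. by elim: s t => [|x s IH] [|y t] //=; rewrite IH. Qed.

Let mem_edges (vs : seq (nat * nat * nat)) (e : R3 * R3) :
  e \in zip (map (lattice_point R) vs) (rot 1 (map (lattice_point R) vs)) <->
  exists2 pq, pq \in zip vs (rot 1 vs) &
    e = (lattice_point R pq.1, lattice_point R pq.2).
Proof. by rewrite -map_rot map_zip; split=> /mapP. Qed.

Lemma figure_eight_edge p q (t : R) : edge p q -> 0 <= t <= 1 ->
  figure_eight ((1 - t) *: lattice_point R p + t *: lattice_point R q).
Proof.
rewrite /edge /figure_eight; move: figure_eight_vertices => vs.
move=> /orP[e|e] t01.
- exists (lattice_point R p, lattice_point R q); first by apply/mem_edges; exists (p, q).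
  by exists t => //=; rewrite in_itv.
- exists (lattice_point R q, lattice_point R p); first by apply/mem_edges; exists (q, p).
  exists (1 - t); first by rewrite /= in_itv /=; lra.
  by rewrite subKr addrC.
Qed.

Lemma figure_eightE v : figure_eight v -> exists p q (t : R),
  [/\ edge p q, 0 <= t <= 1 &
      v = (1 - t) *: lattice_point R p + t *: lattice_point R q].
Proof.
rewrite /edge /figure_eight; move: figure_eight_vertices => vs.
case=> e /mem_edges[[p q] pq ->] [t].
by rewrite /= in_itv /= => t01 <-; exists p, q, t; split=> //; rewrite pq.
Qed.

Definition outside v : Prop := ~ figure_eight_nbhd (Some v : S3 R).

Lemma outside_edge v p q (t : R) : outside v -> edge p q -> 0 <= t <= 1 ->
  `|cx v - ((1 - t) * p.1.1%:R + t * q.1.1%:R)| < 4^-1 ->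
  `|cy v - ((1 - t) * p.1.2%:R + t * q.1.2%:R)| < 4^-1 ->
  `|cz v - ((1 - t) * p.2%:R + t * q.2%:R)| < 4^-1 -> False.
Proof.
move=> ov pq t01 hx hy hz; apply: ov; exists v => //.
exists ((1 - t) *: lattice_point R p + t *: lattice_point R q).
  exact: figure_eight_edge.
by rewrite norm3_lt ?invr_gt0 // /cx /cy /cz !mxE /= hx hy hz.
Qed.

Lemma outsideP v :
  (forall p q (t : R), edge p q -> 0 <= t <= 1 ->
    ~~ [&& `|cx v - ((1 - t) * p.1.1%:R + t * q.1.1%:R)| < 4^-1,
           `|cy v - ((1 - t) * p.1.2%:R + t * q.1.2%:R)| < 4^-1 &
           `|cz v - ((1 - t) * p.2%:R + t * q.2%:R)| < 4^-1]) -> outside v.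
Proof.
move=> h [w [y /figure_eightE[p [q [t [pq t01 ->]]]] hw] [wv]].
move: hw; apply/negP; rewrite wv norm3_lt ?invr_gt0 //.
by have := h p q t pq t01; rewrite /cx /cy /cz !mxE.
Qed.

(** Read off the vertex list. The last edge is the row of ordinate [i], which by the symmetry of the
    diagram has the same ends as column [i]. *)
Lemma edges_of i l : spans i l ->
  [/\ edge (i, edge_lo i, 1%N) (i, edge_hi i, 1%N),
      edge (i, edge_lo i, 0%N) (i, edge_lo i, 1%N),
      edge (i, edge_hi i, 0%N) (i, edge_hi i, 1%N) &
      edge (edge_lo i, i, 0%N) (edge_hi i, i, 0%N)].
Proof.
move=> /spans_le[i7 _ _].
by case: i i7 => [|[|[|[|[|[|[|i]]]]]]] //.
Qed.

Section outside_facts.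
Variables (v : R3) (i l : nat).
Hypothesis ov : outside v.
Hypothesis il : spans i l.

Lemma outside_top : `|cx v - i%:R| < 4^-1 ->
  (edge_lo i)%:R <= cy v <= (edge_hi i)%:R -> `|cz v - 1| < 4^-1 -> False.
Proof.
have [e _ _ _] := edges_of il => hx /andP[y1 y2] hz.
have lt : (edge_lo i)%:R < (edge_hi i)%:R :> R.
  by rewrite ltr_nat; case/andP: il => /leq_ltn_trans h /h.
have lt' : 0 < (edge_hi i)%:R - (edge_lo i)%:R :> R by rewrite subr_gt0.
(* The edge parameter of the point with the same ordinate as [v]. *)
set t := (cy v - (edge_lo i)%:R) / ((edge_hi i)%:R - (edge_lo i)%:R).
have tE : (1 - t) * (edge_lo i)%:R + t * (edge_hi i)%:R = cy v.
  by rewrite /t; field; rewrite gt_eqF.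
apply: (@outside_edge _ _ _ t ov e) => /=.
- by rewrite /t divr_ge0 ?subr_ge0 ?(ltW lt) //= ler_pdivrMr // mul1r lerB.
- by rewrite (_ : (1 - t) * _ + _ = i%:R) //; ring.
- by rewrite tE subrr normr0 invr_gt0.
- by rewrite (_ : (1 - t) * _ + _ = 1) //; ring.
Qed.

Lemma outside_row : (edge_lo i)%:R <= cx v <= (edge_hi i)%:R ->
  `|cy v - i%:R| < 4^-1 -> `|cz v| < 4^-1 -> False.
Proof.
have [_ _ _ e] := edges_of il => /andP[y1 y2] hx hz.
have lt : (edge_lo i)%:R < (edge_hi i)%:R :> R.
  by rewrite ltr_nat; case/andP: il => /leq_ltn_trans h /h.
have lt' : 0 < (edge_hi i)%:R - (edge_lo i)%:R :> R by rewrite subr_gt0.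
set t := (cx v - (edge_lo i)%:R) / ((edge_hi i)%:R - (edge_lo i)%:R).
have tE : (1 - t) * (edge_lo i)%:R + t * (edge_hi i)%:R = cx v.
  by rewrite /t; field; rewrite gt_eqF.
apply: (@outside_edge _ _ _ t ov e) => /=.
- by rewrite /t divr_ge0 ?subr_ge0 ?(ltW lt) //= ler_pdivrMr // mul1r lerB.
- by rewrite tE subrr normr0 invr_gt0.
- by rewrite (_ : (1 - t) * _ + _ = i%:R) //; ring.
- by rewrite !mulr0 addr0 subr0.
Qed.

Let outside_leg j : edge (i, j, 0%N) (i, j, 1%N) ->
  `|cx v - i%:R| < 4^-1 -> `|cy v - j%:R| < 4^-1 -> - 4^-1 < cz v < 1 -> False.
Proof.
(* A point below the leg is compared with the lower end of the leg, whence the maximum. *)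
move=> e hx hy hz; set t := Num.max 0 (cz v).
apply: (@outside_edge _ _ _ t ov e) => /=.
- by rewrite /t; case: (leP 0 (cz v)) => ?; lra.
- by rewrite (_ : (1 - t) * _ + _ = i%:R) //; ring.
- by rewrite (_ : (1 - t) * _ + _ = j%:R) //; ring.
- rewrite (_ : (1 - t) * _ + _ = t); last by ring.
  by rewrite ltr_norml /t; case: (leP 0 (cz v)) => ?; lra.
Qed.

Lemma outside_lo : `|cx v - i%:R| < 4^-1 -> `|cy v - (edge_lo i)%:R| < 4^-1 ->
  - 4^-1 < cz v < 1 -> False.
Proof. by have [_ e _ _] := edges_of il; exact: outside_leg. Qed.

Lemma outside_hi : `|cx v - i%:R| < 4^-1 -> `|cy v - (edge_hi i)%:R| < 4^-1 ->
  - 4^-1 < cz v < 1 -> False.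
Proof. by have [_ _ e _] := edges_of il; exact: outside_leg. Qed.

End outside_facts.

End exterior.

(** * The transport between two points and its multiplicativity on small sets *)

Section cocycle.
Context {R : realType} {A : pzRingType}.
Local Notation R3 := 'rV[R]_3.
Local Notation ext := (figure_eight_exterior R).
Local Notation data := (@fig8_gens A).
Implicit Types (u v w : R3) (P Q : option R3) (d : data).

Definition nearby u w : bool :=
  [&& `|cx u - cx w| < 4^-1, `|cy u - cy w| < 4^-1 & `|cz u - cz w| < 4^-1].

Lemma nearbyC u w : nearby u w = nearby w u.
Proof. by rewrite /nearby (distrC (cx u)) (distrC (cy u)) (distrC (cz u)). Qed.

(** Negative coordinates truncate to 0; this merges them with cell 0, where there is no wall and the
    color is 1. *)
Definition cell_x v : nat := Num.truncn (cx v).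
Definition cell_y v : nat := Num.truncn (cy v).

Let truncn_near (x y : R) : `|x - y| < 4^-1 ->
  (Num.truncn x < Num.truncn y)%N ->
  Num.truncn y = (Num.truncn x).+1 /\ x < (Num.truncn y)%:R <= y.
Proof.
move=> xy lt; have x1 := truncnS_gt x.
have y1 : (Num.truncn y)%:R <= y.
  move: lt; case: (Num.truncn y) (truncn_gt_nat y (Num.truncn y).-1) => //= n.
  by rewrite ltnSn.
have xlt : x < (Num.truncn y)%:R.
  by apply: lt_le_trans x1 _; rewrite ler_nat.
split; last by rewrite xlt.
apply/eqP; rewrite eqn_leq lt andbT leqNgt; apply/negP => lt2.
have : (Num.truncn x).+2%:R <= (Num.truncn y)%:R :> R by rewrite ler_nat.
have -> : (Num.truncn x).+2%:R = (Num.truncn x).+1%:R + 1 :> R by rewrite natr1.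
by move: xy; rewrite ltr_norml; lra.
Qed.

(** Wall [i] stands on the left side of cell [i], between heights -1 and 1. The predicate says that
    entering the cell of [v] from the left, at the level of [v], crosses a wall. *)
Definition on_wall v : bool := (-1 <= cz v < 1) && spans (cell_x v) (cell_y v).

(** If [w] were beyond the top or a lateral end of the wall that [u] faces, then [u], already within
    1/4 of the plane of the wall, would be within 1/4 of a bounding edge. The bottom at height -1 is
    out of reach, both points being above -1/4. *)
Let on_wall_agree s u w : outside u -> - 4^-1 < cz u -> - 4^-1 < cz w ->
  nearby s u -> nearby s w -> nearby u w ->
  (cell_x s < cell_x u)%N -> cell_x w = cell_x u -> on_wall u -> on_wall w.
Proof.
move=> ou zu zw /and3P[sux _ _] /and3P[swx _ _] /and3P[uwx uwy uwz].
rewrite /on_wall => lt kE /andP[/andP[zu1 zu2] sp].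
have [_ /andP[sk ku]] := truncn_near sux lt.
have lt' : (Num.truncn (cx s) < Num.truncn (cx w))%N by rewrite -/(cell_x w) kE.
have [_ /andP[_ kw]] := truncn_near swx lt'.
rewrite -/(cell_x u) in sk ku; rewrite -/(cell_x w) kE in kw.
move: sux swx uwx uwy uwz; rewrite !ltr_norml => sux swx uwx uwy uwz.
have xu : `|cx u - (cell_x u)%:R| < 4^-1 by rewrite ltr_norml; lra.
have [_ lo0 hi0] := spans_le sp.
have [lo hi] : (edge_lo (cell_x u))%:R <= cy u /\ cy u < (edge_hi (cell_x u))%:R.
  have /andP[h1 h2] := sp; split.
    by move: h1; rewrite -[X in (X <= cell_y u)%N](prednK lo0) /cell_y truncn_gt_nat prednK.
  by rewrite ltNge -[X in X%:R](prednK hi0) -truncn_gt_nat prednK // -ltnNge.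
rewrite kE; apply/andP; split.
  apply/andP; split; first lra.
  rewrite ltNge; apply/negP => zw1.
  apply: (outside_top ou sp xu); first by rewrite lo ltW.
  by rewrite ltr_norml; lra.
rewrite /spans; apply/andP; split.
  rewrite leqNgt; apply/negP => lt2.
  have yw : cy w < (edge_lo (cell_x u))%:R.
    by apply: lt_le_trans (truncnS_gt _) _; rewrite ler_nat.
  apply: (outside_lo ou sp xu); rewrite ?ltr_norml; lra.
rewrite ltnNge; apply/negP => lt2.
have yw : (edge_hi (cell_x u))%:R <= cy w.
  by move: lt2; rewrite -[X in (X <= cell_y w)%N](prednK hi0) /cell_y truncn_gt_nat prednK.
apply: (outside_hi ou sp xu); rewrite ?ltr_norml; lra.
Qed.

Definition wall_at d v : A := if on_wall v then label d (cell_x v) else 1.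
Definition wall_atV d v : A := if on_wall v then labelV d (cell_x v) else 1.

Lemma wall_agree d s u w : outside u -> outside w ->
  - 4^-1 < cz u -> - 4^-1 < cz w ->
  nearby s u -> nearby s w -> nearby u w ->
  (cell_x s < cell_x u)%N -> cell_x w = cell_x u ->
  wall_at d u = wall_at d w /\ wall_atV d u = wall_atV d w.
Proof.
move=> ou ow zu zw su sw uw lt kE.
have uwE : on_wall u = on_wall w.
  apply/idP/idP; first exact: on_wall_agree uw lt kE.
  by apply: (on_wall_agree ow zw zu sw su); rewrite ?kE // nearbyC.
by rewrite /wall_at /wall_atV uwE kE.
Qed.

(** If the strips of [u] and [w] differ, [u] is within 1/4 of the line between them at height 0.
    Being outside the neighbourhood of the knot, it faces no row edge there, and [color_step]
    applies. *)
Lemma color_agree d u w : outside u -> `|cz u| < 4^-1 -> nearby u w ->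
  color d (cell_x u) (cell_y u) = color d (cell_x u) (cell_y w).
Proof.
move=> ou zu /and3P[_ uwy _].
have key j : (0 < j)%N -> `|cy u - j%:R| < 4^-1 -> ~~ spans j (cell_x u).
  move=> j0 yj; apply/negP => sp; have [_ lo0 _] := spans_le sp.
  have /andP[h1 h2] := sp.
  have x1 : (edge_lo j)%:R <= cx u.
    by move: h1; rewrite -[X in (X <= cell_x u)%N](prednK lo0) /cell_x truncn_gt_nat prednK.
  apply: (outside_row ou sp) => //; rewrite x1 /= ltW //.
  by apply: lt_le_trans (truncnS_gt _) _; rewrite ler_nat.
have [lt|lt|->//] := ltngtP (cell_y u) (cell_y w).
- have [wE /andP[y1 y2]] := truncn_near uwy lt.
  rewrite [cell_y w]wE; apply: color_step; apply: key => //.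
  rewrite -wE; move: uwy; rewrite !ltr_norml => uwy; lra.
- rewrite distrC in uwy; have [uE /andP[y1 y2]] := truncn_near uwy lt.
  rewrite [cell_y u]uE; apply/esym/color_step; apply: key => //.
  rewrite -uE; move: uwy; rewrite !ltr_norml => uwy; lra.
Qed.

Definition lower P : bool := if P is Some v then cz v < 0 else true.
Definition cell_x_opt P : nat := if P is Some v then cell_x v else 0%N.
Definition wall_opt d P : A := if P is Some v then wall_at d v else 1.
Definition wall_optV d P : A := if P is Some v then wall_atV d v else 1.

(** The floor under the knot: crossing it upwards multiplies by [color]. *)
Definition floor_at d P : A :=
  if P is Some v
  then if -1 <= cz v < 0 then color d (cell_x v) (cell_y v) else 1 else 1.
Definition floor_atV d P : A :=
  if P is Some v
  then if -1 <= cz v < 0 then colorV d (cell_x v) (cell_y v) else 1 else 1.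

(** The wall between adjacent cells is recorded at the point on its right, hence at [Q] in one
    direction and at [P] in the other. *)
Definition crossing d P Q : A :=
  if (cell_x_opt P < cell_x_opt Q)%N then wall_opt d Q
  else if (cell_x_opt Q < cell_x_opt P)%N then wall_optV d P else 1.

(** The walls hang down from the upper edges to the floor; below the floor, and
    far from the knot, the transport is trivial. *)
Definition transport d P Q : A :=
  if lower P && lower Q then 1
  else floor_at d P * crossing d P Q * floor_atV d Q.

Lemma mul_wall_opt d P : wall_opt d P * wall_optV d P = 1.
Proof.
case: P => [v|] /=; last by rewrite mulr1.
by rewrite /wall_at /wall_atV; case: ifP => _; rewrite ?mulr1 ?mul_label.
Qed.

Lemma mul_wall_optV d P : wall_optV d P * wall_opt d P = 1.
Proof.
case: P => [v|] /=; last by rewrite mulr1.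
by rewrite /wall_at /wall_atV; case: ifP => _; rewrite ?mulr1 ?mul_labelV.
Qed.

Lemma mul_floor d P : floor_at d P * floor_atV d P = 1.
Proof.
case: P => [v|] /=; last by rewrite mulr1.
by case: ifP => _; rewrite ?mulr1 ?mul_color.
Qed.

Lemma mul_floorV d P : floor_atV d P * floor_at d P = 1.
Proof.
case: P => [v|] /=; last by rewrite mulr1.
by case: ifP => _; rewrite ?mulr1 ?mul_colorV.
Qed.

Section small.
Variable U : set (option R3).
Hypothesis Uout : forall P, U P -> exists v, [/\ P = Some v, outside v & - 4^-1 < cz v].
Hypothesis Unear : forall u w, U (Some u) -> U (Some w) -> nearby u w.

Let cell_x_near u w : nearby u w -> (cell_x u < cell_x w)%N -> cell_x w = (cell_x u).+1.
Proof. by move=> /and3P[h _ _] /(truncn_near h)[]. Qed.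

(** Three nearby points occupy at most two adjacent cells, and two of them that share the right-hand
    cell see the same wall by [wall_agree]. *)
Lemma crossing_mul d P Q S : U P -> U Q -> U S ->
  crossing d P Q * crossing d Q S = crossing d P S.
Proof.
move=> UP UQ US.
have [p [PE op zp]] := Uout UP; have [q [QE oq zq]] := Uout UQ.
have [s [SE os zs]] := Uout US; subst P Q S.
have pq := Unear UP UQ; have qs := Unear UQ US; have ps := Unear UP US.
have [qp sq sp] : [/\ nearby q p, nearby s q & nearby s p] by rewrite !(nearbyC s) nearbyC.
have cpq := cell_x_near pq; have cqs := cell_x_near qs; have cps := cell_x_near ps.
have cqp := cell_x_near qp; have csq := cell_x_near sq; have csp := cell_x_near sp.
rewrite /crossing /=; have [lpq|lqp|Epq] := ltngtP (cell_x p) (cell_x q).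
- have [lqs|lsq|Eqs] := ltngtP (cell_x q) (cell_x s); first by exfalso; lia.
  + have Eps : cell_x s = cell_x p by lia.
    by rewrite Eps ltnn; exact: (mul_wall_opt d (Some q)).
  + rewrite -Eqs lpq mulr1.
    by have [->] := wall_agree d oq os zq zs pq ps qs lpq (esym Eqs).
- have [lqs|lsq|Eqs] := ltngtP (cell_x q) (cell_x s); last 1 first.
  + by rewrite -Eqs lqp (ltnNge (cell_x p)) (ltnW lqp) /= mulr1.
  + have Eps : cell_x s = cell_x p by lia.
    rewrite Eps ltnn; have [<- _] := wall_agree d op os zp zs qp qs ps lqp Eps.
    exact: (mul_wall_optV d (Some p)).
  + by exfalso; lia.
- rewrite mul1r Epq; have [//|lsq|//] := ltngtP (cell_x q) (cell_x s).
  by have [_ ->] := wall_agree d oq op zq zp sq sp qp lsq Epq.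
Qed.

(** Below the floor, crossing a wall multiplies by exactly the change of color between the two
    cells. *)
Let floor_mul d P Q : U P -> U Q -> lower P -> lower Q ->
  floor_at d P * crossing d P Q = floor_at d Q.
Proof.
move=> UP UQ; have [u [PE ou zu]] := Uout UP; have [w [QE ow zw]] := Uout UQ.
subst P Q; move: (Unear UP UQ) => uw /= lu lw.
have in_floor v : - 4^-1 < cz v -> cz v < 0 -> -1 <= cz v < 0 /\ `|cz v| < 4^-1.
  by rewrite ltr_norml => z1 z2; split; lra.
have [fu nu] := in_floor _ zu lu; have [fw nw] := in_floor _ zw lw.
have on v : -1 <= cz v < 0 -> (-1 <= cz v < 1) by lra.
rewrite /crossing /= fu fw /wall_at /wall_atV /on_wall (on _ fu) (on _ fw) /=.
have := color_agree d ou nu uw; have := color_agree d ow nw (etrans (nearbyC w u) uw).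
have wu := etrans (nearbyC w u) uw.
have [lt|lt|E] := ltngtP (cell_x u) (cell_x w).
- by move=> _ ->; rewrite (cell_x_near uw lt).
- move=> -> _; rewrite (cell_x_near wu lt) /= -mulrA.
  by have := mul_wall d (cell_x w).+1 (cell_y u); rewrite /wall /wallV => ->; rewrite mulr1.
- by rewrite E => _ ->; rewrite mulr1.
Qed.

Lemma transport_mul d P Q S : U P -> U Q -> U S ->
  transport d P Q * transport d Q S = transport d P S.
Proof.
(* On [U] both cases of [transport] obey one formula, a crossing between floor factors, and these
   telescope. *)
have tE P' Q' : U P' -> U Q' ->
    transport d P' Q' = floor_at d P' * crossing d P' Q' * floor_atV d Q'.
  move=> UP UQ; rewrite /transport; case: ifP => // /andP[lP lQ].
  by rewrite floor_mul // mul_floor.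
move=> UP UQ US; rewrite !tE // -!mulrA [floor_atV _ _ * _]mulrA mul_floorV mul1r.
by rewrite [crossing _ _ _ * (_ * _)]mulrA crossing_mul.
Qed.

Lemma transport1 d P : U P -> transport d P P = 1.
Proof.
by rewrite /transport /crossing ltnn mulr1 mul_floor; case: ifP.
Qed.

End small.

End cocycle.

(** * Local flatness of the transport, including at infinity *)

Section flatness.
Context {R : realType} {A : pzRingType}.
Local Notation R3 := 'rV[R]_3.
Local Notation ext := (figure_eight_exterior R).
Local Notation data := (@fig8_gens A).
Implicit Types (u v w : R3) (d : data).

Lemma color_low d k : color d k 0 = 1.
Proof.
elim: k => //= k ->; rewrite mul1r /wall; case: ifP => // /[dup] /spans_le[_ h _].
by rewrite /spans leqNgt h.
Qed.

Definition far v : bool := [|| 10 < `|cx v|, 10 < `|cy v| | 10 < `|cz v|].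

Let truncn_far (x : R) : 10 < `|x| -> Num.truncn x = 0%N \/ (9 < Num.truncn x)%N.
Proof.
rewrite lter_normr => /orP[h|h].
  by right; rewrite truncn_gt_nat ltW.
by left; apply/eqP; rewrite -leqn0 truncn_le_nat; lra.
Qed.

Let far_wall v : far v -> on_wall v = false.
Proof.
move=> fv; apply/negP => /andP[z1 sp].
have [k7 lo0 _] := spans_le sp.
have hi7 : (edge_hi (cell_x v) < 7)%N.
  by move: k7; case: (cell_x v) => [|[|[|[|[|[|[|i]]]]]]].
have row1 : (0 < cell_y v < 7)%N.
  by move/andP: sp => [h1 h2]; apply/andP; split; lia.
case/or3P: fv => [/truncn_far|/truncn_far|].
- by rewrite -/(cell_x v); lia.
- by rewrite -/(cell_y v); lia.
- by rewrite ltNge ler_norml; case/negP; lra.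
Qed.

Let far_floor d v : far v -> floor_at d (Some v) = 1 /\ floor_atV d (Some v) = 1.
Proof.
move=> fv /=; case: ifP => // z1.
have cE : color d (cell_x v) (cell_y v) = 1.
  case/or3P: fv => [/truncn_far|/truncn_far|].
  - rewrite -/(cell_x v) => -[->//|k9].
    by rewrite -(subnKC (ltnW (ltn_trans (isT : 6 < 9)%N k9))) color_right color_end.
  - rewrite -/(cell_y v) => -[->|l9]; first by rewrite color_low.
    by rewrite color_high //; apply: ltn_trans l9.
  - by rewrite ltNge ler_norml; case/negP; lra.
by split=> //; have := mul_colorV d (cell_x v) (cell_y v); rewrite cE mulr1.
Qed.

Definition transport_ext d (p q : ext) : A := transport d (sval p) (sval q).

Let sval_continuous : continuous (sval : ext -> S3 R).
Proof.
have -> : (sval : ext -> S3 R) = set_val by rewrite set_valE.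
exact: initial_continuous.
Qed.

Let nbhs_ext (p : ext) (W : set (S3 R)) :
  nbhs (sval p : S3 R) W -> nbhs p (sval @^-1` W).
Proof. exact: sval_continuous. Qed.

(** Three kinds of neighbourhoods: the open lower half-space, where the transport is 1 by
    definition; a ball of radius 1/8, whose points are pairwise closer than 1/4 and above -1/4; near
    infinity, the complement of a large cube, where walls and floor are trivial. *)
Lemma transport_locally_flat : locally_flat (transport_ext : data -> ext -> ext -> A).
Proof.
move=> p; case pE : (sval p : option R3) => [v|].
- have [vlow|vhigh] := ltP (cz v) 0.
    exists (sval @^-1` [set Some u | u in [set u | cz u < 0]]).
      move=> d; set W := _ @^-1` _.
      have T1 (q r : ext) : W q -> W r -> transport_ext d q r = 1.
        move=> [u /= u0 uq] [w /= w0 wr].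
        by rewrite /transport_ext -uq -wr /transport /= u0 w0.
      by split=> [q hq|q r s hq hr hs]; rewrite !T1 ?mulr1.
    apply: nbhs_ext; rewrite pE; apply: one_point_compactification_some_nbhs.
    have : \forall x \near nbhs (cz v), x < 0 by exact: lt_nbhsl.
    exact: (@coord_continuous R 1 3 0 (@Ordinal 3 2 isT)).
  exists (sval @^-1` [set Some u | u in ball v (8^-1)]); last first.
    apply: nbhs_ext; rewrite pE; apply: one_point_compactification_some_nbhs.
    by apply: nbhsx_ballx; rewrite invr_gt0.
  move=> d; pose U := [set P : option R3 |
    exists2 u, P = Some u & outside u /\ ball v 8^-1 u].
  have ball8 u : ball v 8^-1 u ->
      [/\ `|cx v - cx u| < 8^-1, `|cy v - cy u| < 8^-1 & `|cz v - cz u| < 8^-1].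
    rewrite -ball_normE /= norm3_lt ?invr_gt0 //.
    by rewrite /cx /cy /cz !mxE => /and3P.
  have Uout P : U P -> exists u, [/\ P = Some u, outside u & - 4^-1 < cz u].
    move=> [u -> [ou /ball8[_ _]]]; rewrite ltr_norml => hz; exists u; split=> //.
    lra.
  have Unear u w : U (Some u) -> U (Some w) -> nearby u w.
    move=> [_ [<-] [_ /ball8[x1 y1 z1]]] [_ [<-] [_ /ball8[x2 y2 z2]]].
    move: x1 y1 z1 x2 y2 z2; rewrite /nearby !ltr_norml => x1 y1 z1 x2 y2 z2.
    by apply/and3P; split; lra.
  have UE (q : ext) : (sval @^-1` [set Some u | u in ball v (8^-1)]) q -> U (sval q).
    case: q => q /= qext [u uv uq]; exists u => //; split=> //.
    by move: qext; rewrite -uq inE.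
  split=> [q /UE hq|q r s /UE hq /UE hr /UE hs]; first exact: (transport1 d hq).
  exact: (transport_mul Uout Unear).
- exists (sval @^-1` ((Some @` ~` [set v : R3 | `|v| <= 10]) `|` [set None])).
    move=> d; set W := _ @^-1` _.
    have farP (v : R3) : ~ (`|v| <= 10) -> far v.
      move=> /negP; rewrite -ltNge => h; apply/negP => /negP.
      rewrite !negb_or -!leNgt => /and3P[hx hy hz].
      move: h; rewrite ltNge => /negP; apply.
      rewrite leNgt; apply/negP => h.
      have : `|v| < 10 + (`|v| - 10) / 2; last by lra.
      rewrite norm3_lt; last by lra.
      by rewrite (le_lt_trans hx) ?(le_lt_trans hy) ?(le_lt_trans hz) //; lra.
    have WE (q : ext) : W q -> [/\ floor_at d (sval q) = 1, floor_atV d (sval q) = 1,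
        wall_opt d (sval q) = 1 & wall_optV d (sval q) = 1].
      move=> [[w /farP fw <-]|->] //.
      by have [-> ->] := far_floor d fw; rewrite /= /wall_at /wall_atV far_wall.
    have T1 (q r : ext) : W q -> W r -> transport_ext d q r = 1.
      move=> /WE[f1 f2 w1 w2] /WE[g1 g2 x1 x2].
      rewrite /transport_ext /transport /crossing f1 g2 x1 w2.
      by do 3?[case: ifP => _]; rewrite ?mulr1.
    by split=> [q hq|q r s hq hr hs]; rewrite !T1 ?mulr1.
  apply: nbhs_ext; rewrite pE; exists [set v : R3 | `|v| <= 10] => //.
  have cl : closed [set v : R3 | `|v| <= 10].
    have := @closed_ball_closed R R3 0 10; rewrite closed_ballE //.
    by rewrite /closed_ball_ /=; under eq_set do rewrite sub0r normrN.
  split=> //; apply: bounded_closed_compact => //.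
  by exists 10; split=> // x x10 v /= v10; apply: le_trans v10 (ltW x10).
Qed.

End flatness.

(** * Meridian loops and their holonomy *)

Section generators.
Context {R : realType} {A : pzRingType}.
Local Notation R3 := 'rV[R]_3.
Local Notation ext := (figure_eight_exterior R).
Local Notation data := (@fig8_gens A).
Local Notation G := (figure_eight_group R).
Implicit Types (u v w : R3) (d : data).

Lemma clamp_le0 (t : R) : t <= 0 -> clamp t = 0.
Proof.
move=> t0; rewrite /clamp; apply/max_idPl.
by rewrite ge_min t0.
Qed.

Lemma clamp_ge1 (t : R) : 1 <= t -> clamp t = 1.
Proof. by move=> t1; rewrite /clamp (min_idPr t1); apply/max_idPr. Qed.

(** Only the columns vary in ordinate, and they lie at height 1; a path of half-integral ordinate
    just has to keep away from them. *)
Let edge_shape p q : edge p q ->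
  (p.1.2 = q.1.2 \/ [/\ p.1.1 = q.1.1, p.2 = 1%N & q.2 = 1%N]) /\
  (p.2 <= 1)%N && (q.2 <= 1)%N.
Proof.
rewrite /edge => e; pose ok (e : (nat * nat * nat) * (nat * nat * nat)) :=
  ((e.1.1.2 == e.2.1.2) || [&& e.1.1.1 == e.2.1.1, e.1.2 == 1 & e.2.2 == 1])%N &&
  ((e.1.2 <= 1) && (e.2.2 <= 1))%N.
have /allP all_ok : all ok (zip figure_eight_vertices (rot 1 figure_eight_vertices)).
  by [].
case/orP: e => /all_ok; rewrite /ok /= => /andP[/orP[/eqP|/and3P[/eqP ? /eqP ? /eqP ?]]].
- by move=> ?; split; [left|].
- by split=> //; right.
- by move=> ? /andP[-> ->]; split; [left|].
- by move=> /andP[-> ->]; split=> //; right.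
Qed.

Lemma outside_high v : 5 / 4 <= cz v -> outside v.
Proof.
move=> zv; apply: outsideP => p q t /edge_shape[_ /andP[p1 q1]] t01.
have hp : (p.2%:R : R) <= 1 by rewrite (ler_nat _ _ 1).
have hq : (q.2%:R : R) <= 1 by rewrite (ler_nat _ _ 1).
by apply/and3P => -[_ _]; rewrite ltr_norml; nra.
Qed.

Let half_nat (i j : nat) : ~~ (`|i%:R + 2^-1 - j%:R| < 4^-1 :> R).
Proof.
rewrite -leNgt; have [ij|ji] := leqP j i.
  have : (j%:R : R) <= i%:R by rewrite ler_nat.
  by move=> ?; rewrite ler_normr; apply/orP; left; lra.
have : (i%:R + 1 : R) <= j%:R by rewrite natr1 ler_nat.
by move=> ?; rewrite ler_normr; apply/orP; right; lra.
Qed.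

Lemma outside_half v (j : nat) : cy v = j%:R + 2^-1 ->
  cz v = 2^-1 \/ (exists i : nat, cx v = i%:R + 2^-1) -> outside v.
Proof.
move=> yv h; apply: outsideP => p q t /edge_shape[[pq|[pq p1 q1]] _] t01.
  rewrite pq yv -mulrDl subrK mul1r.
  by rewrite (negbTE (half_nat _ _)) andbF.
rewrite pq p1 q1 -!mulrDl subrK !mul1r.
case: h => [->|[i ->]]; last by rewrite (negbTE (half_nat _ _)).
by apply/and3P => -[_ _]; rewrite ltr_norml; lra.
Qed.

Section meridian.
Variables i j : nat.
Hypothesis ij : spans i.+1 j.

(** Down from the viewpoint to the left of the [i.+1]st wall, through the wall
    at height 1/2, and back up. *)
Definition meridian_pt (t : R) : R3 :=
  ((i%:R + 2^-1) * clamp (5 * t) + clamp (5 * t - 2) -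
     (i%:R + 1 + 2^-1) * clamp (5 * t - 4)) *: delta_mx 0 (@Ordinal 3 0 isT) +
  ((j%:R + 2^-1) * (clamp (5 * t) - clamp (5 * t - 4))) *:
     delta_mx 0 (@Ordinal 3 1 isT) +
  (2 - 3 / 2 * clamp (5 * t - 1) + 3 / 2 * clamp (5 * t - 3)) *:
     delta_mx 0 (@Ordinal 3 2 isT).

Lemma meridian_x t : cx (meridian_pt t) = (i%:R + 2^-1) * clamp (5 * t) +
  clamp (5 * t - 2) - (i%:R + 1 + 2^-1) * clamp (5 * t - 4).
Proof. by rewrite /cx !mxE /= mulr1 !mulr0 !addr0. Qed.

Lemma meridian_y t : cy (meridian_pt t) =
  (j%:R + 2^-1) * (clamp (5 * t) - clamp (5 * t - 4)).
Proof. by rewrite /cy !mxE /= mulr1 !mulr0 addr0 add0r. Qed.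

Lemma meridian_z t : cz (meridian_pt t) =
  2 - 3 / 2 * clamp (5 * t - 1) + 3 / 2 * clamp (5 * t - 3).
Proof. by rewrite /cz !mxE /= mulr1 !mulr0 !add0r. Qed.

Let leg0 t : t <= 5^-1 -> cz (meridian_pt t) = 2.
Proof. by move=> h; rewrite meridian_z !clamp_le0; lra. Qed.

Let leg4 t : 4 / 5 <= t -> cz (meridian_pt t) = 2.
Proof. by move=> h; rewrite meridian_z !clamp_ge1; lra. Qed.

Let leg1 t : 5^-1 <= t <= 2 / 5 -> [/\ cx (meridian_pt t) = i%:R + 2^-1,
  cy (meridian_pt t) = j%:R + 2^-1 & 2^-1 <= cz (meridian_pt t)].
Proof.
move=> h; rewrite meridian_x meridian_y meridian_z.
rewrite (@clamp_ge1 (5 * t)); last lra.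
rewrite (@clamp_id _ (5 * t - 1)); last lra.
by rewrite !clamp_le0; try lra; split; lra.
Qed.

Let leg2 t : 2 / 5 <= t <= 3 / 5 ->
  [/\ i%:R + 2^-1 <= cx (meridian_pt t) <= i%:R + 1 + 2^-1,
      cy (meridian_pt t) = j%:R + 2^-1 & cz (meridian_pt t) = 2^-1].
Proof.
move=> h; rewrite meridian_x meridian_y meridian_z.
rewrite (@clamp_ge1 (5 * t)); last lra.
rewrite (@clamp_ge1 (5 * t - 1)); last lra.
rewrite (@clamp_id _ (5 * t - 2)); last lra.
by rewrite !clamp_le0; try lra; split; lra.
Qed.

Let leg3 t : 3 / 5 <= t <= 4 / 5 -> [/\ cx (meridian_pt t) = i%:R + 1 + 2^-1,
  cy (meridian_pt t) = j%:R + 2^-1 & 2^-1 <= cz (meridian_pt t)].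
Proof.
move=> h; rewrite meridian_x meridian_y meridian_z.
rewrite (@clamp_ge1 (5 * t)); last lra.
rewrite (@clamp_ge1 (5 * t - 1)); last lra.
rewrite (@clamp_ge1 (5 * t - 2)); last lra.
rewrite (@clamp_id _ (5 * t - 3)); last lra.
by rewrite !clamp_le0; try lra; split; lra.
Qed.

Lemma meridian_outside t : outside (meridian_pt t).
Proof.
have [h|h] := leP t 5^-1; first by apply: outside_high; rewrite leg0 //; lra.
have [h'|h'] := leP (4 / 5) t; first by apply: outside_high; rewrite leg4 //; lra.
have [h1|h1] := leP t (2 / 5).
  have [| x y _] := @leg1 t; first lra.
  by apply: (outside_half y); right; exists i.
have [h2|h2] := leP t (3 / 5).
  have [| _ y z] := @leg2 t; first lra.
  by apply: (outside_half y); left.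
have [| x y _] := @leg3 t; first lra.
by apply: (outside_half y); right; exists i.+1; rewrite -natr1.
Qed.

Definition meridian_fun (t : R) : ext :=
  exist _ (Some (meridian_pt t) : S3 R) (mem_set (@meridian_outside t)).

Let clamp_affine (u v : R) : continuous (fun t : R => clamp (u * t + v)).
Proof.
move=> t; apply: (@continuous_comp _ _ _ (fun t : R => u * t + v)).
  apply: continuousD; last exact: cst_continuous.
  by apply: continuousM; [exact: cst_continuous | exact: cvg_id].
exact: clamp_continuous.
Qed.

Lemma meridian_continuous : continuous meridian_fun.
Proof.
apply: continuous_comp_initial.
have -> : set_val \o meridian_fun = Some \o meridian_pt :> (R -> S3 R).
  by rewrite set_valE.
move=> t; apply: continuous_comp; last exact: one_point_compactification_some_continuous.
have c0 : continuous (fun t : R => clamp (5 * t)).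
  rewrite (_ : (fun t => _) = fun t => clamp (5 * t + 0)); first exact: clamp_affine.
  by apply/funext => s; rewrite addr0.
have cc k : continuous (fun t : R => clamp (5 * t - k)) by exact: clamp_affine.
have cZ (f : R -> R) w : continuous f -> continuous (fun t => f t *: w : R3).
  by move=> cf s; apply: cvgZr_tmp; exact: cf.
have cM (f : R -> R) k : continuous f -> continuous (fun t => k * f t).
  by move=> cf s; apply: continuousM; [exact: cst_continuous|exact: cf].
have cA (f g : R -> R) : continuous f -> continuous g -> continuous (fun t => f t + g t).
  by move=> cf cg s; apply: continuousD; [exact: cf|exact: cg].
have cB (f g : R -> R) : continuous f -> continuous g -> continuous (fun t => f t - g t).
  by move=> cf cg s; apply: continuousB; [exact: cf|exact: cg].
have ck (k : R) : continuous (fun _ : R => k) by move=> s; exact: cvg_cst.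
apply: continuousD; last first.
  apply: cZ; apply: cA; last by apply: cM; exact: cc.
  by apply: cB => //; apply: cM; exact: cc.
apply: continuousD; last by apply: cZ; apply: cM; apply: cB.
apply: cZ; apply: cB; last by apply: cM; exact: cc.
by apply: cA; [exact: cM|exact: cc].
Qed.

Let meridian_end t : cz (meridian_pt t) = 2 -> cx (meridian_pt t) = 0 ->
  cy (meridian_pt t) = 0 -> meridian_fun t = figure_eight_base R.
Proof.
move=> hz hx hy; apply: val_inj; congr Some.
apply/rowP; case=> -[|[|[|//]]] hk; rewrite [RHS]mxE /=.
- by rewrite -[RHS]hx; congr (meridian_pt t _ _); exact: val_inj.
- by rewrite -[RHS]hy; congr (meridian_pt t _ _); exact: val_inj.
- by rewrite -[RHS]hz; congr (meridian_pt t _ _); exact: val_inj.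
Qed.

Let meridian0 : meridian_fun 0 = figure_eight_base R.
Proof.
by apply: meridian_end; rewrite ?meridian_x ?meridian_y ?meridian_z mulr0 ?sub0r
  !clamp_le0; lra.
Qed.

Let meridian1 : meridian_fun 1 = figure_eight_base R.
Proof.
by apply: meridian_end; rewrite ?meridian_x ?meridian_y ?meridian_z mulr1
  !clamp_ge1; lra.
Qed.

Definition meridian : loop R (figure_eight_base R) :=
  Loop (continuous_subspaceT meridian_continuous) meridian0 meridian1.

(** Flat sets covering the five legs of the loop: above the walls, within one cell, and the gate,
    where [i.+1] is the only wall between the two cells. *)
Let high : set ext := [set q | exists2 v, sval q = Some v & 1 <= cz v].
Let slab (k : nat) : set ext :=
  [set q | exists v, [/\ sval q = Some v, 0 <= cz v & cell_x v = k]].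
Let gate : set ext := [set q | exists v, [/\ sval q = Some v, 0 <= cz v < 1,
  cell_y v = j & cell_x v = i \/ cell_x v = i.+1]].

Let floor1 d v : 0 <= cz v ->
  floor_at d (Some v) = 1 /\ floor_atV d (Some v) = 1.
Proof. by move=> z0; rewrite /= !(ltNge (cz v)) z0 andbF. Qed.

Let flat1 (U : set ext) :
  (forall d p q, U p -> U q -> transport_ext d p q = 1) ->
  flat_on (transport_ext : data -> ext -> ext -> A) U.
Proof.
by move=> T1 d; split=> [p Up|p q r Up Uq Ur]; rewrite !T1 ?mulr1.
Qed.

Let high1 d p q : high p -> high q -> transport_ext d p q = 1.
Proof.
move=> [v pv zv] [w qw zw]; rewrite /transport_ext pv qw /transport.
have z0 (u : R3) : 1 <= cz u -> 0 <= cz u by lra.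
have [-> _] := floor1 d (z0 _ zv); have [_ ->] := floor1 d (z0 _ zw).
rewrite /crossing /= /wall_at /wall_atV /on_wall !(ltNge _ 1) zv zw /= !andbF /=.
by do 3?[case: ifP => _]; rewrite ?mulr1.
Qed.

Let slab1 k d p q : slab k p -> slab k q -> transport_ext d p q = 1.
Proof.
move=> [v [pv zv kv]] [w [qw zw kw]]; rewrite /transport_ext pv qw /transport.
have [-> _] := floor1 d zv; have [_ ->] := floor1 d zw.
by rewrite /crossing /= kv kw ltnn !mulr1; case: ifP.
Qed.

Let gateE d p q v w : sval p = Some v -> sval q = Some w ->
  0 <= cz v < 1 -> 0 <= cz w < 1 -> cell_y v = j -> cell_y w = j ->
  transport_ext d p q =
    if (cell_x v < cell_x w)%N
    then if cell_x w == i.+1 then label d i.+1 else wall_at d w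
    else if (cell_x w < cell_x v)%N
    then if cell_x v == i.+1 then labelV d i.+1 else wall_atV d v else 1.
Proof.
move=> pv qw /andP[z0 z1] /andP[y0 y1] vj wj.
rewrite /transport_ext pv qw /transport /= !(ltNge _ 0) z0 y0 /= !andbF !mulr1 mul1r.
rewrite /crossing /=; case: ifP => _; [|case: ifP => // _].
  case: eqP => // kw; rewrite /wall_at /on_wall kw wj ij y1 andbT.
  by rewrite ifT //; lra.
case: eqP => // kv; rewrite /wall_atV /on_wall kv vj ij z1 andbT.
by rewrite ifT //; lra.
Qed.

Let gate_flat : flat_on (transport_ext : data -> ext -> ext -> A) gate.
Proof.
move=> d; split=> [p [v [pv zv vj _]]|p q r].
  by rewrite (gateE d pv pv) // ltnn.
move=> [v [pv zv vj kv]] [w [qw zw wj kw]] [u [ru zu uj ku]].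
rewrite (gateE d pv qw) // (gateE d qw ru) // (gateE d pv ru) //.
have ni : (i == i.+1) = false by apply/eqP; lia.
have ii : (i.+1 < i)%N = false by apply/negbTE; rewrite -leqNgt.
by case: kv => ->; case: kw => ->; case: ku => ->;
  rewrite ?ltnn ?ltnSn ?eqxx ?ni ?ii ?mulr1 ?mul1r ?mul_label ?mul_labelV.
Qed.

Let fifth (k : nat) (t : R) : k%:R / 5 <= t <= k.+1%:R / 5 -> (k < 5)%N ->
  match k with
  | 0 => t <= 5^-1 | 1 => 5^-1 <= t <= 2 / 5 | 2 => 2 / 5 <= t <= 3 / 5
  | 3 => 3 / 5 <= t <= 4 / 5 | _ => 4 / 5 <= t end.
Proof. by case: k => [|[|[|[|[|//]]]]]; lra. Qed.

Let piece (k : nat) : set ext :=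
  match k with 1 => slab i | 2 => gate | 3 => slab i.+1 | _ => high end.

Let truncn_half (x : R) (k : nat) : k%:R <= x < k%:R + 1 -> Num.truncn x = k.
Proof. by rewrite natr1; exact: truncn_def. Qed.

Let meridian_piece k t : (k < 5)%N -> k%:R / 5 <= t <= k.+1%:R / 5 ->
  piece k (meridian_fun t).
Proof.
move=> k5 /fifth/(_ k5); case: k k5 => [|[|[|[|[|//]]]]] _ h /=.
- by exists (meridian_pt t) => //; rewrite leg0 //; lra.
- exists (meridian_pt t); have [x y z] := leg1 h; split=> //; first lra.
  by rewrite /cell_x x; apply: truncn_half; lra.
- exists (meridian_pt t); have [x y z] := leg2 h; split=> //.
  + by rewrite z; lra.
  + by rewrite /cell_y y; apply: truncn_half; lra.
  + have [lt|ge] := ltP (cx (meridian_pt t)) (i%:R + 1).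
      by left; apply: truncn_half; lra.
    by right; apply: truncn_half; rewrite -natr1; lra.
- exists (meridian_pt t); have [x y z] := leg3 h; split=> //; first lra.
  by rewrite /cell_x x; apply: truncn_half; rewrite -natr1; lra.
- by exists (meridian_pt t) => //; rewrite leg4 //; lra.
Qed.

(** Only the third leg, through the gate, contributes; the transport is 1 on the sets containing the
    others. *)
Lemma meridian_hol d : loop_hol transport_locally_flat d meridian = label d i.+1.
Proof.
have flat_piece k : flat_on (transport_ext : data -> ext -> ext -> A) (piece k).
  case: k => [|[|[|[|k]]]] /=; try exact: gate_flat.
  - by apply: flat1 => ? ? ?; exact: high1.
  - by apply: flat1 => ? ? ?; exact: slab1.
  - by apply: flat1 => ? ? ?; exact: slab1.
  - by apply: flat1 => ? ? ?; exact: high1.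
have itv (k : nat) (t : R) : (k < 5)%N -> k%:R / 5 <= t <= k.+1%:R / 5 -> 0 <= t <= 1.
  by case: k => [|[|[|[|[|//]]]]] _; lra.
have pc k t : (k < 5)%N -> k%:R / 5 <= t <= k.+1%:R / 5 ->
    piece k ((meridian \o clamp) t).
  by move=> k5 kt; rewrite /= clamp_id ?(itv k) //; exact: meridian_piece.
rewrite (@loop_holE _ _ _ _ _ _ _ _ _ 5%N) //; last first.
  by move=> k k5; exists (piece k) => // t; exact: pc.
have ends (k : nat) : (k%:R : R) / 5 <= (k%:R : R) / 5 <= k.+1%:R / 5 /\
    (k%:R : R) / 5 <= (k.+1%:R : R) / 5 <= k.+1%:R / 5.
  by rewrite !lexx /= andbT ler_pM2r ?invr_gt0 ?ltr0n ?ler_nat.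
have P0 k : (k < 5)%N -> piece k ((meridian \o clamp) (k%:R / 5)).
  by move=> k5; apply: pc => //; exact: (ends k).1.
have P1 k : (k < 5)%N -> piece k ((meridian \o clamp) (k.+1%:R / 5)).
  by move=> k5; apply: pc => //; exact: (ends k).2.
rewrite /holonomy /chain mul1r.
rewrite (high1 d (P0 0%N isT) (P1 0%N isT)) (slab1 d (P0 1%N isT) (P1 1%N isT)).
rewrite (slab1 d (P0 3%N isT) (P1 3%N isT)) (high1 d (P0 4%N isT) (P1 4%N isT)).
rewrite !mul1r !mulr1.
have [v [pv zv vj _]] := P0 2%N isT; have [w [qw zw wj _]] := P1 2%N isT.
rewrite (gateE d pv qw) //.
(* The ends of the third leg also end the second and begin the fourth, which places them in cells
   [i] and [i.+1]. *)
have [v' [pv' _ kv]] := P1 1%N isT; have [w' [qw' _ kw]] := P0 3%N isT.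
have [vv] : Some v = Some v' by rewrite -pv -pv'.
have [ww] : Some w = Some w' by rewrite -qw -qw'.
by rewrite vv ww kv kw ltnSn eqxx.
Qed.

End meridian.

Definition fig8_hol d (g : G) : A := pi1_hol transport_locally_flat d g.

Lemma fig8_holM d g h : fig8_hol d (g * h)%g = fig8_hol d g * fig8_hol d h.
Proof. exact: pi1_holM. Qed.

Lemma fig8_hol_label (i j : nat) : spans i.+1 j ->
  exists x : G, forall d, fig8_hol d x = label d i.+1.
Proof.
move=> ij; exists (\pi_(@pi1 R _ (figure_eight_base R)) (meridian i j)) => d.
by rewrite /fig8_hol pi1_holE meridian_hol.
Qed.

(** For fixed [g] the holonomy is a word in the generators whose shape does not depend on [d], so
    [S] may be any multiplicative property of functions of [d], such as rationality. *)
Lemma fig8_hol_ind (S : (data -> A) -> Prop) :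
  S (fun=> 1) -> (forall f h, S f -> S h -> S (fun d => f d * h d)) ->
  S gena -> S genaV -> S genb -> S genbV -> forall g, S (fun d => fig8_hol d g).
Proof.
move=> S1 SM Sa SaV Sb SbV g.
have SM3 f h k : S f -> S h -> S k -> S (fun d => f d * h d * k d).
  by move=> Sf Sh Sk; apply: (SM (fun d => f d * h d)) => //; exact: SM.
have Slabel i : S (fun d => label d i).
  rewrite /label; case: i => [|[|[|[|[|[|[|i]]]]]]] //=; try exact: SM3.
  by under eq_fun do rewrite nth_nil.
have SlabelV i : S (fun d => labelV d i).
  rewrite /labelV; case: i => [|[|[|[|[|[|[|i]]]]]]] //=; try exact: SM3.
  by under eq_fun do rewrite nth_nil.
have Swall i l : S (fun d => wall d i l) by rewrite /wall; case: (spans i l).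
have SwallV i l : S (fun d => wallV d i l) by rewrite /wallV; case: (spans i l).
have Scolor k l : S (fun d => color d k l) by elim: k => //= k IH; exact: SM.
have ScolorV k l : S (fun d => colorV d k l) by elim: k => //= k IH; exact: SM.
have St (p q : ext) : S (fun d => transport_ext d p q).
  rewrite /transport_ext; move: (sval p : option R3) (sval q : option R3) => P Q.
  rewrite /transport; case: (lower P && lower Q) => //; apply: SM3.
  - by rewrite /floor_at; case: P => [v|] //; case: (-1 <= cz v < 0).
  - rewrite /crossing; case: (cell_x_opt P < cell_x_opt Q)%N.
      by rewrite /wall_opt /wall_at; case: Q => [v|] //; case: (on_wall v).
    case: (cell_x_opt Q < cell_x_opt P)%N => //.
    by rewrite /wall_optV /wall_atV; case: P => [v|] //; case: (on_wall v).
  - by rewrite /floor_atV; case: Q => [v|] //; case: (-1 <= cz v < 0).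
have [p [n pn]] := @pi1_hol_chain R _ _ A _ transport_locally_flat (figure_eight_base R) g.
have -> : (fun d => fig8_hol d g) = fun d => chain transport_ext d p n.
  by apply/funext => d; exact: pn.
by elim: n {pn} => //= n IH; exact: SM.
Qed.

End generators.

(** * Induced representations *)

Section block_monomial.
Context {F : fieldType} {k m : nat}.
Implicit Types (p q : 'I_k -> 'I_k) (w v : 'I_k -> 'M[F]_m).

(** Block column [c] holds the single block [w c], in block row [p c]; a constant [p] gives
    [unit_block]. *)
Definition monomial p w : 'M[F]_(k * m) :=
  \matrix_(i, j) if (mxtens_unindex i).1 == p (mxtens_unindex j).1
    then w (mxtens_unindex j).1 (mxtens_unindex i).2 (mxtens_unindex j).2 else 0.

Lemma monomialE p w b c i j :
  monomial p w (mxtens_index (b, i)) (mxtens_index (c, j)) =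
  if b == p c then w c i j else 0.
Proof. by rewrite mxE !mxtens_indexK. Qed.

Lemma eq_monomial p q w v : p =1 q -> w =1 v -> monomial p w = monomial q v.
Proof. by move=> pq wv; apply/matrixP => i j; rewrite !mxE pq wv. Qed.

Lemma sum_tens (f : 'I_(k * m) -> F) :
  \sum_i f i = \sum_b \sum_i f (mxtens_index (b, i)).
Proof.
rewrite pair_bigA (reindex (@mxtens_index k m)) /=; last first.
  exists (@mxtens_unindex k m) => i _; first exact: mxtens_indexK.
  exact: mxtens_unindexK.
by apply: eq_bigr => -[b i].
Qed.

Lemma monomialM p q w v : monomial p w *m monomial q v =
  monomial (p \o q) (fun c => w (q c) *m v c).
Proof.
apply/matrixP => i j; case: (mxtens_indexP i) => b {}i; case: (mxtens_indexP j) => c {}j.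
rewrite mxE sum_tens (bigD1 (q c)) //= [X in _ + X]big1 ?addr0 => [|d dq].
  rewrite monomialE /=; have [->|bp] := eqVneq b (p (q c)).
    by rewrite [RHS]mxE; apply: eq_bigr => l _; rewrite !monomialE !eqxx.
  by rewrite big1 // => l _; rewrite monomialE (negbTE bp) mul0r.
by rewrite big1 // => l _; rewrite [X in _ * X]monomialE (negbTE dq) mulr0.
Qed.

Lemma monomial1 : monomial id (fun=> 1%:M) = 1%:M.
Proof.
apply/matrixP => i j; case: (mxtens_indexP i) => b {}i; case: (mxtens_indexP j) => c {}j.
rewrite monomialE !mxE (inj_eq (can_inj (@mxtens_indexK k m))) xpair_eqE.
by case: eqP.
Qed.

Lemma monomialD p w v : monomial p w + monomial p v =
  monomial p (fun c => w c + v c).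
Proof. by apply/matrixP => i j; rewrite !mxE; case: ifP; rewrite ?addr0 ?mxE. Qed.

Lemma monomial_scalar c : c%:M = monomial id (fun=> c%:M).
Proof.
apply/matrixP => i j; case: (mxtens_indexP i) => b {}i; case: (mxtens_indexP j) => d {}j.
rewrite monomialE !mxE (inj_eq (can_inj (@mxtens_indexK k m))) xpair_eqE.
by case: eqP.
Qed.

Lemma trace_monomial w : \tr (monomial id w) = \sum_c \tr (w c).
Proof.
rewrite /mxtrace sum_tens; apply: eq_bigr => c _; apply: eq_bigr => i _.
by rewrite monomialE eqxx.
Qed.

End block_monomial.

Section block_determinants.
Context {F : fieldType} {m : nat}.

Lemma det_block_diag k (w : 'I_k -> 'M[F]_m) :
  \det (monomial id w) = \prod_c \det (w c).
Proof.
elim: k w => [|k IH] w; first by rewrite big_ord0 det_mx00.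
rewrite big_ord_recl -(IH (fun c => w (lift ord0 c))).
have -> : monomial id w = block_mx (w ord0) 0 0 (monomial id (fun c => w (lift ord0 c)))
    :> 'M_(m + k * m); last by rewrite det_ublock.
have un1 (u : 'I_m) : mxtens_unindex (lshift (k * m) u : 'I_(k.+1 * m)) = (ord0, u).
  by congr pair; apply: val_inj; rewrite /= ?divn_small ?modn_small.
have un2 (v : 'I_(k * m)) : mxtens_unindex (rshift m v : 'I_(k.+1 * m)) =
    (lift ord0 (mxtens_unindex v).1, (mxtens_unindex v).2).
  have m0 : (0 < m)%N by case: m v => // -[v]; rewrite muln0.
  congr pair; apply: val_inj; rewrite /= ?lift0 /=.
    by rewrite -[X in (X + _)%N]mul1n divnMDl // /bump add1n.
  by rewrite -[X in (X + _)%N]mul1n modnMDl.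
apply/matrixP => i j; rewrite [LHS]mxE.
case: (@splitP m (k * m) i) => u iE; case: (@splitP m (k * m) j) => v jE.
- have -> : i = lshift (k * m) u by apply: val_inj.
  have -> : j = lshift (k * m) v by apply: val_inj.
  by rewrite !un1 /= block_mxEul.
- have -> : i = lshift (k * m) u by apply: val_inj.
  have -> : j = rshift m v by apply: val_inj.
  by rewrite un1 un2 /= block_mxEur mxE.
- have -> : i = rshift m u by apply: val_inj.
  have -> : j = lshift (k * m) v by apply: val_inj.
  by rewrite un1 un2 /= block_mxEdl mxE.
- have -> : i = rshift m u by apply: val_inj.
  have -> : j = rshift m v by apply: val_inj.
  by rewrite !un2 /= block_mxEdr mxE (inj_eq lift_inj).
Qed.

(** A product of two conjugate block transpositions is an even permutation. *)
Lemma det_block_perm k (s p q r : 'I_k -> 'I_k) :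
  s =1 p \o r -> r =1 q \o p \o q -> p \o p =1 id -> q \o q =1 id ->
  \det (monomial s (fun=> 1%:M : 'M[F]_m)) = 1.
Proof.
move=> sE rE pp qq; pose S (t : 'I_k -> 'I_k) := monomial t (fun=> 1%:M : 'M[F]_m).
have SM t t' : S t *m S t' = S (t \o t').
  by rewrite /S monomialM; apply: eq_monomial => // c; rewrite mulmx1.
have SE t t' : t =1 t' -> S t = S t' by move=> h; exact: eq_monomial.
have S1 : S id = 1%:M by exact: monomial1.
have rS : S r = S q *m S p *m S q by rewrite SM SM; exact: SE.
have sS : S s = S p *m S r by rewrite SM; exact: SE.
have dq : \det (S q) * \det (S q) = 1 by rewrite -det_mulmx SM (SE _ _ qq) S1 det1.
have dp : \det (S p) * \det (S p) = 1 by rewrite -det_mulmx SM (SE _ _ pp) S1 det1.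
by rewrite -/(S s) sS rS !det_mulmx mulrAC dq mul1r dp.
Qed.

End block_determinants.

(** * The block monomial matrices of the dihedral representation *)

Section dihedral.
Context {F : fieldType} {m : nat}.

Record gl_pair := GlPair {
  pA : 'M[F]_m; pAV : 'M[F]_m; pB : 'M[F]_m; pBV : 'M[F]_m;
  pAK : pA *m pAV = 1%:M; pAVK : pAV *m pA = 1%:M;
  pBK : pB *m pBV = 1%:M; pBVK : pBV *m pB = 1%:M;
  pdet : \det pA * \det pB = 1 }.

Let o0 : 'I_5 := @Ordinal 5 0 isT.
Let o1 : 'I_5 := @Ordinal 5 1 isT.
Let o2 : 'I_5 := @Ordinal 5 2 isT.
Let o3 : 'I_5 := @Ordinal 5 3 isT.
Let o4 : 'I_5 := @Ordinal 5 4 isT.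

(** The permutations [(1 2)(3 4)] and [(0 1)(2 3)] act as reflections of a pentagon and fix 0 and 4
    respectively. *)
Definition perma (c : 'I_5) : 'I_5 := nth o0 [:: o0; o2; o1; o4; o3] c.
Definition permb (c : 'I_5) : 'I_5 := nth o0 [:: o1; o0; o3; o2; o4] c.

Definition blocks (x0 x1 x2 x3 x4 : 'M[F]_m) (c : 'I_5) : 'M[F]_m :=
  nth 0 [:: x0; x1; x2; x3; x4] c.

Variable P : gl_pair.
Local Notation A := (pA P).
Local Notation A' := (pAV P).
Local Notation B := (pB P).
Local Notation B' := (pBV P).
Local Notation I := (1%:M : 'M[F]_m).

(** The representation of the figure-eight group induced from the index 5
    subgroup of its dihedral action on five points, through the quotient of that
    subgroup by the normal closure of its meridian: a free group of rank 2,
    whose generators act by [A] and [B]. *)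
Definition mxa : 'M[F]_(5 * m) := monomial perma (blocks I I A I B).
Definition mxaV : 'M[F]_(5 * m) := monomial perma (blocks I A' I B' I).
Definition mxb : 'M[F]_(5 * m) := monomial permb (blocks I (A *m B *m A') I A I).
Definition mxbV : 'M[F]_(5 * m) := monomial permb (blocks (A *m B' *m A') I A' I I).

Let AK n (x : 'M_(m, n)) : A *m (A' *m x) = x. Proof. by rewrite mulmxA pAK mul1mx. Qed.
Let AVK n (x : 'M_(m, n)) : A' *m (A *m x) = x. Proof. by rewrite mulmxA pAVK mul1mx. Qed.
Let BK n (x : 'M_(m, n)) : B *m (B' *m x) = x. Proof. by rewrite mulmxA pBK mul1mx. Qed.
Let BVK n (x : 'M_(m, n)) : B' *m (B *m x) = x. Proof. by rewrite mulmxA pBVK mul1mx. Qed.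

Let simp := (mul1mx, mulmx1, AK, AVK, BK, BVK, pAK, pAVK, pBK, pBVK).

Let cases5 (Q : 'I_5 -> Prop) : Q o0 -> Q o1 -> Q o2 -> Q o3 -> Q o4 -> forall c, Q c.
Proof.
by move=> q0 q1 q2 q3 q4 [[|[|[|[|[|//]]]]] h];
  [move: q0|move: q1|move: q2|move: q3|move: q4]; congr Q; exact: val_inj.
Qed.

Lemma mxaK : mxa *m mxaV = 1%:M.
Proof.
rewrite monomialM -monomial1; apply: eq_monomial; apply: cases5 => //=;
by rewrite /blocks /= ?simp.
Qed.

Lemma mxaVK : mxaV *m mxa = 1%:M.
Proof.
rewrite monomialM -monomial1; apply: eq_monomial; apply: cases5 => //=;
by rewrite /blocks /= ?simp.
Qed.

Lemma mxbK : mxb *m mxbV = 1%:M.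
Proof.
rewrite monomialM -monomial1; apply: eq_monomial; apply: cases5 => //=;
by rewrite /blocks /= -?mulmxA ?simp.
Qed.

Lemma mxbVK : mxbV *m mxb = 1%:M.
Proof.
rewrite monomialM -monomial1; apply: eq_monomial; apply: cases5 => //=;
by rewrite /blocks /= -?mulmxA ?simp.
Qed.

(** Both sides permute the five blocks in the same way, and their blocks agree after cancelling
    inverses. *)
Lemma mx_rel : mxa *m mxb *m mxaV *m mxb *m mxa = mxb *m mxa *m mxbV *m mxa *m mxb.
Proof.
rewrite !monomialM; apply: eq_monomial; apply: cases5 => //=;
by rewrite /blocks /= ?simp -?mulmxA ?simp.
Qed.

Definition gens : @fig8_gens 'M[F]_(5 * m) :=
  Fig8Gens mxaK mxaVK mxbK mxbVK mx_rel.

Let det_conj (x y z : 'M[F]_m) : x *m z = 1%:M -> \det (x *m y *m z) = \det y.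
Proof.
by move=> xz; rewrite !det_mulmx mulrAC -det_mulmx xz det1 mul1r.
Qed.

Let prod5 (f : 'I_5 -> F) : \prod_c f c = f o0 * f o1 * f o2 * f o3 * f o4.
Proof.
rewrite !big_ord_recr big_ord0 /= mul1r.
by do 4?[congr (_ * _)]; congr (f _); exact: val_inj.
Qed.

Lemma det_mxa : \det mxa = 1.
Proof.
have -> : mxa = monomial perma (fun=> I) *m monomial id (blocks I I A I B).
  by rewrite monomialM; apply: eq_monomial => // c; rewrite mul1mx.
rewrite det_mulmx det_block_diag prod5 /blocks /= !det1 !mul1r !mulr1 pdet mulr1.
(* [(1 2)(3 4)] is [(1 2)] times its conjugate by [(1 3)(2 4)]. *)
apply: (@det_block_perm _ _ _ _ (fun c => nth o0 [:: o0; o2; o1; o3; o4] c)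
  (fun c => nth o0 [:: o0; o3; o4; o1; o2] c) (fun c => nth o0 [:: o0; o1; o2; o4; o3] c));
  by apply: cases5.
Qed.

Lemma det_mxb : \det mxb = 1.
Proof.
have -> : mxb = monomial permb (fun=> I) *m monomial id (blocks I (A *m B *m A') I A I).
  by rewrite monomialM; apply: eq_monomial => // c; rewrite mul1mx.
rewrite det_mulmx det_block_diag prod5 /blocks /= !det1 !mul1r !mulr1.
rewrite det_conj ?pAK // mulrC [\det B * _]mulrC pdet mul1r.
apply: (@det_block_perm _ _ _ _ (fun c => nth o0 [:: o1; o0; o2; o3; o4] c)
  (fun c => nth o0 [:: o2; o3; o0; o1; o4] c) (fun c => nth o0 [:: o0; o1; o3; o2; o4] c));
  by apply: cases5.
Qed.

Lemma det_mxaV : \det mxaV = 1.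
Proof.
by have := congr1 determinant mxaK; rewrite det_mulmx det_mxa mul1r det1.
Qed.

Lemma det_mxbV : \det mxbV = 1.
Proof.
by have := congr1 determinant mxbK; rewrite det_mulmx det_mxb mul1r det1.
Qed.

(** Squares of meridians are block diagonal with one identity block: block 0 here, then 4, 1 and 3
    in the next three lemmas. *)
Lemma mx_aa : mxa *m mxa = monomial id (blocks I A A B B).
Proof.
rewrite monomialM; apply: eq_monomial; apply: cases5 => //=;
by rewrite /blocks /= ?simp.
Qed.

Lemma mx_bb : mxb *m mxb = monomial id (blocks (A *m B *m A') (A *m B *m A') A A I).
Proof.
rewrite monomialM; apply: eq_monomial; apply: cases5 => //=;
by rewrite /blocks /= ?simp.
Qed.

Lemma mx_baab : mxbV *m mxa *m mxa *m mxb = monomial id (blocks A I B A B).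
Proof.
rewrite !monomialM; apply: eq_monomial; apply: cases5 => //=;
by rewrite /blocks /= ?simp -?mulmxA ?simp.
Qed.

Lemma mx_abba : mxaV *m mxb *m mxb *m mxa =
  monomial id (blocks (A *m B *m A') A B I (B' *m A *m B)).
Proof.
rewrite !monomialM; apply: eq_monomial; apply: cases5 => //=;
by rewrite /blocks /= ?simp -?mulmxA ?simp.
Qed.

End dihedral.

Section fraction_matrices.
Context {F : numFieldType}.
Implicit Types (D : {poly F}).

Definition fraction_mx n p D (M : F -> 'M[F]_(n, p)) : Prop :=
  forall i j, fraction_fun D (fun t => M t i j).

Lemma fraction_mulmx n p q D (M : F -> 'M[F]_(n, p)) (N : F -> 'M[F]_(p, q)) :
  fraction_mx D M -> fraction_mx D N -> fraction_mx D (fun t => M t *m N t).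
Proof.
move=> fM fN i j; under eq_fun do rewrite mxE.
by apply: fraction_sum => k; exact: fraction_mul.
Qed.

Lemma fraction_det n D (M : F -> 'M[F]_n) :
  fraction_mx D M -> fraction_fun D (fun t => \det (M t)).
Proof.
move=> fM; apply: fraction_sum => s; apply: fraction_mul; first exact: fraction_const.
by apply: fraction_prod => i; exact: fM.
Qed.

Lemma fraction_cofactor n D (M : F -> 'M[F]_n) i j :
  fraction_mx D M -> fraction_fun D (fun t => cofactor (M t) i j).
Proof.
move=> fM; apply: fraction_mul; first exact: fraction_const.
by apply: fraction_det => k l; under eq_fun do rewrite !mxE; exact: fM.
Qed.

Lemma fraction_divisor D (f g : F -> F) : (forall t, f t * g t = D.[t]) ->
  fraction_fun D g -> fraction_fun D (fun t => (f t)^-1).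
Proof.
move=> fg hg; apply: fraction_ext (fraction_mul hg (fraction_inv D)) => t.
rewrite -fg mulf_eq0 negb_or => /andP[f0 g0].
by rewrite invfM mulrCA mulfV ?mulr1.
Qed.

Lemma fraction_monomial k m D p (w : F -> 'I_k -> 'M[F]_m) :
  (forall c, fraction_mx D (fun t => w t c)) ->
  fraction_mx D (fun t => monomial p (w t)).
Proof.
move=> fw i j; under eq_fun do rewrite mxE.
case: ((mxtens_unindex i).1 == p (mxtens_unindex j).1); first exact: fw.
exact: fraction_const.
Qed.

End fraction_matrices.

(** * Rational parametrisation of the pairs of matrices *)

Section parameters.
Context {F : numFieldType} {m' : nat}.
Local Notation m := m'.+2.
Implicit Types (tau : 'M[F]_m).

(** The first row of [tau] holds the eigenvalues of [A], the other rows are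
    those of [B]; the first row of [B] is [(x, 1, .., 1)], where [x] is chosen so
    that [det A * det B = 1]. *)
Definition fill (x : F) tau : 'M[F]_m :=
  \matrix_(i, j) if i == 0 then if j == 0 then x else 1 else tau i j.

(** Its nonvanishing makes [A] invertible and the equation for the corner of [B] solvable; all
    denominators that occur divide it. *)
Definition goodval tau : F := (\prod_k tau 0 k) * cofactor tau 0 0.
(** Solves [det A * det B = 1], which is affine in the corner by [det_fill]. *)
Definition corner tau : F :=
  ((\prod_k tau 0 k)^-1 - \det (fill 0 tau)) / cofactor tau 0 0.

Definition parA tau : 'M[F]_m := diag_mx (row 0 tau).
Definition parAV tau : 'M[F]_m := diag_mx (\row_k (tau 0 k)^-1).
Definition parB tau : 'M[F]_m := fill (corner tau) tau.
Definition parBV tau : 'M[F]_m := (\prod_k tau 0 k) *: \adj (parB tau).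

Let lift_eq0 (k : 'I_m'.+1) : (lift 0 k == 0 :> 'I_m) = false.
Proof. by apply/negbTE; rewrite eq_sym neq_lift. Qed.

Let cofactor_fill x tau j : cofactor (fill x tau) 0 j = cofactor (fill 0 tau) 0 j.
Proof.
rewrite /cofactor; congr (_ * \det _); apply/matrixP => k l.
by rewrite !mxE lift_eq0.
Qed.

Lemma det_fill x tau :
  \det (fill x tau) = x * cofactor tau 0 0 + \det (fill 0 tau).
Proof.
rewrite (expand_det_row _ 0) [in RHS](expand_det_row _ 0) big_ord_recl [in RHS]big_ord_recl.
rewrite !mxE !eqxx mul0r add0r cofactor_fill; congr (_ * _ + _).
  rewrite /cofactor; congr (_ * \det _); apply/matrixP => k l.
  by rewrite !mxE lift_eq0.
apply: eq_bigr => j _; rewrite [in RHS]cofactor_fill cofactor_fill.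
by congr (_ * _); rewrite !mxE.
Qed.

Section good.
Variable tau : 'M[F]_m.
Hypothesis good : goodval tau != 0.

Let lam0 : \prod_k tau 0 k != 0.
Proof. by move: good; rewrite mulf_eq0 negb_or => /andP[]. Qed.

Let cof0 : cofactor tau 0 0 != 0.
Proof. by move: good; rewrite mulf_eq0 negb_or => /andP[]. Qed.

Let det_parB : \det (parB tau) = (\prod_k tau 0 k)^-1.
Proof. by rewrite det_fill divfK // subrK. Qed.

Let lamk k : tau 0 k != 0.
Proof. by move: lam0; rewrite (bigD1 k) //= mulf_eq0 negb_or => /andP[]. Qed.

Let parAK : parA tau *m parAV tau = 1%:M.
Proof.
rewrite mulmx_diag -diag_const_mx; congr diag_mx.
by apply/rowP => k; rewrite !mxE mulfV.
Qed.

Let parAVK : parAV tau *m parA tau = 1%:M.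
Proof. exact: mulmx1C parAK. Qed.

Let parBK : parB tau *m parBV tau = 1%:M.
Proof.
by rewrite -scalemxAr mul_mx_adj det_parB scale_scalar_mx mulfV.
Qed.

Let parBVK : parBV tau *m parB tau = 1%:M.
Proof. exact: mulmx1C parBK. Qed.

Let par_det : \det (parA tau) * \det (parB tau) = 1.
Proof.
rewrite det_parB det_diag (eq_bigr (fun k => tau 0 k)) ?mulfV // => k _.
by rewrite mxE.
Qed.

Definition good_pair : gl_pair := GlPair parAK parAVK parBK parBVK par_det.

End good.

Let trivial_pair : @gl_pair F m.
Proof.
by apply: (@GlPair _ _ 1%:M 1%:M 1%:M 1%:M); rewrite ?mul1mx ?det1 ?mul1r.
Defined.

(** A total function of [tau]: parameters that are not good get the trivial pair, and they belong to
    no stage. *)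
Definition par_pair tau : gl_pair :=
  if @idP (goodval tau != 0) is ReflectT h then good_pair h else trivial_pair.

Lemma par_pairE tau : goodval tau != 0 ->
  [/\ pA (par_pair tau) = parA tau, pAV (par_pair tau) = parAV tau,
      pB (par_pair tau) = parB tau & pBV (par_pair tau) = parBV tau].
Proof. by move=> h; rewrite /par_pair; case: {-}_ / idP. Qed.

Section line.
Variables p q : 'M[F]_m.

Definition line (t : F) : 'M[F]_m := p + t *: (q - p).

Lemma line0 : line 0 = p. Proof. by rewrite /line scale0r addr0. Qed.
Lemma line1 : line 1 = q. Proof. by rewrite /line scale1r addrC subrK. Qed.

Let line_fraction D : fraction_mx D line.
Proof.
move=> i j; under eq_fun do rewrite !mxE.
apply: fraction_add; first exact: fraction_const.
apply: fraction_mul; last exact: fraction_const.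
by apply: fraction_ext (fraction_poly D 'X) => t _; rewrite hornerX.
Qed.

Let prod_fraction D : fraction_fun D (fun t => \prod_k line t 0 k).
Proof. by apply: fraction_prod => k; exact: line_fraction. Qed.

Lemma goodval_line : exists D : {poly F}, forall t, goodval (line t) = D.[t].
Proof.
(* A fraction with denominator 1 is a polynomial. *)
have [|D [e h]] := @fraction_mul F 1 (fun t => \prod_k line t 0 k)
    (fun t => cofactor (line t) 0 0) (prod_fraction 1).
  by apply: fraction_cofactor; exact: line_fraction.
by exists D => t; rewrite [LHS]h ?hornerC ?oner_eq0 // expr1n divr1.
Qed.

Lemma par_fraction D : (forall t, goodval (line t) = D.[t]) ->
  [/\ fraction_mx D (fun t => pA (par_pair (line t))),
      fraction_mx D (fun t => pAV (par_pair (line t))),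
      fraction_mx D (fun t => pB (par_pair (line t))) &
      fraction_mx D (fun t => pBV (par_pair (line t)))].
Proof.
move=> hD.
have ext (M N : F -> 'M[F]_m) : (forall t, goodval (line t) != 0 -> M t = N t) ->
    fraction_mx D M -> fraction_mx D N.
  by move=> MN fM i j; apply: fraction_ext (fM i j) => t Dt; rewrite MN ?hD.
have cof : fraction_fun D (fun t => cofactor (line t) 0 0).
  by apply: fraction_cofactor; exact: line_fraction.
have fillf (x : F -> F) : fraction_fun D x -> fraction_mx D (fun t => fill (x t) (line t)).
  move=> fx i j; under eq_fun do rewrite mxE.
  case: (i == 0); last exact: line_fraction.
  by case: (j == 0) => //; exact: fraction_const.
have fB : fraction_mx D (fun t => parB (line t)).
  apply: (fillf (fun t => corner (line t))); apply: fraction_mul.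
    apply: fraction_add; first exact: fraction_divisor hD cof.
    have f0 := fraction_det (fillf _ (fraction_const D 0)).
    apply: fraction_ext (fraction_mul (fraction_const D (-1)) f0) => t _.
    by rewrite mulN1r.
  apply: (@fraction_divisor _ _ _ (fun t => \prod_k line t 0 k)) => // t.
  by rewrite mulrC -hD.
split.
- apply: (ext (fun t => parA (line t))) => [t /par_pairE[]//|i j].
  rewrite /parA; under eq_fun do rewrite mxE.
  case: (i == j); last by under eq_fun do rewrite mulr0n; exact: fraction_const.
  by under eq_fun do rewrite mulr1n mxE; exact: line_fraction.
- apply: (ext (fun t => parAV (line t))) => [t /par_pairE[]//|i j].
  rewrite /parAV; under eq_fun do rewrite mxE.
  case: (i == j); last by under eq_fun do rewrite mulr0n; exact: fraction_const.
  under eq_fun do rewrite mulr1n mxE.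
  apply: (@fraction_divisor _ _ _
    (fun t => (\prod_(k | k != i) line t 0 k) * cofactor (line t) 0 0)) => [t|].
    by rewrite mulrA -hD /goodval [in RHS](bigD1 i).
  by apply: fraction_mul cof; apply: fraction_prod => k; exact: line_fraction.
- by apply: ext fB => t /par_pairE[].
- apply: (ext (fun t => parBV (line t))) => [t /par_pairE[]//|i j].
  rewrite /parBV; under eq_fun do rewrite !mxE.
  by apply: fraction_mul => //; exact: fraction_cofactor.
Qed.

End line.
End parameters.

(** * Representations of the figure-eight group attached to the pairs *)

Section representation.
Context {R : realType} {F : numFieldType} {m : nat}.
Local Notation G := (figure_eight_group R).
Implicit Types (P : @gl_pair F m) (g : G).

Lemma det_fig8_hol P g : \det (fig8_hol (gens P) g) = 1.
Proof.
have := @fig8_hol_ind R _ (fun f => forall P, \det (f (gens P)) = 1); apply => //.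
- by move=> Q; exact: det1.
- by move=> f h hf hh Q; rewrite -mulmxE det_mulmx hf hh mulr1.
- by move=> Q; exact: det_mxa.
- by move=> Q; exact: det_mxaV.
- by move=> Q; exact: det_mxb.
- by move=> Q; exact: det_mxbV.
Qed.

Definition rep P : SLrep F G (5 * m) := MkSLrep (det_fig8_hol P) (fig8_holM (gens P)).

Lemma rep_generators : exists xa xaV xb xbV : G, forall P,
  [/\ rep P xa = mxa P, rep P xaV = mxaV P, rep P xb = mxb P & rep P xbV = mxbV P].
Proof.
(* Columns 1, 2, 5 and 6 carry the generators and their inverses; the second number is a strip that
   the column spans. *)
have [xa ha] := @fig8_hol_label R 'M[F]_(5 * m) 0 2 isT.
have [xb hb] := @fig8_hol_label R 'M[F]_(5 * m) 1 3 isT.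
have [xaV haV] := @fig8_hol_label R 'M[F]_(5 * m) 4 2 isT.
have [xbV hbV] := @fig8_hol_label R 'M[F]_(5 * m) 5 3 isT.
by exists xa, xaV, xb, xbV => P; split; rewrite /= ?ha ?hb ?haV ?hbV.
Qed.

Lemma rep_fraction (D : {poly F}) (c : F -> @gl_pair F m) :
  fraction_mx D (fun t => pA (c t)) -> fraction_mx D (fun t => pAV (c t)) ->
  fraction_mx D (fun t => pB (c t)) -> fraction_mx D (fun t => pBV (c t)) ->
  forall g i j, fraction_fun D (fun t => rep (c t) g i j).
Proof.
move=> fA fAV fB fBV g.
have f1 : fraction_mx D (fun _ : F => 1%:M : 'M[F]_m) by move=> i j; exact: fraction_const.
have fm (f : F -> 'M[F]_m) x y : fraction_mx D f -> fraction_mx D x -> fraction_mx D y ->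
    fraction_mx D (fun t => x t *m f t *m y t).
  by move=> ff fx fy; apply: fraction_mulmx fy; exact: fraction_mulmx.
apply: (@fig8_hol_ind R _ (fun f => fraction_mx D (fun t => f (gens (c t))))).
- by move=> i j; exact: fraction_const.
- by move=> f h; exact: fraction_mulmx.
- by apply: fraction_monomial => -[[|[|[|[|[|//]]]]] h] /=.
- by apply: fraction_monomial => -[[|[|[|[|[|//]]]]] h] /=.
- by apply: fraction_monomial => -[[|[|[|[|[|//]]]]] h] /=; try exact: fm.
- by apply: fraction_monomial => -[[|[|[|[|[|//]]]]] h] /=; try exact: fm.
Qed.

End representation.

(** * Matrices with a single nonzero block *)

Section unit_blocks.
Context {F : fieldType} {k m : nat}.
Implicit Types (X : 'M[F]_m) (b c d : 'I_k).

Definition unit_block d c X : 'M[F]_(k * m) :=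
  monomial (fun=> d) (fun c' => if c' == c then X else 0).

Lemma unit_block_diag c X :
  monomial id (fun c' => if c' == c then X else 0) = unit_block c c X.
Proof.
apply/matrixP => i j; rewrite !mxE.
by have [->//|_] := eqVneq (mxtens_unindex j).1 c; rewrite mxE !if_same.
Qed.

Lemma mul_monomial_unit p w d c X :
  monomial p w *m unit_block d c X = unit_block (p d) c (w d *m X).
Proof.
rewrite monomialM; apply: eq_monomial => // c' /=.
by case: ifP; rewrite ?mulmx0.
Qed.

Lemma mul_unit_monomial p w d c c' X : injective p -> p c' = c ->
  unit_block d c X *m monomial p w = unit_block d c' (X *m w c').
Proof.
move=> pI pc; rewrite monomialM; apply: eq_monomial => // b /=.
by rewrite -pc (inj_eq pI); case: eqP => [->|]; rewrite ?mul0mx.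
Qed.

Lemma unit_blockD d c X Y : unit_block d c X + unit_block d c Y = unit_block d c (X + Y).
Proof.
by rewrite monomialD; apply: eq_monomial => // c' /=; case: eqP; rewrite ?addr0.
Qed.

Lemma mul_unit_block d c b X Y :
  unit_block d c X *m unit_block c b Y = unit_block d b (X *m Y).
Proof. by rewrite mul_monomial_unit eqxx. Qed.

Lemma trace_unit_block c X : \tr (unit_block c c X) = \tr X.
Proof.
rewrite -unit_block_diag trace_monomial (bigD1 c) //= eqxx big1 ?addr0 // => d /negbTE->.
exact: mxtrace0.
Qed.

Lemma unit_blockE d c i j :
  unit_block d c (delta_mx i j) = delta_mx (mxtens_index (d, i)) (mxtens_index (c, j)).
Proof.
apply/matrixP => i' j'; case: (mxtens_indexP i') => d' {}i'.
case: (mxtens_indexP j') => c' {}j'; rewrite monomialE mxE.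
rewrite !(inj_eq (can_inj (@mxtens_indexK _ _))) !xpair_eqE.
by case: (d' == d); case: (c' == c); rewrite ?mxE ?andbF.
Qed.

End unit_blocks.

Section diagonal_products.
Context {F : fieldType}.

Lemma prod_monomial (I : Type) k m (r : seq I) (w : I -> 'I_k -> 'M[F]_m) :
  \big[mulmx/1%:M]_(i <- r) monomial id (w i) =
  monomial id (fun c => \big[mulmx/1%:M]_(i <- r) w i c).
Proof.
elim: r => [|i r IH].
  by rewrite big_nil -monomial1; apply: eq_monomial => // c; rewrite big_nil.
by rewrite big_cons IH monomialM; apply: eq_monomial => // c; rewrite big_cons.
Qed.

Lemma prod_diag_mx (I : Type) m (r : seq I) (D : I -> 'rV[F]_m) :
  \big[mulmx/1%:M]_(i <- r) diag_mx (D i) = diag_mx (\row_j \prod_(i <- r) D i 0 j).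
Proof.
elim: r => [|i r IH].
  rewrite big_nil -diag_const_mx; congr diag_mx; apply/rowP => j.
  by rewrite !mxE big_nil.
rewrite big_cons IH mulmx_diag; congr diag_mx; apply/rowP => j.
by rewrite !mxE big_cons.
Qed.

Lemma delta_sandwich m (M : 'M[F]_m) u i j v :
  delta_mx u i *m M *m delta_mx j v = M i j *: (delta_mx u v : 'M[F]_m).
Proof.
apply/matrixP => u' v'; rewrite !mxE (bigD1 j) //= big1 ?addr0 => [|w wj].
  rewrite !mxE (bigD1 i) //= big1 ?addr0 => [|w wi].
    rewrite !mxE !eqxx andbT /=; case: (u' == u); case: (v' == v);
    by rewrite ?mulr0 ?mul0r ?mulr1 ?mul1r.
  by rewrite !mxE (negbTE wi) andbF mul0r.
by rewrite !mxE (negbTE wj) mulr0.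
Qed.

Lemma trace_delta_mul m (M : 'M[F]_m) i j : \tr (delta_mx i j *m M) = M j i.
Proof.
rewrite /mxtrace (bigD1 i) //= big1 ?addr0 => [|u ui].
  rewrite mxE (bigD1 j) //= big1 ?addr0 => [|v vj]; first by rewrite !mxE !eqxx mul1r.
  by rewrite !mxE (negbTE vj) andbF mul0r.
by rewrite mxE big1 // => v _; rewrite !mxE (negbTE ui) mul0r.
Qed.

End diagonal_products.

Section invariants.
Context {F : fieldType} {G : groupType} {N : nat}.

Lemma invariant_add (f h : SLrep F G N -> F) : invariant_fun f -> invariant_fun h ->
  invariant_fun (fun rho => f rho + h rho).
Proof.
move=> [rf If] [rh Ih]; split; first exact: regular_add.
by move=> rho rho' c; rewrite (If _ _ c) (Ih _ _ c).
Qed.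

Lemma invariant_scale a (f : SLrep F G N -> F) : invariant_fun f ->
  invariant_fun (fun rho => a * f rho).
Proof.
move=> [rf If]; split; first by apply: regular_mul => //; exact: regular_const.
by move=> rho rho' c; rewrite (If _ _ c).
Qed.

Lemma invariant_const a : invariant_fun (fun _ : SLrep F G N => a).
Proof. by split=> //; exact: regular_const. Qed.

End invariants.

(** * A flag of families of representations *)

Section flag.
Context {R : realType} {F : numFieldType} {m' : nat}.
Local Notation m := m'.+2.
Local Notation G := (figure_eight_group R).
Local Notation Rep := (SLrep F G (5 * m)).
Implicit Types (tau : 'M[F]_m) (rho : Rep).

Definition rho_of tau : Rep := rep (par_pair tau).

(** The eigenvalues 2, 3, .. of [A] are distinct and differ from 1. Below its first row, [B - 1] has
    ones in the first column and on the diagonal, and zeros elsewhere. *)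
Definition base : 'M[F]_m :=
  \matrix_(i, j) if i == 0 then j.+2%:R else if j == 0 then 1
                 else if i == j then 2 else 0.

(** The entries of the rows of [B] come first, the eigenvalues of [A] last. *)
Definition entry_rank (i j : 'I_m) : nat :=
  if i == 0 then (m'.+1 * m + j)%N else (i.-1 * m + j)%N.

Definition stage (s : nat) : set 'M[F]_m := [set tau | goodval tau != 0 /\
  forall i j, (s <= entry_rank i j)%N -> tau i j = base i j].

Let lift_eq0 (k : 'I_m'.+1) : (lift 0 k == 0 :> 'I_m) = false.
Proof. by apply/negbTE; rewrite eq_sym neq_lift. Qed.

Lemma base_good : goodval base != 0.
Proof.
rewrite /goodval mulf_neq0 //.
  by apply/prodf_neq0 => k _; rewrite mxE eqxx pnatr_eq0.
rewrite /cofactor expr0 mul1r (_ : row' _ _ = 2%:M).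
  by rewrite det_scalar expf_neq0 // pnatr_eq0.
apply/matrixP => i j; rewrite !mxE !lift_eq0 (inj_eq lift_inj).
by case: eqP.
Qed.

Lemma stage_base s : stage s base.
Proof. by split=> //; exact: base_good. Qed.

Lemma stage_le s t : (s <= t)%N -> stage s `<=` stage t.
Proof. by move=> st tau [g h]; split=> // i j /(leq_trans st); exact: h. Qed.

(** The line through two parameters of a stage stays in it off the zeros of the polynomial
    [goodval], and the representation is rational along it. *)
Lemma irreducible_stage s :
  irreducible_set [set character (rho_of tau) | tau in stage s].
Proof.
apply: irreducible_rational; first by exists base; exact: stage_base.
move=> p q [gp hp] [gq hq]; have [D hD] := goodval_line p q.
exists (line p q), D; split; [exact: line0|exact: line1| | |].
- by rewrite -!hD line0 line1.
- move=> t Dt; split; first by rewrite hD.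
  move=> i j ij.
  have -> : line p q t i j = p i j + t * (q i j - p i j) by rewrite !mxE.
  by rewrite hp // hq // subrr mulr0 addr0.
- have [fA fAV fB fBV] := par_fraction hD.
  exact: rep_fraction.
Qed.

Lemma entry_rank_surj s : (s < m * m)%N -> exists i j, entry_rank i j = s.
Proof.
move=> sm; have m0 : (0 < m)%N by [].
pose j : 'I_m := Ordinal (ltn_pmod s m0).
have [lt|ge] := ltnP s (m'.+1 * m).
  have im : ((s %/ m).+1 < m)%N by rewrite ltnS ltn_divLR.
  by exists (Ordinal im), j; rewrite /entry_rank /= -divn_eq.
exists 0, j; rewrite /entry_rank eqxx /= [RHS](divn_eq s m).
suff -> : (s %/ m = m'.+1)%N by [].
apply/eqP; rewrite eqn_leq -ltnS ltn_divLR // leq_divRL //.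
by rewrite sm ge.
Qed.

Let pred_lt (i : 'I_m) : i != 0 -> (i.-1 < m'.+1)%N.
Proof. by case: i => -[|n]. Qed.

(** * Group ring elements and the invariants that separate the stages *)

Section group_ring.
Variables xa xaV xb xbV : G.
Hypothesis gensE : forall P : @gl_pair F m,
  [/\ rep P xa = mxa P, rep P xaV = mxaV P, rep P xb = mxb P & rep P xbV = mxbV P].

(** Squares of meridians; each is the identity on the block fixed by its
    reflection. *)
Definition sq0 rho := rho xa *m rho xa.
Definition sq4 rho := rho xb *m rho xb.
Definition sq1 rho := rho xbV *m rho xa *m rho xa *m rho xb.
Definition sq3 rho := rho xaV *m rho xb *m rho xb *m rho xa.

Lemma group_alg_sq : [/\ group_alg sq0, group_alg sq4, group_alg sq1 & group_alg sq3].
Proof. by split; do ?[apply: group_alg_mul]; exact: group_alg_rep. Qed.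

Definition plus_scalar (phi : Rep -> 'M[F]_(5 * m)) c rho := phi rho + c%:M.

Lemma group_alg_plus phi c : group_alg phi -> group_alg (plus_scalar phi c).
Proof. by move=> h; apply: group_alg_add => //; exact: group_alg_scalar. Qed.

(** An unnormalised Lagrange interpolation polynomial in [sq0]: when [A] is the base diagonal
    matrix, it isolates the [i]-th eigenline in block 2. *)
Definition lagrange (i : 'I_m) rho :=
  \big[mulmx/1%:M]_(k <- [seq k <- enum 'I_m | k != i]) plus_scalar sq0 (- base 0 k) rho.

Lemma group_alg_lagrange i : group_alg (lagrange i).
Proof.
by apply: group_alg_prod => k; apply: group_alg_plus; have [] := group_alg_sq.
Qed.

Definition lagrange_coef (i : 'I_m) : F :=
  \prod_(k <- [seq k <- enum 'I_m | k != i]) (base 0 i - base 0 k).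

Lemma lagrange_coef_neq0 i : lagrange_coef i != 0.
Proof.
rewrite /lagrange_coef prodf_seq_neq0; apply/allP => k; rewrite mem_filter => /andP[ki _] /=.
rewrite !mxE eqxx subr_eq0 eqr_nat eqSS eqSS; apply: contra ki => /eqP h.
by apply/eqP/ord_inj.
Qed.

Let o2 : 'I_5 := @Ordinal 5 2 isT.

Lemma sq0E P : sq0 (rep P) = monomial id (blocks 1%:M (pA P) (pA P) (pB P) (pB P)).
Proof. by have [ha _ _ _] := gensE P; rewrite /sq0 ha mx_aa. Qed.

Lemma sq1E P : sq1 (rep P) = monomial id (blocks (pA P) 1%:M (pB P) (pA P) (pB P)).
Proof. by have [ha _ hb hbV] := gensE P; rewrite /sq1 ha hb hbV mx_baab. Qed.

Lemma plus_monomial k (w : 'I_k -> 'M[F]_m) c :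
  monomial id w + c%:M = monomial id (fun b => w b + c%:M).
Proof. by rewrite monomial_scalar monomialD. Qed.

Lemma lagrangeE P i : pA P = parA base -> exists w,
  lagrange i (rep P) = monomial id w /\ w o2 = lagrange_coef i *: delta_mx i i.
Proof.
move=> PA; rewrite /lagrange.
under eq_bigr do rewrite /plus_scalar sq0E plus_monomial.
rewrite prod_monomial; eexists; split; first by [].
rewrite /= PA; under eq_bigr => k _.
  have -> : blocks 1%:M (parA base) (parA base) (pB P) (pB P) o2 + (- base 0 k)%:M =
      diag_mx (\row_j (base 0 j - base 0 k)).
    rewrite /blocks /= /parA -diag_const_mx -raddfD; congr diag_mx.
    by apply/rowP => j; rewrite !mxE.
  over.
rewrite prod_diag_mx; apply/matrixP => u v; rewrite !mxE.
have [->|uv] := eqVneq u v; last first.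
  rewrite mulr0n; have [ui|] := eqVneq u i; last by rewrite mulr0.
  have [vi|] := eqVneq v i; last by rewrite mulr0.
  by rewrite ui vi eqxx in uv.
rewrite mulr1n andbb; have [->|vi] := eqVneq v i.
  by rewrite mulr1; apply: eq_bigr => k _; rewrite !mxE.
have vr : v \in [seq k <- enum 'I_m | k != i] by rewrite mem_filter vi mem_enum.
by rewrite mulr0 (big_rem v vr) /= mxE subrr mul0r.
Qed.

(** [sq0 - 1], [sq4 - 1], [sq1 - 1] and [sq3 - 1] kill the blocks 0, 4, 1 and 3,
    so that the product lives in block 2 for all values of the parameters. *)
Definition path_elt (i j k : 'I_m) rho :=
  plus_scalar sq0 (-1) rho *m lagrange i rho *m plus_scalar sq4 (-1) rho *m
  plus_scalar sq1 (-1) rho *m lagrange j rho *m plus_scalar sq3 (-1) rho *m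
  lagrange k rho.

Lemma group_alg_path i j k : group_alg (path_elt i j k).
Proof.
have [h0 h4 h1 h3] := group_alg_sq.
by do ![apply: group_alg_mul]; first [exact: group_alg_plus | exact: group_alg_lagrange].
Qed.

Definition path_coef (i j k : 'I_m) : F :=
  (base 0 i - 1) ^+ 2 * lagrange_coef i * lagrange_coef j * lagrange_coef k.

Lemma path_coef_neq0 i j k : path_coef i j k != 0.
Proof.
have h : base 0 i - 1 != 0 by rewrite mxE eqxx subr_eq0 pnatr_eq1.
by rewrite !mulf_neq0 ?lagrange_coef_neq0.
Qed.

(** In block 2, [sq0] and [sq4] are [A] while [sq1] and [sq3] are [B]. The Lagrange factors are
    multiples of diagonal matrix units, so the product reads the entries of [B - 1] along the path
    [i], [j], [k]. *)
Lemma path_eltE P i j k : pA P = parA base ->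
  path_elt i j k (rep P) = unit_block o2 o2 ((path_coef i j k *
    ((pB P - 1%:M) i j * (pB P - 1%:M) j k)) *: delta_mx i k).
Proof.
move=> PA; have [ha haV hb hbV] := gensE P; rewrite /path_elt /plus_scalar.
have [wi [-> wi2]] := lagrangeE i PA; have [wj [-> wj2]] := lagrangeE j PA.
have [wk [-> wk2]] := lagrangeE k PA.
rewrite sq0E sq1E /sq4 /sq3 ha haV hb mx_bb mx_abba.
rewrite !plus_monomial !monomialM -unit_block_diag; apply: eq_monomial => // c /=.
have N1 : (-1)%:M = - 1%:M :> 'M[F]_m by rewrite raddfN.
rewrite N1; case: eqP => [->|c2]; last first.
  by case: c c2 => -[|[|[|[|[|//]]]]] h c2; rewrite /blocks /=
    ?subrr ?mul0mx ?mulmx0 ?mul0mx ?mulmx0 ?mul0mx //; case: c2; exact: val_inj.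
rewrite wi2 wj2 wk2 /blocks /= PA; set d := pB P - 1%:M.
have AE : (parA base - 1%:M) *m delta_mx i i = (base 0 i - 1) *: delta_mx i i.
  rewrite mulmxBl mul1mx scalerBl scale1r; congr (_ - _).
  rewrite /parA mul_diag_mx; apply/matrixP => u v; rewrite !mxE.
  by have [->|] := eqVneq u i; rewrite ?mulr0.
rewrite -!scalemxAr -!scalemxAl -?scalemxAr AE -?scalemxAl.
have EA : delta_mx i i *m (parA base - 1%:M) = (base 0 i - 1) *: delta_mx i i.
  rewrite mulmxBr mulmx1 scalerBl scale1r; congr (_ - _).
  rewrite /parA mul_mx_diag; apply/matrixP => u v; rewrite !mxE.
  by have [->|] := eqVneq v i; rewrite ?andbF ?mulr0 ?mul0r // mulrC.
rewrite EA -!scalemxAl delta_sandwich -!scalemxAl delta_sandwich !scalerA.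
by congr (_ *: _); rewrite /path_coef; ring.
Qed.

Lemma parA_stage s tau : (s <= m'.+1 * m)%N -> stage s tau -> parA tau = parA base.
Proof.
move=> sm [_ h]; congr diag_mx; apply/rowP => j; rewrite ![in LHS]mxE h ?mxE //.
by rewrite /entry_rank eqxx; apply: leq_trans sm (leq_addr _ _).
Qed.

(** Let [j] be nonzero. A path from 0 through [j] back to 0 has trace proportional to [tau j 0], the
    first row of [B] being 1 off the corner. For other [k], a factor [sq1] closes the path from [k]
    to 0 and brings in [tau k 0]; the subtracted term carries the same factor. *)
Definition entry_fun (j k : 'I_m) rho : F :=
  if k == 0 then \tr (path_elt 0 j 0 rho) + - (path_coef 0 j 0 * base j 0)
  else path_coef 0 k 0 * \tr (path_elt 0 j k rho *m sq1 rho) +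
       - (path_coef 0 j k * (base j k - (j == k)%:R)) * \tr (path_elt 0 k 0 rho).

Lemma entry_fun_invariant j k : invariant_fun (entry_fun j k).
Proof.
have [_ _ h1 _] := group_alg_sq.
rewrite /entry_fun; case: (k == 0); apply: invariant_add.
- exact: group_alg_trace (group_alg_path _ _ _).
- exact: invariant_const.
- apply: invariant_scale; apply: group_alg_trace; apply: group_alg_mul h1.
  exact: group_alg_path.
- by apply: invariant_scale; exact: group_alg_trace (group_alg_path _ _ _).
Qed.

Definition entry_coef (j k : 'I_m) : F :=
  path_coef 0 j k * (if k == 0 then 1 else path_coef 0 k 0).

Lemma entry_funE tau j k : goodval tau != 0 -> parA tau = parA base -> j != 0 ->
  entry_fun j k (rho_of tau) =
  entry_coef j k * (tau j k - base j k) * (if k == 0 then 1 else tau k 0).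
Proof.
move=> good PA j0; have [EA _ EB _] := par_pairE good.
have PA' : pA (par_pair tau) = parA base by rewrite EA.
rewrite /entry_fun /entry_coef /rho_of !path_eltE // sq1E.
rewrite (@mul_unit_monomial _ _ _ id _ o2 o2 o2) //.
rewrite !trace_unit_block -scalemxAl !mxtraceZ trace_delta_mul.
have tr1 (i : 'I_m) : \tr (delta_mx i i : 'M[F]_m) = 1.
  by rewrite -[delta_mx i i]mulmx1 trace_delta_mul mxE eqxx.
rewrite !tr1 EB.
have B0 l : l != 0 -> (parB tau - 1%:M) 0 l = 1.
  by move=> l0; rewrite !mxE eqxx (negbTE l0) eq_sym (negbTE l0) subr0.
have Bj l i : l != 0 -> (parB tau - 1%:M) l i = tau l i - (l == i)%:R.
  by move=> l0; rewrite !mxE (negbTE l0).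
have [->|k0] := eqVneq k 0.
  by rewrite B0 // Bj // (negbTE j0) subr0 !mulr1 mul1r mulrBr.
rewrite !B0 // !Bj // (negbTE k0) subr0.
have -> : parB tau k 0 = tau k 0 by rewrite mxE (negbTE k0).
ring.
Qed.

Lemma entry_coef_neq0 j k : entry_coef j k != 0.
Proof.
rewrite mulf_neq0 ?path_coef_neq0 //.
by case: ifP; rewrite ?oner_eq0 ?path_coef_neq0.
Qed.

(** Vanishes as soon as [base 0 k] is an eigenvalue of [A], whatever [B] is. *)
Definition eigen_fun (k : 'I_m) rho : F := \det (plus_scalar sq0 (- base 0 k) rho).

Lemma eigen_fun_invariant k : invariant_fun (eigen_fun k).
Proof.
by have [h0 _ _ _] := group_alg_sq; apply: group_alg_det; exact: group_alg_plus.
Qed.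

Lemma eigen_funE tau k : goodval tau != 0 -> eigen_fun k (rho_of tau) =
  (1 - base 0 k) ^+ m * \det (parA tau - (base 0 k)%:M) ^+ 2 *
  \det (parB tau - (base 0 k)%:M) ^+ 2.
Proof.
move=> good; have [EA _ EB _] := par_pairE good.
rewrite /eigen_fun /plus_scalar /rho_of sq0E plus_monomial det_block_diag.
rewrite !big_ord_recl big_ord0 /blocks /= EA EB raddfN -[1%:M - _]raddfB det_scalar.
ring.
Qed.

Let fill_det0 tau : (forall i, i != 0 -> tau i 0 = 0) -> \det (fill 0 tau) = 0.
Proof.
move=> h; rewrite (expand_det_col _ 0) big1 // => i _.
by rewrite mxE eqxx; case: eqVneq => [_|/h->]; rewrite mul0r.
Qed.

Let cofactor_scalar tau c : (forall i j, i != 0 -> j != 0 -> tau i j = c *+ (i == j)) ->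
  cofactor tau 0 0 = c ^+ m'.+1.
Proof.
move=> h; rewrite /cofactor expr0 mul1r (_ : row' _ _ = c%:M) ?det_scalar //.
by apply/matrixP => i j; rewrite !mxE h ?lift_eq0 // (inj_eq lift_inj).
Qed.

(** Moves the [j]-th eigenvalue off its base value and makes [B] upper triangular, with ones on the
    diagonal below the corner, so that its characteristic polynomial is explicit. *)
Let eigen_point (j : 'I_m) : 'M[F]_m :=
  \matrix_(k, l) if k == 0 then base 0 l + (l == j)%:R else (k == l)%:R.

Let eigen_point_prod j : exists M : nat, \prod_l eigen_point j 0 l = M.+1%:R.
Proof.
exists (\prod_(l < m) (l.+2 + (l == j)))%N.-1; rewrite prednK; last first.
  by apply/prodn_gt0 => l; rewrite addSn.
by rewrite natr_prod; apply: eq_bigr => l _; rewrite !mxE eqxx natrD.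
Qed.

Let eigen_point_cof j : cofactor (eigen_point j) 0 0 = 1.
Proof.
rewrite (@cofactor_scalar _ 1) ?expr1n // => k l k0 l0.
by rewrite mxE (negbTE k0).
Qed.

Let eigen_point_good j : goodval (eigen_point j) != 0.
Proof.
have [M hM] := eigen_point_prod j.
by rewrite /goodval hM eigen_point_cof mulr1 pnatr_eq0.
Qed.

Let eigen_point_fun j : eigen_fun j (rho_of (eigen_point j)) != 0.
Proof.
rewrite eigen_funE; last exact: eigen_point_good.
have baseE l : base 0 l = l.+2%:R by rewrite mxE eqxx.
have mu1 : 1 - base 0 j != 0 by rewrite baseE subr_eq0 eq_sym pnatr_eq1.
apply: mulf_neq0; [apply: mulf_neq0|]; apply: expf_neq0 => //.
- rewrite -diag_const_mx /parA -raddfB det_diag; apply/prodf_neq0 => l _.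
  rewrite !mxE eqxx subr_eq0 -natrD eqr_nat.
  case: (eqVneq l j) => [->|lj]; first by rewrite addn1 eqn_leq ltnn.
  by rewrite addn0 !eqSS; apply: contra lj => /eqP h; apply/eqP/ord_inj.
- have -> : parB (eigen_point j) - (base 0 j)%:M =
     fill (corner (eigen_point j) - base 0 j) (eigen_point j - (base 0 j)%:M).
    apply/matrixP => k l; rewrite !mxE.
    have [->|k0] //= := eqVneq k 0.
    by have [l0|l0] := eqVneq l 0; rewrite ?mulr1n // mulr0n subr0.
  rewrite det_fill fill_det0 ?addr0; last first.
    by move=> k k0; rewrite !mxE (negbTE k0) subr0.
  rewrite (@cofactor_scalar _ (1 - base 0 j)); last first.
    by move=> k l k0 l0; rewrite !mxE (negbTE k0) mulrnBl.
  rewrite mulf_neq0 ?expf_neq0 // /corner fill_det0; last first.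
    by move=> k k0; rewrite mxE (negbTE k0).
  have [M hM] := eigen_point_prod j; rewrite hM eigen_point_cof subr0 divr1 baseE.
  (* The corner is the inverse of [M.+1]; equality with [j.+2] would force [j.+2 * M.+1 = 1]. *)
  rewrite subr_eq0; apply/eqP => h.
  have : (1 : F) = (j.+2 * M.+1)%:R by rewrite natrM -h mulVf // pnatr_eq0.
  by move/eqP; rewrite eq_sym pnatr_eq1 muln_eq1.
Qed.

(** A freed entry of [B] is detected by [entry_fun] on a line through [base], a freed eigenvalue by
    [eigen_fun] at [eigen_point]. *)
Lemma stage_separated s : (s < m * m)%N -> exists phi : Rep -> F,
  [/\ invariant_fun phi, forall tau, stage s tau -> phi (rho_of tau) = 0 &
      exists2 tau, stage s.+1 tau & phi (rho_of tau) != 0].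
Proof.
move=> sm; have [i [j ijs]] := entry_rank_surj sm.
have [i0|i0] := eqVneq i 0.
  exists (eigen_fun j); split; first exact: eigen_fun_invariant.
    move=> tau [good h]; rewrite eigen_funE // (_ : \det (parA tau - _) = 0).
      by rewrite expr0n mulr0 mul0r.
    rewrite -diag_const_mx /parA -raddfB det_diag (bigD1 j) //=.
    by rewrite !mxE -[X in tau X j]i0 h ?ijs // i0 mxE eqxx subrr mul0r.
  exists (eigen_point j); last exact: eigen_point_fun.
  split=> [|k l]; first exact: eigen_point_good.
  (* Entries of higher rank are the later eigenvalues, which [eigen_point] leaves at their base
     values. *)
  rewrite -ijs i0 => lt; have [k0|k0] := eqVneq k 0.
    rewrite k0 mxE eqxx; have [lj|_] := eqVneq l j; last by rewrite addr0.
    by move: lt; rewrite k0 lj ltnn.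
  exfalso; move: lt; rewrite /entry_rank eqxx (negbTE k0) ltnNge => /negP; apply.
  have kp := pred_lt k0.
  apply: leq_trans (leq_addr _ _).
  apply: leq_trans (_ : k.-1.+1 * m <= _)%N; last by rewrite leq_mul2r kp orbT.
  by rewrite mulSnr leq_add2l ltnW.
have sle : (s < m'.+1 * m)%N.
  rewrite -ijs /entry_rank (negbTE i0).
  have ip := pred_lt i0.
  apply: leq_trans (_ : i.-1.+1 * m <= _)%N; last by rewrite leq_mul2r ip orbT.
  by rewrite mulSnr ltn_add2l.
exists (entry_fun i j); split; first exact: entry_fun_invariant.
  move=> tau st; have PA := parA_stage (ltnW sle) st; have [good h] := st.
  by rewrite entry_funE // h ?ijs // subrr mulr0 mul0r.
have [D hD] := goodval_line base (base + delta_mx i j).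
(* A nonroot of [D * 'X] is a good point of the line other than [base]. *)
have [t] : exists t, (D * 'X).[t] != 0.
  apply: nonroot_exists; rewrite mulf_neq0 ?polyX_eq0 //.
  apply: contraNneq base_good => D0; have := hD 0.
  by rewrite line0 D0 horner0 => ->.
rewrite hornerM hornerX mulf_eq0 negb_or => /andP[Dt t0].
have lineE k l : line base (base + delta_mx i j) t k l =
    base k l + t * ((k == i) && (l == j))%:R.
  by rewrite /line addrAC subrr add0r [LHS]mxE [X in _ + X]mxE ?[delta_mx _ _ _ _]mxE.
have st : stage s.+1 (line base (base + delta_mx i j) t).
  split=> [|k l lt]; first by rewrite hD.
  rewrite lineE; case: andP => [[/eqP ki /eqP lj]|_]; last by rewrite mulr0 addr0.
  by move: lt; rewrite ki lj ijs ltnn.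
exists (line base (base + delta_mx i j) t) => //.
have [good _] := st; rewrite entry_funE ?(parA_stage sle st) //.
apply: mulf_neq0; first apply: mulf_neq0; first exact: entry_coef_neq0.
  by rewrite lineE !eqxx mulr1 addrAC subrr add0r.
(* For nonzero [j] the last factor is a first-column entry below the corner, which [base] sets to 1
   and the line does not move. *)
have [j0|j0] := eqVneq j 0; first exact: oner_neq0.
rewrite lineE [0 == j]eq_sym (negbTE j0) andbF mulr0 addr0 mxE (negbTE j0) eqxx.
exact: oner_neq0.
Qed.

(** Every matrix preserves the invariant subspace [V]: path elements yield the matrix units of block
    2, and [mxa] and [mxb] spread them over all block positions. A nonzero vector then generates the
    whole space. *)
Lemma irreducible_base : irreducible_rep (rho_of base).
Proof.
move=> V stV; pose st (M : 'M[F]_(5 * m)) := forall v, v \in V -> M *m v \in V.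
have stM M N : st M -> st N -> st (M *m N).
  by move=> hM hN v vV; rewrite -mulmxA; exact/hM/hN.
have stalg phi : group_alg phi -> st (phi (rho_of base)).
  by move=> [_ _ h] v; exact: h.
have [PA _ PB _] := par_pairE base_good.
set P := par_pair base in PA PB.
have [ha haV hb hbV] := gensE P.
have sta : st (mxa P) by rewrite -ha; exact: stV.
have stb : st (mxb P) by rewrite -hb; exact: stV.
have st0 i j k : (parB base - 1%:M) i j * (parB base - 1%:M) j k != 0 ->
    st (unit_block o2 o2 (delta_mx i k)).
  move=> h v vV; have := stalg _ (group_alg_path i j k) v vV.
  rewrite path_eltE ?PA // PB; set c := path_coef i j k * _.
  have c0 : c != 0 by rewrite mulf_neq0 ?path_coef_neq0.
  have -> : unit_block o2 o2 (c *: delta_mx i k) =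
      c *: unit_block o2 o2 (delta_mx i k) :> 'M_(5 * m).
    by apply/matrixP => a b; rewrite !mxE; case: ifP => _; [case: ifP => _|]; rewrite ?mxE ?mulr0.
  by rewrite -scalemxAl => /(memvZ c^-1); rewrite scalerA mulVf // scale1r.
have dE i j : (parB base - 1%:M) i j =
    (if i == 0 then if j == 0 then corner base else 1
     else if j == 0 then 1 else if i == j then 2 else 0) - (i == j)%:R.
  by rewrite !mxE; have [->|] := eqVneq i 0.
have l0 : (lift 0 0 == 0 :> 'I_m) = false by exact: lift_eq0.
have E1 i : st (unit_block o2 o2 (delta_mx i 0)).
  have [->|i0] := eqVneq i 0.
    (* The path through index 1 avoids the corner entry of [B]. *)
    apply: (@st0 0 (lift 0 0) 0); rewrite !dE eqxx !l0 [0 == lift 0 0]eq_sym l0 !subr0.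
    by rewrite mulr1 oner_eq0.
  apply: (@st0 i i 0); rewrite !dE (negbTE i0) !eqxx subr0 mulr1.
  by rewrite subr_eq0 pnatr_eq1.
have E2 i : st (unit_block o2 o2 (delta_mx 0 i)).
  have [->|i0] := eqVneq i 0; first exact: E1.
  apply: (@st0 0 i i); rewrite !dE (negbTE i0) !eqxx [0 == i]eq_sym (negbTE i0) subr0 mul1r.
  by rewrite subr_eq0 pnatr_eq1.
have st2 X : st (unit_block o2 o2 X).
  rewrite [X]matrix_sum_delta; elim/big_ind: _ => [v vV|Y Z hY hZ v vV|i _].
  - rewrite (_ : unit_block _ _ _ = 0) ?mul0mx ?mem0v //.
    by apply/matrixP => a b; rewrite !mxE !if_same mxE if_same.
  - by rewrite -unit_blockD mulmxDl memvD ?hY ?hZ.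
  elim/big_ind: _ => [v vV|Y Z hY hZ v vV|j _].
  - rewrite (_ : unit_block _ _ _ = 0) ?mul0mx ?mem0v //.
    by apply/matrixP => a b; rewrite !mxE !if_same mxE if_same.
  - by rewrite -unit_blockD mulmxDl memvD ?hY ?hZ.
  have -> : unit_block o2 o2 (X i j *: delta_mx i j) =
      X i j *: (unit_block o2 o2 (delta_mx i 0) *m
                unit_block o2 o2 (delta_mx 0 j)) :> 'M_(5 * m).
    rewrite mul_unit_block mul_delta_mx.
    by apply/matrixP => a b; rewrite !mxE; case: ifP => _; [case: ifP => _|]; rewrite ?mxE ?mulr0.
  by move=> v vV; rewrite -scalemxAl memvZ // stM.
pose o k (h : (k < 5)%N) : 'I_5 := Ordinal h.
have rowblock d d' (w : 'I_5 -> 'M[F]_m) p X : st (monomial p w) -> p d = d' ->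
    st (unit_block d o2 X) -> st (unit_block d' o2 (w d *m X)).
  by move=> sp <- sd; rewrite -mul_monomial_unit; exact: stM.
have colblock d c c' (w : 'I_5 -> 'M[F]_m) p X : st (monomial p w) -> injective p ->
    p c' = c -> st (unit_block d c X) -> st (unit_block d c' (X *m w c')).
  by move=> sp pI pc sd; rewrite -(mul_unit_monomial w d X pI pc); exact: stM.
have permaI : injective perma.
  by apply: (@can_inj _ _ _ perma) => -[[|[|[|[|[|//]]]]] h]; exact: val_inj.
have permbI : injective permb.
  by apply: (@can_inj _ _ _ permb) => -[[|[|[|[|[|//]]]]] h]; exact: val_inj.
(* The block rows are reached along 2, 1, 0 and along 2, 3, 4; inverse factors put into [X] cancel
   the blocks met on the way. *)
have R1 X : st (unit_block (@o 1 isT) o2 X).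
  have := @rowblock o2 (@o 1 isT) _ _ (pAV P *m X) sta erefl (st2 _).
  by rewrite /blocks /= mulmxA pAK mul1mx.
have R0 X : st (unit_block (@o 0 isT) o2 X).
  have := @rowblock (@o 1 isT) (@o 0 isT) _ _ (pA P *m pBV P *m pAV P *m X) stb erefl (R1 _).
  rewrite /blocks /= !mulmxA -[pA P *m pB P *m pAV P *m pA P]mulmxA pAVK mulmx1.
  by rewrite -[pA P *m pB P *m pBV P]mulmxA pBK mulmx1 pAK mul1mx.
have R3 X : st (unit_block (@o 3 isT) o2 X).
  by have := @rowblock o2 (@o 3 isT) _ _ X stb erefl (st2 _); rewrite /blocks /= mul1mx.
have R4 X : st (unit_block (@o 4 isT) o2 X).
  by have := @rowblock (@o 3 isT) (@o 4 isT) _ _ X sta erefl (R3 _); rewrite /blocks /= mul1mx.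
have Rall d X : st (unit_block d o2 X).
  case: d => -[|[|[|[|[|//]]]]] h;
    [move: (R0 X)|move: (R1 X)|move: (st2 X)|move: (R3 X)|move: (R4 X)];
    by congr (st (unit_block _ _ _)); exact: val_inj.
have C1 d X : st (unit_block d (@o 1 isT) X).
  have := @colblock d o2 (@o 1 isT) _ _ X sta permaI erefl (Rall _ _).
  by rewrite /blocks /= mulmx1.
have C3 d X : st (unit_block d (@o 3 isT) X).
  have := @colblock d o2 (@o 3 isT) _ _ (X *m pAV P) stb permbI erefl (Rall _ _).
  by rewrite /blocks /= -mulmxA pAVK mulmx1.
have C0 d X : st (unit_block d (@o 0 isT) X).
  have := @colblock d (@o 1 isT) (@o 0 isT) _ _ X stb permbI erefl (C1 _ _).
  by rewrite /blocks /= mulmx1.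
have C4 d X : st (unit_block d (@o 4 isT) X).
  have := @colblock d (@o 3 isT) (@o 4 isT) _ _ (X *m pBV P) sta permaI erefl (C3 _ _).
  by rewrite /blocks /= -mulmxA pBVK mulmx1.
have Call d c X : st (unit_block d c X).
  case: c => -[|[|[|[|[|//]]]]] h;
    [move: (C0 d X)|move: (C1 d X)|move: (Rall d X)|move: (C3 d X)|move: (C4 d X)];
    by congr (st (unit_block _ _ _)); exact: val_inj.
have [->|V0] := eqVneq V 0%VS; [by left|right].
have [r vr0] : exists r, vpick V r 0 != 0.
  apply: contrapT => /forallNP h; case/negP: V0; rewrite -vpick0.
  apply/eqP/matrixP => i j.
  by rewrite ord1 [RHS]mxE; apply/eqP; apply: contra_notT (h i).
have eV s : delta_mx s 0 \in V.
  have : st (delta_mx s r).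
    case: (mxtens_indexP s) => d i; case: (mxtens_indexP r) => c j.
    by rewrite -unit_blockE; exact: Call.
  move=> /(_ _ (memv_pick V)) /(memvZ (vpick V r 0)^-1).
  congr (_ \in V); apply/matrixP => i j; rewrite ord1 !mxE (bigD1 r) //= big1 ?addr0.
    rewrite mxE eqxx andbT; case: (i == s); rewrite ?mul0r ?mulr0 // mul1r mulVf //.
  by move=> k kr; rewrite mxE (negbTE kr) andbF mul0r.
apply/eqP; rewrite eqEsubv subvf; apply/subvP => v _.
rewrite [v]matrix_sum_delta; apply: memv_suml => i _; rewrite big_ord1.
exact/memvZ/eV.
Qed.

End group_ring.

(** Inclusions are strict because the separating invariant vanishes on the closure of one stage but
    not on the next stage. [base] lies in every stage, so its character is already in [Z 0]. *)
Lemma stage_chain : exists Z : nat -> set (char_variety F G (5 * m)),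
  [/\ forall s t, (s <= t)%N -> Z s `<=` Z t,
      forall s, irreducible_closed (Z s),
      forall s, (s < m * m)%N -> Z s `<` Z s.+1 &
      exists rho : SLrep F G (5 * m), irreducible_rep rho /\ Z 0%N (character rho)].
Proof.
have [xa [xaV [xb [xbV gensE]]]] := @rep_generators R F m.
exists (fun s => zariski_closure [set character (rho_of tau) | tau in stage s]).
have mono s t : (s <= t)%N -> [set character (rho_of tau) | tau in stage s] `<=`
    [set character (rho_of tau) | tau in stage t].
  by move=> st _ [tau h <-]; exists tau => //; exact: stage_le h.
split.
- move=> s t st; apply: zariski_closure_min; first exact: zariski_closure_closed.
  by apply: subset_trans (mono _ _ st) _; exact: sub_zariski_closure.
- by move=> s; apply: irreducible_closure; exact: irreducible_stage.
- move=> s sm; split.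
    apply: zariski_closure_min; first exact: zariski_closure_closed.
    by apply: subset_trans (mono _ _ (leqnSn s)) _; exact: sub_zariski_closure.
  have [phi [iphi phi0 [tau st phin]]] := stage_separated gensE sm.
  move=> /(_ (character (rho_of tau))) h; move/eqP: phin; apply.
  rewrite -(char_funE _ iphi); apply: h.
  + by apply: sub_zariski_closure; exists tau.
  + exact: char_fun_regular.
  + by move=> _ [sigma ss <-]; rewrite char_funE // phi0.
- exists (rho_of base); split; first exact: irreducible_base gensE.
  by apply: sub_zariski_closure; exists base => //; exact: stage_base.
Qed.

End flag.

Theorem corollary1p3 (R : realType) (n : nat) (hn : (1 <= n)%N) :
  exists C : set (char_variety R[i] (figure_eight_group R) (10 * n)),
    [/\ irreducible_component C,
        (((4 * n ^ 2 - 1)%N%:R : R)%:E <= krull_dim R C)%E &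
        exists rho : SLrep R[i] (figure_eight_group R) (10 * n),
          irreducible_rep rho /\ C (character rho)].
Proof.
(* Blocks have size [m'.+2], which is [2 * n] for [m' = (2 * n).-2] because [n] is positive. *)
have -> : (10 * n = 5 * (2 * n).-2.+2)%N by lia.
have [Z [Zmono Zirr Zlt [rho [irho Zrho]]]] := @stage_chain R R[i] (2 * n).-2.
set d := (4 * n ^ 2 - 1)%N.
(* A component above [Z d] contains the whole chain [Z 0, .., Z d], of length [d]. *)
have [C [compC ZC]] := irreducible_component_exists (Zirr d).
exists C; split=> //.
- apply: (@krull_dim_ge _ _ _ _ _ _ Z) => s sd; last first.
    by apply: Zlt; rewrite /d in sd; nia.
  by split=> //; apply: subset_trans ZC; exact: Zmono.
- by exists rho; split=> //; apply: ZC; apply: Zmono Zrho.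
Qed.
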